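(* Let $\Omega\subset\mathbb{R}^n$ be a bounded Lipschitz domain and let $f:\Omega\times\Omega\times\mathbb{R}\times\mathbb{R}\to[0,\infty)$ be a Carathéodory function (measurable in the first two and continuous with respect to the last two variables) satisfying: (1) there exist $M,\delta>0$ and $\beta\in[0,1]$ such that for all $\xi,\zeta\in\mathbb{R}$, $$f(x,y,\xi,\zeta)\le M\Bigl(\frac{|\xi-\zeta|}{|x-y|^\beta}+|\xi|+|\zeta|+1\Bigr)\quad\text{for a.e. }x,y\in\Omega,$$ and $$M^{-1}\frac{|\xi-\zeta|}{|x-y|^\beta}-M\le f(x,y,\xi,\zeta)\quad\text{for a.e. }x,y\in\Omega\text{ with }|x-y|<\delta;$$ (2) $f$ is separately convex in its last two variables, i.e. $f(x,y,\cdot,\zeta)$ and $f(x,y,\xi,\cdot)$ are convex for a.e. $x,y\in\Omega$ and every $\xi,\zeta\in\mathbb{R}$; (3) $f$ is (jointly) level convex in its last two variables, i.e. the sub-level sets of $(\xi,\zeta)\mapsto f(x,y,\xi,\zeta)$ are convex. For $p\in[1,\infty)$ and $u\in L^2(\Omega)$ set $$\mathcal{R}_p(u):=\Bigl(\frac{1}{|\Omega\times\Omega|}\int_\Omega\int_\Omega f^p(x,y,u(x),u(y))\,\mathrm{d}x\,\mathrm{d}y\Bigr)^{1/p},\qquad \mathcal{R}_\infty(u):=\operatorname*{ess\,sup}_{(x,y)\in\Omega\times\Omega}f(x,y,u(x),u(y)),$$ with values in $[0,\infty]$. Then, for every $p\in[1,\infty]$, the Mosco-limit below exists and $$\overline{\mathcal{R}}_p:=\mathrm{Mosc}(L^2)\text{-}\lim_{p'\to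 p}\mathcal{R}_{p'}=\begin{cases}\mathcal{R}_p&\text{if }p\in[1,\infty),\\ \mathcal{R}_\infty&\text{if }p=\infty.\end{cases}$$
   Context: Mosco-convergence: for $\mathcal{F}_k,\mathcal{F}:L^2(\Omega)\to[0,\infty]$, $\mathcal{F}=\mathrm{Mosc}(L^2)\text{-}\lim_k\mathcal{F}_k$ means: (liminf inequality) whenever $u_k\rightharpoonup u$ weakly in $L^2(\Omega)$, $\mathcal{F}(u)\le\liminf_k\mathcal{F}_k(u_k)$; and (limsup inequality) for every $u\in L^2(\Omega)$ there is a sequence $u_k\to u$ strongly in $L^2(\Omega)$ with $\mathcal{F}(u)\ge\limsup_k\mathcal{F}_k(u_k)$. The statement $\mathrm{Mosc}(L^2)\text{-}\lim_{p'\to p}\mathcal{R}_{p'}=\mathcal{F}$ means that $\mathrm{Mosc}(L^2)\text{-}\lim_k\mathcal{R}_{p_k}=\mathcal{F}$ for every sequence $(p_k)_k\subset[1,\infty)$ with $p_k\to p$ in $[1,\infty]$. *)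

(* Defs.v *)
From HB Require Import structures.
From mathcomp Require Import all_boot all_order all_algebra.
From mathcomp Require Import all_classical all_reals all_analysis measurable_realfun ess_sup_inf.

Set Implicit Arguments.
Unset Strict Implicit.
Unset Printing Implicit Defensive.

Import Order.TTheory GRing.Theory Num.Theory.
Import numFieldNormedType.Exports.

Local Open Scope classical_set_scope.
Local Open Scope ring_scope.

(* R^n is 'rV[R]_n, with its normed-space topology (max norm) and the Borel
   sigma-algebra of that topology. *)
Definition measure_rV_display : measure_display. Proof. exact. Qed.

Section borel_rV.
Context (R : realType) (n : nat).

Let rV_set0 : <<s @open 'rV[R]_n >> set0.
Proof. exact: sigma_algebra0. Qed.

Let rV_setC A : <<s @open 'rV[R]_n >> A -> <<s @open 'rV[R]_n >> (~` A).
Proof. exact: sigma_algebraC. Qed.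

Let rV_bigcup (F : (set 'rV[R]_n)^nat) : (forall i, <<s @open 'rV[R]_n >> (F i)) ->
  <<s @open 'rV[R]_n >> (\bigcup_i (F i)).
Proof. exact: sigma_algebra_bigcup. Qed.

HB.instance Definition _ := @isMeasurable.Build measure_rV_display
  'rV[R]_n <<s @open 'rV[R]_n >> rV_set0 rV_setC rV_bigcup.

End borel_rV.

Section borel_rV_lemmas.
Context (R : realType).

Lemma open_measurable_rV n (U : set 'rV[R]_n) : open U -> measurable U.
Proof. exact: sub_sigma_algebra. Qed.

Lemma continuous_measurable_rV n m (g : 'rV[R]_n -> 'rV[R]_m) :
  continuous g -> measurable_fun setT g.
Proof.
move=> /continuousP cg; apply: (@measurability _ _ _ _ _ g open) => //.
by move=> _ [U oU <-]; rewrite setTI; apply: open_measurable_rV; exact: cg.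
Qed.

Lemma measurable_coord_rV n (i : 'I_n) :
  measurable_fun [set: 'rV[R]_n] (fun x : 'rV[R]_n => x ord0 i).
Proof.
apply: (measurability _ (RGenOpens.measurableE R)).
move=> _ [_ [a [b ->] <-]]; rewrite setTI; apply: open_measurable_rV.
have /continuousP := @coord_continuous R 1 n ord0 i.
by apply; exact: interval_open.
Qed.

Lemma ball_rVE n (x : 'rV[R]_n) (e : R) : 0 < e ->
  ball x e = \bigcap_(i in [set: 'I_n])
    ((fun y : 'rV[R]_n => y ord0 i) @^-1` ball (x ord0 i) e).
Proof.
move=> e0; apply/seteqP; split=> y.
  by move=> [_ xy] i _; exact: xy.
by move=> xy; split=> // i j; rewrite !ord1; exact: xy.
Qed.

Lemma open_rV_ratball n (U : set 'rV[R]_n) : open U ->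
  U = \bigcup_(qk in [set qk : 'rV[rat]_n * nat |
        ball (map_mx ratr qk.1 : 'rV[R]_n) (qk.2.+1%:R^-1) `<=` U])
      ball (map_mx ratr qk.1 : 'rV[R]_n) (qk.2.+1%:R^-1).
Proof.
move=> oU; apply/seteqP; split=> [x Ux|x [qk /= qkU xqk]]; last exact: qkU.
have /nbhs_ballP[e /= e0 xeU] : nbhs x U by exact: open_nbhs_nbhs.
have [k ke] : exists k, (k.+1%:R^-1 : R) < e / 2.
  have e20 : 0 < e / 2 by rewrite divr_gt0.
  by have /filter_ex[k ke] := near_infty_natSinv_lt (PosNum e20); exists k.
have k0 : 0 < (k.+1%:R^-1 : R) by rewrite invr_gt0.
have Hq (i : 'I_n) : exists q : rat, ball (x ord0 i) (k.+1%:R^-1) (ratr q : R).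
  have xk : x ord0 i - k.+1%:R^-1 < x ord0 i + k.+1%:R^-1.
    by rewrite ltrBlDr -addrA ltrDl addr_gt0.
  have [q] := rat_in_itvoo xk.
  rewrite in_itv/= => /andP[q1 q2]; exists q.
  by rewrite /ball/= ltr_distlC q1 q2.
pose q : 'rV[rat]_n := \row_i projT1 (cid (Hq i)).
have bq : ball (map_mx ratr q : 'rV[R]_n) (k.+1%:R^-1) x.
  rewrite ball_rVE// => i _ /=; rewrite !mxE.
  by apply: ball_sym; exact: (projT2 (cid (Hq i))).
exists (q, k) => //= y qy; apply: xeU.
rewrite (splitr e).
apply: (@ball_triangle _ _ (map_mx ratr q : 'rV[R]_n)) => //.
  by apply: ball_sym; apply: le_ball bq; exact: ltW.
by apply: le_ball qy; exact: ltW.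
Qed.

Lemma measurable_fun_rVP d (T : measurableType d) n (g : T -> 'rV[R]_n) :
  (forall i : 'I_n, measurable_fun setT (fun t => g t ord0 i)) ->
  measurable_fun setT g.
Proof.
move=> mg; apply: (@measurability _ _ _ _ _ g open) => //.
move=> _ [U oU <-]; rewrite setTI (open_rV_ratball oU) preimage_bigcup.
rewrite bigcup_mkcond; apply: countable_bigcupT_measurable => //= qk.
case: ifPn => // _; rewrite ball_rVE ?invr_gt0// preimage_bigcap.
apply: fin_bigcap_measurable => //= i _.
rewrite -comp_preimage -[X in measurable X]setTI; apply: mg => //.
by apply: open_measurable; apply: ball_open; rewrite invr_gt0.
Qed.

End borel_rV_lemmas.

Section lebesgue_rV.
Context (R : realType).

Definition cons_rV n (z : R * 'rV[R]_n) : 'rV[R]_n.+1 := row_mx z.1%:M z.2.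

Definition uncons_rV n (x : 'rV[R]_n.+1) : R * 'rV[R]_n :=
  (x ord0 ord0, \row_j x ord0 (lift ord0 j)).

Lemma cons_rVK n : cancel (@cons_rV n) (@uncons_rV n).
Proof.
move=> [a v]; rewrite /uncons_rV /cons_rV/=; congr pair.
  transitivity (row_mx (a%:M : 'rV_1) v ord0 (lshift n ord0)).
    by congr (fun_of_matrix _ _ _); exact/val_inj.
  by rewrite row_mxEl mxE eqxx.
apply/rowP => j; rewrite mxE.
transitivity (row_mx (a%:M : 'rV_1) v ord0 (rshift 1 j)).
  by congr (fun_of_matrix _ _ _); exact/val_inj.
by rewrite row_mxEr.
Qed.

Lemma measurable_cons_rV n : measurable_fun setT (@cons_rV n).
Proof.
apply: measurable_fun_rVP => i.
have [j ->|->] := unliftP ord0 i.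
  rewrite (_ : (fun _ => _) = (fun y : 'rV[R]_n => y ord0 j) \o snd).
    exact: measurableT_comp (measurable_coord_rV j) measurable_snd.
  apply/funext => -[a v] /=.
  by have := congr1 (fun z : R * 'rV[R]_n => z.2 ord0 j) (cons_rVK (a, v)); rewrite /= mxE.
rewrite (_ : (fun _ => _) = fst); first exact: measurable_fst.
by apply/funext => -[a v]; exact: (congr1 fst (cons_rVK (a, v))).
Qed.

Lemma measurable_uncons_rV n : measurable_fun setT (@uncons_rV n).
Proof.
apply/measurable_fun_pairP; split => /=.
  exact: measurable_coord_rV.
apply: measurable_fun_rVP => i.
rewrite (_ : (fun _ => _) = (fun y : 'rV[R]_n.+1 => y ord0 (lift ord0 i))).
  exact: measurable_coord_rV.
by apply/funext => x /=; rewrite mxE.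
Qed.

Section step.
Context n (m : {sigma_finite_measure set 'rV[R]_n -> \bar R}).
Local Open Scope ereal_scope.

Definition cons_measure : set 'rV[R]_n.+1 -> \bar R :=
  fun A => (@lebesgue_measure R \x m) (@cons_rV n @^-1` A).

Let cons_measure0 : cons_measure set0 = 0.
Proof. by rewrite /cons_measure preimage_set0 measure0. Qed.

Let cons_measure_ge0 A : 0 <= cons_measure A.
Proof. exact: measure_ge0. Qed.

Let mpre A : measurable A -> measurable (@cons_rV n @^-1` A).
Proof. by move=> mA; rewrite -[X in measurable X]setTI; exact: measurable_cons_rV. Qed.

Let cons_measure_sigma_additive : semi_sigma_additive cons_measure.
Proof.
move=> F mF tF mUF; rewrite /cons_measure preimage_bigcup.
apply: measure_semi_sigma_additive.
- by move=> k; exact: mpre.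
- apply/trivIsetP => /= i j _ _ ij; rewrite -preimage_setI.
  by move/trivIsetP : tF => /(_ _ _ _ _ ij) ->//; rewrite preimage_set0.
- by rewrite -preimage_bigcup; exact: mpre.
Qed.

HB.instance Definition _ := isMeasure.Build _ _ _ cons_measure
  cons_measure0 cons_measure_ge0 cons_measure_sigma_additive.

Lemma cons_measureX (A : set R) (B : set 'rV[R]_n) : measurable A -> measurable B ->
  cons_measure (@uncons_rV n @^-1` (A `*` B)) = (@lebesgue_measure R A * m B)%E.
Proof.
move=> mA mB; rewrite /cons_measure -comp_preimage.
rewrite (_ : _ \o _ = id); last by apply/funext => z /=; exact: cons_rVK.
by rewrite preimage_id product_measure1E.
Qed.

Let cons_measure_sigma_finite : sigma_finite setT cons_measure.
Proof.
have [F FT Foo] := sigma_finiteT (@lebesgue_measure R).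
have [G GT Goo] := sigma_finiteT m.
have mU (A : set (R * 'rV[R]_n)) : measurable A -> measurable (@uncons_rV n @^-1` A).
  by move=> mA; rewrite -[X in measurable X]setTI; exact: measurable_uncons_rV.
pose H (k : nat) : set (R * 'rV[R]_n) :=
  let ij := odflt (0%N, 0%N) (unpickle k) in F ij.1 `*` G ij.2.
have mH k : measurable (H k).
  by apply: measurableX; [exact: (Foo _).1|exact: (Goo _).1].
exists (fun k => @uncons_rV n @^-1` H k).
  apply/esym; rewrite -preimage_bigcup -subTset => x _ /=.
  have [i _ Fi] : (\bigcup_i F i) (uncons_rV x).1 by rewrite -FT.
  have [j _ Gj] : (\bigcup_i G i) (uncons_rV x).2 by rewrite -GT.
  by exists (pickle (i, j)) => //; rewrite /H pickleK.
move=> k; split; first exact: mU.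
have [[mF Foo'] [mG Goo']] := (Foo (odflt (0%N, 0%N) (unpickle k)).1,
  Goo (odflt (0%N, 0%N) (unpickle k)).2).
rewrite cons_measureX//.
by rewrite lte_mul_pinfty// ge0_fin_numE.
Qed.

HB.instance Definition _ := Measure_isSigmaFinite.Build _ _ _ cons_measure
  cons_measure_sigma_finite.

End step.

(* Lebesgue measure on the Borel sets of R^n, by recursion on n through
   R^(n+1) = R x R^n; the Dirac mass is the convention for R^0. *)
Fixpoint lebesgue_measure_rV n : {sigma_finite_measure set 'rV[R]_n -> \bar R} :=
  match n with
  | 0 => [the {sigma_finite_measure set 'rV[R]_0 -> \bar R} of \d_(0 : 'rV[R]_0)]
  | n'.+1 => [the {sigma_finite_measure set 'rV[R]_n'.+1 -> \bar R} of
                cons_measure (lebesgue_measure_rV n')]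
  end.

End lebesgue_rV.

(* Euclidean norm: the library norm of 'rV[R]_n is the max norm. *)
Definition enorm (R : realType) n (v : 'rV[R]_n) : R :=
  Num.sqrt (\sum_i v ord0 i ^+ 2).

(* Near each boundary point, in the orthonormal coordinates x *m Q, the set is
   the strict epigraph in direction i of a Lipschitz function of the other
   n - 1 coordinates. *)
Definition lipschitz_boundary (R : realType) n (Omega : set 'rV[R]_n) :=
  forall x0, (closure Omega `\` interior Omega) x0 ->
    exists (Q : 'M[R]_n) (i : 'I_n) (gamma : 'rV[R]_n.-1 -> R^o),
      [/\ Q *m Q^T = 1%:M, lipschitz gamma &
          \forall x \near x0,
            Omega x <-> gamma (col' i (x *m Q)) < (x *m Q) ord0 i].

Record bounded_lipschitz_domain (R : realType) (n : nat) := BoundedLipschitzDomain {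
  domain_set :> set 'rV[R]_n ;
  domain_open : open domain_set ;
  domain_connected : connected domain_set ;
  domain_nonempty : domain_set !=set0 ;
  domain_bounded : bounded_set domain_set ;
  domain_lipschitz : lipschitz_boundary domain_set }.

Lemma measurable_domain (R : realType) n (Omega : bounded_lipschitz_domain R n) :
  measurable (Omega : set 'rV[R]_n).
Proof. by apply: open_measurable_rV; exact: domain_open. Qed.

Section mosco.
Context d (T : measurableType d) (R : realType).
Variable mu : {measure set T -> \bar R}.
Implicit Types (u v : LspaceType2 mu) (us : nat -> LspaceType2 mu).

(* The continuous linear functionals on L^2 are the pairings with some v in L^2. *)
Definition weak_cvg us u := forall v,
  (fun k => \int[mu]_x (us k x * v x)) @ \oo --> \int[mu]_x (u x * v x).

Definition strong_cvg us u :=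
  (fun k => 'N[mu]_2[EFin \o (us k \- u)%R])%E @ \oo --> 0%E.

Definition mosco_cvg (F_ : nat -> LspaceType2 mu -> \bar R)
    (F : LspaceType2 mu -> \bar R) :=
  (forall us u, weak_cvg us u ->
    (F u <= limn_einf (fun k => F_ k (us k)))%E) /\
  (forall u, exists2 us, strong_cvg us u &
    (limn_esup (fun k => F_ k (us k)) <= F u)%E).

End mosco.

Section nonlocal.
Context (R : realType) (n : nat) (Omega : bounded_lipschitz_domain R n).
Implicit Type f : 'rV[R]_n -> 'rV[R]_n -> R -> R -> R.

Let Omega2 : set ('rV[R]_n * 'rV[R]_n) := Omega `*` Omega.

Definition leb := lebesgue_measure_rV R n.
Definition leb2 : {measure set ('rV[R]_n * 'rV[R]_n)%type -> \bar R} :=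
  (leb \x leb)%E.

Definition leb_on : {measure set 'rV[R]_n -> \bar R} :=
  mrestr leb (measurable_domain Omega).

Definition leb2_on : {measure set ('rV[R]_n * 'rV[R]_n)%type -> \bar R} :=
  mrestr leb2 (measurableX (measurable_domain Omega) (measurable_domain Omega)).

(* completed_algebra_gen leb2 is the completion of the Borel sigma-algebra of
   R^n x R^n, so z |-> f z.1 z.2 xi zeta is only required to be Lebesgue
   measurable on Omega x Omega. *)
Definition caratheodory f :=
  (forall xi zeta (B : set R), measurable B ->
    completed_algebra_gen leb2
      (Omega2 `&` [set z | B (f z.1 z.2 xi zeta)])) /\
  {ae leb2, forall z, Omega2 z ->
    continuous (fun w : R * R => f z.1 z.2 w.1 w.2)}.

(* The value of the quotient on the diagonal (a null set, as n > 0) is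
   irrelevant. *)
Definition growth f :=
  exists M delta beta : R, [/\ 0 < M, 0 < delta, 0 <= beta <= 1,
    (forall xi zeta, {ae leb2, forall z, Omega2 z ->
      f z.1 z.2 xi zeta <=
        M * (`|xi - zeta| / enorm (z.1 - z.2) `^ beta + `|xi| + `|zeta| + 1)}) &
    (forall xi zeta, {ae leb2, forall z, Omega2 z -> enorm (z.1 - z.2) < delta ->
      M^-1 * (`|xi - zeta| / enorm (z.1 - z.2) `^ beta) - M <=
        f z.1 z.2 xi zeta})].

Definition separately_convex f :=
  {ae leb2, forall z, Omega2 z ->
    (forall zeta, @convex_function R R^o setT (fun xi => f z.1 z.2 xi zeta)) /\
    (forall xi, @convex_function R R^o setT (fun zeta => f z.1 z.2 xi zeta))}.

Definition level_convex f :=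
  {ae leb2, forall z, Omega2 z -> forall c : R,
    @convex_set R (R^o * R^o)%type
      [set w : R^o * R^o | f z.1 z.2 w.1 w.2 <= c]}.

(* Elements u of L^2(Omega) are a.e.-classes, evaluated through a Borel
   representative whose choice does not affect the two functionals below.  The
   integrand is nonnegative and Lebesgue measurable; on such functions the
   library integral against the Borel measure leb2, a supremum over Borel
   simple functions from below, agrees with the integral against its
   completion. *)
Definition double_integral f (r : R) (u : LspaceType2 leb_on) : \bar R :=
  (((leb2 Omega2)^-1 *
    \int[leb2]_(z in Omega2) ((f z.1 z.2 (u z.1) (u z.2) `^ r)%R)%:E) `^ r^-1)%E.

Definition supremal f (u : LspaceType2 leb_on) : \bar R :=
  ess_sup leb2_on (fun z => (f z.1 z.2 (u z.1) (u z.2))%:E).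

(* Only exponents p >= 1 are meaningful. *)
Definition nonlocal_functional f (p : \bar R) (u : LspaceType2 leb_on) : \bar R :=
  match p with
  | r%:E => double_integral f r u
  | +oo%E => supremal f u
  | -oo%E => 0%E
  end.

End nonlocal.

(* Main.v *)
From HB Require Import structures.
Require Import Defs.
From mathcomp Require Import all_boot all_order all_algebra.
From mathcomp Require Import all_classical all_reals all_analysis.
From mathcomp Require Import measurable_realfun ess_sup_inf ring lra zify.
Import Order.TTheory GRing.Theory Num.Theory.
Import numFieldNormedType.Exports.
Import HBNNSimple.

Set Implicit Arguments.
Unset Strict Implicit.
Unset Printing Implicit Defensive.

Local Open Scope classical_set_scope.
Local Open Scope ring_scope.

(** * Convex functions of one and two real variables *)

Section convexity.
Context {R : realType}.
Implicit Types (phi : R -> R) (g : R -> R -> R).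

Definition convex_on_line phi := forall t a b, 0 <= t -> t <= 1 ->
  phi (t * a + (1 - t) * b) <= t * phi a + (1 - t) * phi b.

Lemma convex_three_points phi : convex_on_line phi ->
  forall a b c, a <= b -> b <= c ->
  (phi b - phi a) * (c - b) <= (phi c - phi b) * (b - a).
Proof.
move=> cphi a b c ab bc.
have [ac|ac] := eqVneq a c.
  have -> : b = a by apply/eqP; rewrite eq_le ab ac bc.
  by rewrite !subrr mul0r mulr0.
have ca0 : 0 < c - a by move: ac; rewrite neq_lt => /orP[]; lra.
have t0 : 0 <= (c - b) / (c - a) by rewrite divr_ge0//; lra.
have t1 : (c - b) / (c - a) <= 1 by rewrite ler_pdivrMr//; lra.
have := cphi _ a c t0 t1.
have -> : (c - b) / (c - a) * a + (1 - (c - b) / (c - a)) * c = b.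
  by field; lra.
rewrite -(ler_pM2l ca0) => H.
have E : (c - a) * ((c - b) / (c - a) * phi a + (1 - (c - b) / (c - a)) * phi c)
   = (c - b) * phi a + (b - a) * phi c by field; lra.
by rewrite E in H; nra.
Qed.

Lemma convex_lipschitz phi (B N : R) : convex_on_line phi ->
  (forall s, 0 <= phi s) -> (forall s, `|s| <= N + 2 -> phi s <= B) ->
  forall s t, `|s| <= N + 1 -> `|t| <= N + 1 ->
  `|phi s - phi t| <= B * `|s - t|.
Proof.
move=> cphi phi0 phiB s t sN tN.
wlog st : s t sN tN / s <= t.
  move=> H; have [|ts] := leP s t; first exact: H.
  by rewrite distrC (distrC s); apply: H => //; exact: ltW.
rewrite ler_norml in sN; rewrite ler_norml in tN.
have h1 := convex_three_points cphi st (ltac:(lra) : t <= t + 1).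
have h2 := convex_three_points cphi (ltac:(lra) : s - 1 <= s) st.
have b1 : phi (t + 1) <= B by apply: phiB; rewrite ler_norml; lra.
have b2 : phi (s - 1) <= B by apply: phiB; rewrite ler_norml; lra.
have := phi0 s; have := phi0 t => p1 p2.
rewrite (distrC s) (@ger0_norm _ (t - s)) ?ler_norml; last by lra.
apply/andP; split; nra.
Qed.

(** Replacing the derivative at [a] by a forward difference quotient costs
    only an error of order [h]; unlike a subgradient, the quotient depends
    continuously on parameters. *)
Lemma convex_above_quotient phi (L a h : R) : convex_on_line phi -> 0 < h ->
  (forall s, a <= s -> s <= a + h -> `|phi s - phi a| <= L * `|s - a|) ->
  forall xi, phi a + (phi (a + h) - phi a) / h * (xi - a) - 2 * L * h <= phi xi.
Proof.
move=> cphi h0 Lip xi.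
set D := _ / h.
have DE : D * h = phi (a + h) - phi a by rewrite /D; field; lra.
have Lh : `|phi (a + h) - phi a| <= L * h.
  have := Lip (a + h) (ltac:(lra)) (lexx _).
  by rewrite (_ : a + h - a = h) ?(gtr0_norm h0)//; ring.
have L0 : 0 <= L * h by exact: le_trans Lh.
have DL : `|D| <= L.
  by rewrite -(ler_pM2r h0) -{1}(gtr0_norm h0) -normrM DE.
have [xia|axi] := leP xi a.
  have := convex_three_points cphi xia (ltac:(lra) : a <= a + h).
  rewrite (_ : a + h - a = h); last by ring.
  rewrite -DE => H.
  have : phi a - phi xi <= D * (a - xi) by rewrite -(ler_pM2r h0); lra.
  by lra.
have [xih|hxi] := leP (a + h) xi.
  have := convex_three_points cphi (ltac:(lra) : a <= a + h) xih.
  rewrite (_ : a + h - a = h); last by ring.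
  rewrite -DE => H.
  have : D * (xi - (a + h)) <= phi xi - phi (a + h).
    by rewrite -(ler_pM2r h0); lra.
  by lra.
have := Lip xi (ltW axi) (ltW hxi).
rewrite (@gtr0_norm _ (xi - a)) ?subr_gt0//.
rewrite ler_norml => /andP[H _].
have L0' : 0 <= L by exact: le_trans DL.
have D1 : D * (xi - a) <= L * (xi - a).
  by apply: ler_wpM2r; [lra | exact: le_trans (ler_norm _) DL].
have D2 : L * (xi - a) <= L * h by apply: ler_wpM2l => //; lra.
lra.
Qed.

(** The affine minorant of [g (., zeta)] at [a] may be computed at a nearby
    parameter [zeta'], at the price of an error linear in [xi]: near [a] this is
    the Lipschitz bound, far from [a] convexity propagates it along the ray. *)
Lemma convex_above_frozen_quotient g (B N a zeta zeta' h : R) :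
  (forall eta, convex_on_line (g ^~ eta)) ->
  (forall xi, convex_on_line (g xi)) ->
  (forall xi eta, 0 <= g xi eta) ->
  (forall xi eta, `|xi| <= N + 2 -> `|eta| <= N + 2 -> g xi eta <= B) ->
  `|a| <= N -> `|zeta| <= N -> `|zeta - zeta'| <= h -> 0 < h -> h <= 1 ->
  forall xi, g a zeta + (g (a + h) zeta' - g a zeta') / h * (xi - a)
    - 4 * B * h * (1 + `|xi - a|) <= g xi zeta.
Proof.
move=> c1 c2 g0 gB aN zN zz h0 h1 xi.
have N0 : 0 <= N by exact: le_trans (normr_ge0 _) aN.
have B0 : 0 <= B by apply: le_trans (g0 0 0) (gB _ _ _ _); rewrite normr0; lra.
have z'N : `|zeta'| <= N + 1.
  by move: zN zz; rewrite !ler_norml => /andP[? ?] /andP[? ?]; apply/andP; split; lra.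
have lip1 : forall eta, `|eta| <= N + 2 -> forall s t, `|s| <= N + 1 -> `|t| <= N + 1 ->
    `|g s eta - g t eta| <= B * `|s - t|.
  move=> eta etaN s t sN tN; apply: (convex_lipschitz (N := N) (c1 eta)) => //.
  by move=> r rN; exact: gB.
have lip2 : forall eta, `|eta| <= N + 2 -> forall s t, `|s| <= N + 1 -> `|t| <= N + 1 ->
    `|g eta s - g eta t| <= B * `|s - t|.
  move=> eta etaN s t sN tN; apply: (convex_lipschitz (N := N) (c2 eta)) => //.
  by move=> r rN; exact: gB.
set D := _ / h.
have near x : `|x - a| <= 1 -> g a zeta + D * (x - a) - 4 * B * h <= g x zeta.
  move=> xa.
  have xN : `|x| <= N + 1.
    by move: aN xa; rewrite !ler_norml => /andP[? ?] /andP[? ?]; apply/andP; split; lra.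
  have Q := convex_above_quotient (c1 zeta') h0 (L := B) (a := a) _ x.
  have {}Q : g a zeta' + D * (x - a) - 2 * B * h <= g x zeta'.
    apply: Q => s s1 s2; apply: lip1; [lra| |lra].
    by move: aN; rewrite !ler_norml => /andP[? ?]; apply/andP; split; lra.
  have A1 : `|g x zeta - g x zeta'| <= B * `|zeta - zeta'| by apply: lip2 => //; lra.
  have A2 : `|g a zeta - g a zeta'| <= B * `|zeta - zeta'| by apply: lip2 => //; lra.
  have A3 : B * `|zeta - zeta'| <= B * h by apply: ler_wpM2l.
  move: A1 A2; rewrite !ler_norml => /andP[? ?] /andP[? ?]; lra.
have [xa|xa] := leP `|xi - a| 1.
  have := near _ xa; have := normr_ge0 (xi - a) => ? ?.
  have ? : 0 <= B * h by apply: mulr_ge0 => //; exact: ltW.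
  nra.
set r := `|xi - a| in xa *.
have r0 : 0 < r by lra.
pose eta := a + (xi - a) / r.
have etaE : eta - a = (xi - a) / r by rewrite /eta; ring.
have eta1 : `|eta - a| <= 1.
  by rewrite etaE normrM normfV (gtr0_norm r0) -/r divff//; lra.
have conv : g eta zeta <= r^-1 * g xi zeta + (1 - r^-1) * g a zeta.
  have -> : eta = r^-1 * xi + (1 - r^-1) * a by rewrite /eta; field; lra.
  by apply: c1; rewrite ?invr_ge0 ?(ltW r0)// invf_le1// ltW.
have := near _ eta1; rewrite etaE => H.
have H2 := le_trans H conv.
rewrite -(ler_pM2l r0) in H2.
have E1 : r * (g a zeta + D * ((xi - a) / r) - 4 * B * h) =
   r * g a zeta + D * (xi - a) - 4 * B * h * r by field; lra.
have E2 : r * (r^-1 * g xi zeta + (1 - r^-1) * g a zeta) =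
   g xi zeta + (r - 1) * g a zeta by field; lra.
rewrite E1 E2 in H2.
have ? : 0 <= B * h by apply: mulr_ge0 => //; exact: ltW.
lra.
Qed.

End convexity.

(** * Measurability and integral inequalities *)

Section floor_approximation.
Context {R : realType}.

(** Largest multiple of [h] below [t]: a measurable choice, with countably many
    values, of a point at distance at most [h]. *)
Definition floor_mul (h t : R) : R := h * (Num.floor (t / h))%:~R.

Lemma floor_mul_near (h t : R) : 0 < h -> `|t - floor_mul h t| <= h.
Proof.
move=> h0; rewrite /floor_mul.
have -> : t - h * (Num.floor (t / h))%:~R = h * (t / h - (Num.floor (t / h))%:~R).
  by field; lra.
rewrite normrM (gtr0_norm h0) -[leRHS]mulr1 ler_pM2l//.
have := floor_le (t / h); have := floorD1_gt (t / h).
rewrite intrD ler_norml => ? ?; apply/andP; split; lra.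
Qed.

Lemma measurable_floor_mul (h : R) : 0 < h -> measurable_fun setT (floor_mul h).
Proof.
move=> h0; apply: nondecreasing_measurable => // x y xy.
rewrite /floor_mul ler_pM2l// ler_int le_floor//.
by rewrite ler_pM2r// invr_gt0.
Qed.

Lemma floor_mul_cvg (t : R) :
  floor_mul (n.+1%:R^-1) t @[n --> \oo] --> t.
Proof.
apply/cvgrPdist_le => e e0.
have [N _ HN] := near_infty_natSinv_lt (PosNum e0).
exists N => // n /= Nn.
by rewrite (le_trans (floor_mul_near _ _)) ?invr_gt0// ltW// HN.
Qed.

End floor_approximation.

Section caratheodory_composition.
Context d (T : measurableType d) {R : realType}.
Variable g : T -> R -> R -> R.
Hypothesis mg : forall xi zeta, measurable_fun setT (fun z => g z xi zeta).
Hypothesis cg : forall z, continuous (fun w : R * R => g z w.1 w.2).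
Variables a b : T -> R.
Hypotheses (ma : measurable_fun setT a) (mb : measurable_fun setT b).

Let measurable_step (h : R) : 0 < h ->
  measurable_fun setT (fun z => g z (floor_mul h (a z)) (floor_mul h (b z))).
Proof.
move=> h0 _ B mB; rewrite setTI.
pose q (c : T -> R) z := Num.floor (c z / h).
have mq (c : T -> R) i : measurable_fun setT c -> measurable [set z | q c z = i].
  move=> mc.
  have := (measurableT_comp (measurable_floor_mul h0) mc) measurableT
    _ (measurable_set1 (h * i%:~R)).
  rewrite setTI; congr measurable; apply/seteqP; split => z /=.
    by rewrite /floor_mul => /(mulfI (lt0r_neq0 h0))/intr_inj.
  by rewrite /floor_mul /q => ->.
rewrite [X in measurable X](_ : _ = \bigcup_(ij : int * int)
    ([set z | q a z = ij.1] `&` [set z | q b z = ij.2] `&`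
     ((fun z => g z (h * ij.1%:~R) (h * ij.2%:~R)) @^-1` B))).
  apply: countable_bigcupT_measurable => //= -[i j].
  apply: measurableI; first by apply: measurableI; exact: mq.
  by rewrite -[X in measurable X]setTI; exact: mg.
apply/seteqP; split => [z /= Bz|z [[i j] _ /= [[<- <-]]]//].
by exists (q a z, q b z).
Qed.

Lemma measurable_caratheodory : measurable_fun setT (fun z => g z (a z) (b z)).
Proof.
apply: (measurable_fun_cvg (h := fun n z =>
  g z (floor_mul (n.+1%:R^-1) (a z)) (floor_mul (n.+1%:R^-1) (b z)))).
  by move=> n; apply: measurable_step; rewrite invr_gt0.
move=> z _.
have ca := @floor_mul_cvg _ (a z); have cb := @floor_mul_cvg _ (b z).
exact: (cvg_comp2 ca cb (@cg z (a z, b z))).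
Qed.

End caratheodory_composition.

Section real_integral.
Context d (T : measurableType d) {R : realType}.
Variable mu : {measure set T -> \bar R}.
Implicit Types (f g : T -> R).

Definition itg f : \bar R := (\int[mu]_x (f x)%:E)%E.

Lemma itg_ge0 f : (forall x, 0 <= f x) -> (0 <= itg f)%E.
Proof. by move=> f0; apply: integral_ge0 => x _; rewrite lee_fin. Qed.

Lemma le_itg f g : measurable_fun setT f -> measurable_fun setT g ->
  (forall x, 0 <= f x) -> (forall x, f x <= g x) -> (itg f <= itg g)%E.
Proof.
move=> mf mg f0 fg; apply: ge0_le_integral => //.
- by move=> x _; rewrite lee_fin.
- exact/measurable_EFinP.
- exact/measurable_EFinP.
- by move=> x _; rewrite lee_fin.
Qed.

Lemma ae_le_itg f g : measurable_fun setT f -> measurable_fun setT g ->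
  (forall x, 0 <= f x) -> (forall x, 0 <= g x) ->
  {ae mu, forall x, f x <= g x} -> (itg f <= itg g)%E.
Proof.
move=> mf mg f0 g0 fg; apply: ae_ge0_le_integral => //.
- by move=> x _; rewrite lee_fin.
- exact/measurable_EFinP.
- by move=> x _; rewrite lee_fin.
- exact/measurable_EFinP.
- by apply: filterS fg => x fg _; rewrite lee_fin.
Qed.

Lemma itgD f g : measurable_fun setT f -> measurable_fun setT g ->
  (forall x, 0 <= f x) -> (forall x, 0 <= g x) ->
  itg (fun x => f x + g x) = (itg f + itg g)%E.
Proof.
move=> mf mg f0 g0; rewrite /itg -ge0_integralD//.
- by move=> x _; rewrite lee_fin.
- exact/measurable_EFinP.
- by move=> x _; rewrite lee_fin.
- exact/measurable_EFinP.
Qed.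

Lemma itgZ f c : measurable_fun setT f -> (forall x, 0 <= f x) -> 0 <= c ->
  itg (fun x => c * f x) = (c%:E * itg f)%E.
Proof.
move=> mf f0 c0; rewrite /itg -ge0_integralZl_EFin//.
- by move=> x _; rewrite lee_fin.
- exact/measurable_EFinP.
Qed.

Lemma itg_cst c : itg (fun=> c) = (c%:E * mu setT)%E.
Proof. by rewrite /itg integral_cst. Qed.

Lemma itg_indic A : measurable A -> itg (\1_A : T -> R) = mu A.
Proof. by move=> mA; rewrite /itg integral_indic// setIT. Qed.

Lemma integrable_itg f : measurable_fun setT f -> (forall x, 0 <= f x) ->
  (itg f < +oo)%E -> mu.-integrable setT (EFin \o f).
Proof.
move=> mf f0 foo; apply/integrableP; split; first exact/measurable_EFinP.
by under eq_integral do rewrite /= ger0_norm//.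
Qed.

Lemma itg_integrable f : (forall x, 0 <= f x) ->
  mu.-integrable setT (EFin \o f) -> (itg f < +oo)%E.
Proof.
move=> f0 /integrableP[_]; rewrite /itg.
by under eq_integral do rewrite /= ger0_norm//.
Qed.

Lemma itg_sum (I : Type) (s : seq I) (f : I -> T -> R) :
  (forall i, measurable_fun setT (f i)) -> (forall i x, 0 <= f i x) ->
  itg (fun x => \sum_(i <- s) f i x) = (\sum_(i <- s) itg (f i))%E.
Proof.
move=> mf f0; rewrite /itg -ge0_integral_sum//.
- by apply: eq_integral => x _; rewrite -sumEFin.
- by move=> i; exact/measurable_EFinP.
- by move=> i x _; rewrite lee_fin.
Qed.

Lemma Rintegral_sum (I : Type) (s : seq I) (f : I -> T -> R) :
  (forall i, mu.-integrable setT (EFin \o f i)) ->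
  \int[mu]_x (\sum_(i <- s) f i x) = \sum_(i <- s) \int[mu]_x f i x.
Proof.
move=> fi; elim: s => [|i s IH].
  under eq_Rintegral do rewrite big_nil.
  by rewrite Rintegral_cst// mul0r big_nil.
under eq_Rintegral do rewrite big_cons.
rewrite big_cons -IH RintegralD//.
have : mu.-integrable setT (fun x => \sum_(i <- s) (f i x)%:E)%E.
  by apply: integrable_sum => // k _; exact: fi.
by apply: eq_integrable => // x _; rewrite /= -sumEFin.
Qed.

End real_integral.

Arguments itg {d T R} mu f%_ring_scope.

Section real_integral_finite.
Context d (T : measurableType d) {R : realType}.
Variable mu : {measure set T -> \bar R}.
Hypothesis muoo : (mu setT < +oo)%E.
Implicit Types (f g : T -> R).

Lemma bounded_integrable f B : measurable_fun setT f -> (forall x, `|f x| <= B) ->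
  mu.-integrable setT (EFin \o f).
Proof.
move=> mf fB; apply: measurable_bounded_integrable => //.
exists B; split; first by rewrite num_real.
by move=> r Br x _; exact: le_trans (fB x) (ltW Br).
Qed.

Lemma bounded_cvg_itg (f_ : nat -> T -> R) f B :
  (forall k, measurable_fun setT (f_ k)) -> measurable_fun setT f ->
  (forall k x, `|f_ k x| <= B) ->
  {ae mu, forall x, f_ k x @[k --> \oo] --> f x} ->
  itg mu (f_ k) @[k --> \oo] --> itg mu f.
Proof.
move=> mf_ mf fB ff.
have [|||||_ _ //] := @dominated_convergence _ _ _ mu setT measurableT
  (fun k => EFin \o f_ k) (EFin \o f) (EFin \o cst B).
- by move=> k; exact/measurable_EFinP.
- exact/measurable_EFinP.
- by apply: filterS ff => x fx _; apply: cvg_EFin; [exact: nearW|exact: fx].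
- by apply: (@bounded_integrable _ `|B|) => // x /=.
- by apply/nearW => x k _; rewrite /= lee_fin.
Qed.

End real_integral_finite.

Lemma finite_measure_lty d (T : measurableType d) (R : realType)
  (mu : {finite_measure set T -> \bar R}) : (mu setT < +oo)%E.
Proof. by rewrite -ge0_fin_numE// fin_num_measure. Qed.

Section power_mean.
Context d (T : measurableType d) {R : realType}.
Variable mu : {measure set T -> \bar R}.

Lemma powR_ge_tangent (r t : R) : 1 <= r -> 0 <= t -> t <= t `^ r / r + (1 - r^-1).
Proof.
move=> r1 t0; have [->|rN1] := eqVneq r 1; first by rewrite powRr1// invr1; lra.
have {}r1 : 1 < r by rewrite lt_neqAle eq_sym rN1.
have r0 : 0 < r by lra.
have q0 : 0 < 1 - r^-1 by rewrite subr_gt0 invf_lt1.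
have := @conjugate_powR R t 1 r (1 - r^-1)^-1 t0 ler01 r0.
rewrite invr_gt0 q0 invrK powR1 mulr1 mul1r; apply=> //; lra.
Qed.

(** Monotonicity of power means, freed of roots so that it can be applied to
    integrals that are not known to be finite. *)
Lemma power_mean (D : set T) (f : T -> R) (r s : R) :
  measurable D -> (mu D < +oo)%E ->
  measurable_fun D f -> (forall x, D x -> 0 <= f x) -> 1 <= r -> 0 <= s ->
  (\int[mu]_(x in D) (f x `^ r)%:E <= mu D * (s `^ r)%:E)%E ->
  (\int[mu]_(x in D) (f x)%:E <= mu D * s%:E)%E.
Proof.
move=> mD Doo mf f0 r1 s0 H.
have r0 : 0 < r by lra.
have Dfin : mu D \is a fin_num by rewrite ge0_fin_numE.
have mfr : measurable_fun D (fun x => f x `^ r).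
  exact: (measurableT_comp (measurable_powR _)).
have key t : s <= t -> 0 < t -> (\int[mu]_(x in D) (f x)%:E <= mu D * t%:E)%E.
  move=> st t0.
  have ti : 0 <= t / (t `^ r * r).
    by rewrite divr_ge0 ?(ltW t0)// mulr_ge0 ?powR_ge0// ltW.
  have tq : 0 <= t * (1 - r^-1) by rewrite mulr_ge0 ?(ltW t0)// subr_ge0 invf_le1.
  apply: (@le_trans _ _ (\int[mu]_(x in D)
      ((t / (t `^ r * r) * f x `^ r)%:E + (t * (1 - r^-1))%:E)))%E.
    apply: ge0_le_integral => //.
    - exact/measurable_EFinP.
    - apply/measurable_EFinP; apply: measurable_funD => //.
      exact: measurable_funM.
    - move=> x Dx; rewrite -EFinD lee_fin.
      have xt0 : 0 <= f x / t by rewrite divr_ge0 ?f0// ltW.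
      have tr0 : t `^ r != 0 by rewrite lt0r_neq0// powR_gt0.
      have E : (f x / t) `^ r = f x `^ r / t `^ r.
        by rewrite powRM ?invr_ge0 ?f0 ?(ltW t0)// -(powR_inv1 (ltW t0))
          -powRrM mulN1r powRN.
      have := powR_ge_tangent r1 xt0.
      rewrite E => Ht; have {Ht} := ler_wpM2l (ltW t0) Ht.
      have -> : t * (f x / t) = f x by field; rewrite lt0r_neq0.
      move/le_trans; apply; rewrite le_eqVlt; apply/orP; left; apply/eqP.
      by field; rewrite tr0 lt0r_neq0.
  rewrite ge0_integralD//; last 2 first.
  - by move=> x Dx; rewrite lee_fin mulr_ge0// powR_ge0.
  - by apply/measurable_EFinP; exact: measurable_funM.
  under eq_integral do rewrite EFinM.
  rewrite ge0_integralZl_EFin//; last 2 first.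
  - by move=> x Dx; rewrite lee_fin powR_ge0.
  - exact/measurable_EFinP.
  rewrite integral_cst//.
  have H' : (\int[mu]_(x in D) (f x `^ r)%:E <= mu D * (t `^ r)%:E)%E.
    apply: (le_trans H); apply: lee_wpmul2l => //; rewrite lee_fin.
    by apply: ge0_ler_powR => //; rewrite ?nnegrE ltW.
  apply: (@le_trans _ _ ((t / (t `^ r * r))%:E * (mu D * (t `^ r)%:E) +
       (t * (1 - r^-1))%:E * mu D))%E.
    by rewrite leeD2r//; exact: lee_wpmul2l.
  rewrite -(fineK Dfin) -!EFinM -EFinD lee_fin le_eqVlt; apply/orP; left; apply/eqP.
  have tr0 : t `^ r != 0 by rewrite lt0r_neq0// powR_gt0.
  by field; rewrite tr0 lt0r_neq0.
have [sp|] := ltP 0 s; first exact: key.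
move=> sn; have {s0 sn}s0 : s = 0 by apply/eqP; rewrite eq_le sn s0.
apply/lee_addgt0Pr => e e0; rewrite s0 mule0 add0e.
have m0 : 0 <= fine (mu D) by apply: fine_ge0.
have t0 : 0 < e / (fine (mu D) + 1) by rewrite divr_gt0// ltr_wpDl.
apply: (le_trans (key _ _ t0)); first by rewrite s0 ltW.
rewrite -(fineK Dfin) -EFinM lee_fin mulrCA ler_piMr ?(ltW e0)//.
by rewrite ler_pdivrMr ?ltr_wpDl// mul1r lerDl.
Qed.

End power_mean.

(** * Square-integrable functions and weak convergence *)

Section square_integrable.
Context d (T : measurableType d) {R : realType}.
Variable mu : {measure set T -> \bar R}.
Implicit Types (u v w : T -> R).

Definition sq_integrable u :=
  measurable_fun setT u /\ mu.-integrable setT (EFin \o (fun x => u x ^+ 2)).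

Definition norm2 u : R := Num.sqrt (\int[mu]_x (u x ^+ 2)).

Lemma sq_integral_ge0 u : 0 <= \int[mu]_x (u x ^+ 2).
Proof. by apply: Rintegral_ge0 => x _; exact: sqr_ge0. Qed.

Lemma norm2_ge0 u : 0 <= norm2 u.
Proof. exact: sqrtr_ge0. Qed.

Lemma norm2_sqr u : norm2 u ^+ 2 = \int[mu]_x (u x ^+ 2).
Proof. by rewrite sqr_sqrtr// sq_integral_ge0. Qed.

Lemma itg_sqr u : sq_integrable u ->
  itg mu (fun x => u x ^+ 2) = (norm2 u ^+ 2)%:E.
Proof.
by move=> [_ iu]; rewrite norm2_sqr /Rintegral fineK//; exact: integrable_fin_num.
Qed.

Lemma sq_integrableP u : measurable_fun setT u ->
  (itg mu (fun x => u x ^+ 2)%R < +oo)%E -> sq_integrable u.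
Proof.
move=> mu_ uoo; split=> //; apply: integrable_itg => //.
  exact: measurable_funX.
by move=> x; exact: sqr_ge0.
Qed.

Lemma sq_integrable_mul u v : sq_integrable u -> sq_integrable v ->
  mu.-integrable setT (EFin \o (fun x => u x * v x)).
Proof.
move=> [mu_ iu] [mv iv].
apply: (le_integrable measurableT _ _ (integrableD measurableT iu iv)).
  by apply/measurable_EFinP; exact: measurable_funM.
move=> x _ /=; rewrite lee_fin (@ger0_norm _ (_ + _)) ?addr_ge0 ?sqr_ge0//.
have := sqr_ge0 (`|u x| - `|v x|); rewrite normrM.
rewrite -(real_normK (num_real (u x))) -(real_normK (num_real (v x))).
have := normr_ge0 (u x); have := normr_ge0 (v x); nra.
Qed.

Lemma sq_integrableZ u c : sq_integrable u -> sq_integrable (fun x => c * u x).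
Proof.
move=> [mu_ iu]; split; first exact: measurable_funM.
have := integrableZl measurableT (c ^+ 2) iu.
by apply: eq_integrable => // x _ /=; rewrite -EFinM exprMn.
Qed.

Lemma sq_integrable_norm u : sq_integrable u -> sq_integrable (fun x => `|u x|).
Proof.
move=> [mu_ iu]; split; first exact: measurableT_comp.
by apply: eq_integrable iu => // x _ /=; rewrite real_normK// num_real.
Qed.

Lemma sq_integrableD u v : sq_integrable u -> sq_integrable v ->
  sq_integrable (fun x => u x + v x).
Proof.
move=> L2u L2v; have [mu_ iu] := L2u; have [mv iv] := L2v.
split; first exact: measurable_funD.
have iuv := sq_integrable_mul L2u L2v.
have := integrableD measurableT iu (integrableD measurableT iv
  (integrableZl measurableT 2 iuv)).
by apply: eq_integrable => // x _ /=; rewrite -EFinM -!EFinD; congr EFin; ring.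
Qed.

Lemma sq_integrableB u v : sq_integrable u -> sq_integrable v ->
  sq_integrable (fun x => u x - v x).
Proof.
move=> L2u L2v; have := sq_integrableD L2u (sq_integrableZ (-1) L2v).
by under eq_fun do rewrite mulN1r.
Qed.

Lemma Rintegral_linear_sqr u v (s t : R) : sq_integrable u -> sq_integrable v ->
  \int[mu]_x ((s * u x + t * v x) ^+ 2) = s ^+ 2 * (\int[mu]_x (u x ^+ 2)) +
   2 * s * t * (\int[mu]_x (u x * v x)) + t ^+ 2 * (\int[mu]_x (v x ^+ 2)).
Proof.
move=> L2u L2v; have [_ iu] := L2u; have [_ iv] := L2v.
have iuv := sq_integrable_mul L2u L2v.
have iZ (c : R) f : mu.-integrable setT (EFin \o f) ->
    mu.-integrable setT (EFin \o (fun x => c * f x)).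
  by move=> /(integrableZl measurableT c); apply: eq_integrable => // x _.
rewrite -!RintegralZl// -!RintegralD//; try exact: iZ.
  by apply: eq_Rintegral => x _; ring.
have := integrableD measurableT (iZ (s ^+ 2) _ iu) (iZ (2 * s * t) _ iuv).
by apply: eq_integrable.
Qed.

Lemma cauchy_schwarz u v : sq_integrable u -> sq_integrable v ->
  `|\int[mu]_x (u x * v x)| <= norm2 u * norm2 v.
Proof.
move=> L2u L2v.
rewrite -(@ler_sqr _ `|_|) ?nnegrE// ?mulr_ge0 ?norm2_ge0//.
rewrite real_normK ?num_real// exprMn !norm2_sqr.
set B := Rintegral _ _ _.
have H s t := Rintegral_linear_sqr s t L2u L2v.
move: H; rewrite -/B.
have := sq_integral_ge0 u; have := sq_integral_ge0 v.
set A := Rintegral _ _ _; set C := Rintegral _ _ _ => A0 C0 H.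
have K s t : 0 <= s ^+ 2 * C + 2 * s * t * B + t ^+ 2 * A.
  by rewrite -H; apply: Rintegral_ge0 => x _; exact: sqr_ge0.
have [A1|A1] := eqVneq A 0.
  have := K B (- (C + 1)); rewrite A1 !mulr0 addr0.
  have := sqr_ge0 B => B0 KB.
  have : 0 <= C * B ^+ 2 by exact: mulr_ge0.
  lra.
have {}A0 : 0 < A by rewrite lt_neqAle eq_sym A1.
have := K A (- B).
have -> : A ^+ 2 * C + 2 * A * - B * B + (- B) ^+ 2 * A = A * (C * A - B ^+ 2) by ring.
by rewrite pmulr_rge0// subr_ge0.
Qed.

Lemma norm2D u v : sq_integrable u -> sq_integrable v ->
  norm2 (fun x => u x + v x) <= norm2 u + norm2 v.
Proof.
move=> L2u L2v.
rewrite -ler_sqr ?nnegrE ?addr_ge0 ?norm2_ge0//.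
have := Rintegral_linear_sqr 1 1 L2u L2v.
under eq_Rintegral do rewrite !mul1r.
rewrite norm2_sqr => ->; rewrite -!norm2_sqr.
have := cauchy_schwarz L2u L2v; rewrite ler_norml => /andP[_ H]; nra.
Qed.

Lemma norm2Z u c : sq_integrable u -> norm2 (fun x => c * u x) = `|c| * norm2 u.
Proof.
move=> [_ iu]; rewrite /norm2; under eq_Rintegral do rewrite exprMn.
by rewrite RintegralZl// sqrtrM ?sqr_ge0// sqrtr_sqr.
Qed.

Lemma norm2_norm u : norm2 (fun x => `|u x|) = norm2 u.
Proof.
by congr Num.sqrt; apply: eq_Rintegral => x _; rewrite real_normK// num_real.
Qed.

Lemma sq_integrable0 : sq_integrable (fun=> 0).
Proof.
split=> //; have := integrable0 mu setT; apply: eq_integrable => // x _ /=.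
by rewrite expr0n.
Qed.

Lemma norm20 : norm2 (fun=> 0) = 0.
Proof.
rewrite /norm2; under eq_Rintegral do rewrite expr0n.
by rewrite Rintegral_cst// mul0r sqrtr0.
Qed.

Lemma sq_integrable_sum (I : Type) (s : seq I) (f : I -> T -> R) :
  (forall i, sq_integrable (f i)) -> sq_integrable (fun x => \sum_(i <- s) f i x).
Proof.
move=> L2f; elim: s => [|i s IH].
  by under eq_fun do rewrite big_nil; exact: sq_integrable0.
by under eq_fun do rewrite big_cons; apply: sq_integrableD.
Qed.

Lemma norm2_sum (I : Type) (s : seq I) (f : I -> T -> R) :
  (forall i, sq_integrable (f i)) ->
  norm2 (fun x => \sum_(i <- s) f i x) <= \sum_(i <- s) norm2 (f i).
Proof.
move=> L2f; elim: s => [|i s IH].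
  by under eq_fun do rewrite big_nil; rewrite norm20 big_nil.
under eq_fun do rewrite big_cons; rewrite big_cons.
apply: (le_trans (norm2D (L2f i) (sq_integrable_sum s L2f))).
by rewrite lerD2l.
Qed.

End square_integrable.

Section summable_integrals.
Context d (T : measurableType d) {R : realType}.
Variable mu : {measure set T -> \bar R}.

Lemma ae_cvgn_series (f : nat -> T -> R) (C : R) :
  (forall j, measurable_fun setT (f j)) -> (forall j x, 0 <= f j x) ->
  (forall N, \sum_(0 <= j < N) itg mu (f j) <= C%:E)%E ->
  {ae mu, forall x, cvgn (series (f ^~ x))}.
Proof.
move=> mf f0 HC.
pose g x := (\sum_(0 <= j <oo) (f j x)%:E)%E.
have mfE j : measurable_fun setT (EFin \o f j) by exact/measurable_EFinP.
have g0 x : (0 <= g x)%E by apply: nneseries_ge0 => n _ _; rewrite lee_fin.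
have ig : mu.-integrable setT g.
  apply/integrableP; split.
    apply: (@ge0_emeasurable_sum _ _ _ _ (fun n => EFin \o f n) xpredT) => //.
    by move=> k x _ _; rewrite lee_fin.
  under eq_integral do rewrite gee0_abs//.
  rewrite /g integral_nneseries//; last by move=> n x _; rewrite lee_fin.
  apply: (@le_lt_trans _ _ C%:E); last exact: ltry.
  apply: lime_le; last by apply: nearW => N; exact: HC.
  by apply: is_cvg_nneseries => n _ _; apply: integral_ge0 => x _; rewrite lee_fin.
have := integrable_ae measurableT ig; apply: filterS => x /(_ I) gx.
apply: nondecreasing_is_cvgn.
  by apply/nondecreasing_seqP => n; rewrite seriesEnat/= big_nat_recr//= lerDl.
exists (fine (g x)) => _ [N _ <-].
rewrite -lee_fin fineK// seriesEnat/= -sumEFin.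
by apply: nneseries_lim_ge => k _ _; rewrite lee_fin.
Qed.

End summable_integrals.

Section extended_limits.
Context {R : realType}.
Implicit Types (u : nat -> \bar R) (X : \bar R).

Lemma lte_between_real (x y : \bar R) : (x < y)%E ->
  exists r : R, (x < r%:E)%E /\ (r%:E < y)%E.
Proof.
case: x y => [a| |] [b| |]//= xy.
- by exists ((a + b) / 2); rewrite !lte_fin in xy *; split; lra.
- by exists (a + 1); rewrite lte_fin ltry; split=> //; lra.
- by exists (b - 1); rewrite lte_fin ltNyr; split=> //; lra.
- by exists 0; rewrite ltNyr ltry.
Qed.

Lemma limn_einf_le u (X : \bar R) :
  (forall K, exists2 k, (K <= k)%N & (u k <= X)%E) -> (limn_einf u <= X)%E.
Proof.
move=> H; rewrite limn_einf_lim.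
apply: lime_le; first exact: is_cvg_einfs.
apply: nearW => K; have [k Kk ukX] := H K.
by apply: le_trans ukX; apply: ereal_inf_lbound; exists k.
Qed.

Lemma le_limn_einf u X :
  (forall c : R, (forall K, exists2 k, (K <= k)%N & (u k <= c%:E)%E) ->
     (X <= c%:E)%E) -> (X <= limn_einf u)%E.
Proof.
move=> H; rewrite leNgt; apply/negP => /lte_between_real[c [lc cX]].
suff : (X <= c%:E)%E by rewrite leNgt cX.
apply: H => K; have : (einfs u K < c%:E)%E.
  apply: le_lt_trans lc; rewrite limn_einf_lim (cvg_lim _ (cvg_einfs_sup (u := u)))//.
  by apply: ereal_sup_ubound; exists K.
by move=> /ereal_inf_lt[_ [k /= Kk <-] /ltW ukc]; exists k.
Qed.

Lemma limn_esup_le u X :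
  (forall c : R, (X < c%:E)%E -> exists K, forall k, (K <= k)%N -> (u k <= c%:E)%E) ->
  (limn_esup u <= X)%E.
Proof.
move=> H; rewrite leNgt; apply/negP => /lte_between_real[c [Xc cl]].
have [K HK] := H _ Xc.
suff : (limn_esup u <= c%:E)%E by rewrite leNgt cl.
rewrite limn_esup_lim (le_trans (y := esups u K))//.
  apply: lime_le; first exact: is_cvg_esups.
  by exists K => // n /= Kn; exact: nonincreasing_esups.
by apply: ub_ereal_sup => _ [k /= Kk <-]; exact: HK.
Qed.

End extended_limits.

Section fatou_bound.
Context d (T : measurableType d) {R : realType}.
Variable mu : {measure set T -> \bar R}.

Lemma fatou_bound (h : nat -> T -> R) (h0 : T -> R) (C : \bar R) :
  (forall k, measurable_fun setT (h k)) -> measurable_fun setT h0 ->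
  (forall k x, 0 <= h k x) -> (forall x, 0 <= h0 x) ->
  {ae mu, forall x, h k x @[k --> \oo] --> h0 x} ->
  (forall K, exists2 k, (K <= k)%N & (itg mu (h k) <= C)%E) ->
  (itg mu h0 <= C)%E.
Proof.
move=> mh mh0 hge0 h0ge0 hh0 HC.
have mhE k : measurable_fun setT (EFin \o h k) by exact/measurable_EFinP.
rewrite /itg (_ : (\int[mu]_x (h0 x)%:E)%E =
    (\int[mu]_x limn_einf (fun k => (h k x)%:E))%E).
  apply: (le_trans (fatou mu measurableT mhE _)).
    by move=> k x _; rewrite lee_fin.
  exact: limn_einf_le.
apply: ge0_ae_eq_integral => //.
- exact/measurable_EFinP.
- apply: (measurableT_comp (@oppe_measurable R setT)).
  apply: (measurable_fun_limn_esup (f := fun k x => - (h k x)%:E)%E) => k.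
  exact: (measurableT_comp (@oppe_measurable R setT) (mhE k)).
- by move=> x _; rewrite lee_fin.
- move=> x _; rewrite limn_einf_lim; apply: lime_ge; first exact: is_cvg_einfs.
  by apply: nearW => k; apply: le_ereal_inf_tmp => _ [m _ <-]; rewrite lee_fin.
- apply: filterS hh0 => x hx _; apply/esym.
  have : (h k x)%:E @[k --> \oo] --> (h0 x)%:E by apply: cvg_EFin; [exact: nearW|].
  by move=> /cvg_limn_einf_sup[].
Qed.

End fatou_bound.

Section uniform_boundedness.
Context d (T : measurableType d) {R : realType}.
Variable mu : {finite_measure set T -> \bar R}.
Implicit Types (u v : T -> R).

Lemma sq_integrable_bounded u B : measurable_fun setT u ->
  (forall x, `|u x| <= B) -> sq_integrable mu u.
Proof.
move=> mu_ uB; split => //.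
apply: (@bounded_integrable _ _ _ _ (finite_measure_lty mu) _ (B ^+ 2)).
  exact: measurable_funX.
by move=> x; rewrite normrX lerXn2r ?nnegrE// (le_trans _ (uB x)).
Qed.

Lemma sq_integrable_cst (c : R) : sq_integrable mu (fun=> c).
Proof. exact: (@sq_integrable_bounded _ `|c|). Qed.

Lemma sq_integrable_integrable u : sq_integrable mu u ->
  mu.-integrable setT (EFin \o u).
Proof.
move=> L2u; have := sq_integrable_mul L2u (sq_integrable_cst 1).
by apply: eq_integrable => // x _ /=; rewrite mulr1.
Qed.

Lemma itg_norm_le u : sq_integrable mu u ->
  (itg mu (fun x => `|u x|)%R <= (norm2 mu u * norm2 mu (fun=> 1%R))%:E)%E.
Proof.
move=> L2u; have L2n := sq_integrable_norm L2u.
have := cauchy_schwarz L2n (sq_integrable_cst 1).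
under eq_Rintegral do rewrite mulr1.
rewrite norm2_norm -lee_fin ger0_norm; last by apply: Rintegral_ge0 => x _.
rewrite /Rintegral fineK//; apply: integrable_fin_num => //.
exact: sq_integrable_integrable.
Qed.

Lemma sq_integrable_series (f : nat -> T -> R) (t : nat -> R) :
  (forall j, sq_integrable mu (f j)) ->
  (forall n m, (n <= m)%N -> \sum_(n <= j < m) norm2 mu (f j) <= t n) ->
  exists2 V, sq_integrable mu V &
    forall n, norm2 mu (fun x => V x - \sum_(0 <= j < n) f j x) <= t n.
Proof.
move=> L2f ft.
have t0 n : 0 <= t n by apply: le_trans (ft _ _ (leqnn n)); rewrite big_geq.
have [N [mN N0 HN]] : {ae mu, forall x, cvgn (series (f ^~ x))}.
  have : {ae mu, forall x, cvgn (series (fun j => `|f j x|))}.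
    apply: (@ae_cvgn_series _ _ _ _ _ (t 0%N * norm2 mu (fun=> 1))) => //.
      by move=> j; apply: measurableT_comp => //; have [] := L2f j.
    move=> M; apply: (@le_trans _ _ (\sum_(0 <= j < M)
        (norm2 mu (f j) * norm2 mu (fun=> 1))%:E)%E).
      by apply: lee_sum => j _; exact: itg_norm_le.
    rewrite sumEFin lee_fin -mulr_suml ler_wpM2r ?norm2_ge0//; exact: ft.
  by apply: filterS => x; exact: normed_cvg.
have mN' : measurable (~` N) by exact: measurableC.
pose S n x := \sum_(0 <= j < n) f j x.
have mS n : measurable_fun setT (S n).
  by apply: measurable_sum => j; have [] := L2f j.
have L2S n : sq_integrable mu (S n) by exact: sq_integrable_sum.
pose F n x := S n x * \1_(~` N) x.
have cvgF x : cvgn (F ^~ x).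
  rewrite /F indicE; case: (boolP (x \in _)) => [|_] /=.
    rewrite inE /= => xN.
    have Sx : cvgn (series (f ^~ x)) by apply: contrapT => /HN.
    under eq_fun do rewrite mulr1.
    by move: Sx; rewrite seriesEnat.
  by under eq_fun do rewrite mulr0; exact: is_cvg_cst.
pose V x := limn (F ^~ x).
have mV : measurable_fun setT V.
  apply: (measurable_fun_cvg (h := F)) => [m|x _]; last exact: cvgF.
  by apply: measurable_funM => //; exact: measurable_indic.
have aeV : {ae mu, forall x, S n x @[n --> \oo] --> V x}.
  exists N; split => // x /= H; apply: contrapT => xN; apply: H.
  have := cvgF x; rewrite /V /F indicE mem_set//=.
  by under eq_fun do rewrite mulr1.
have key n : (itg mu (fun x => (V x - S n x) ^+ 2)%R <= (t n ^+ 2)%:E)%E.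
  apply: (@fatou_bound _ _ _ _ (fun m x => (S m x - S n x) ^+ 2)).
  - by move=> m; apply: measurable_funX; exact: measurable_funB.
  - by apply: measurable_funX; exact: measurable_funB.
  - by move=> m x; exact: sqr_ge0.
  - by move=> x; exact: sqr_ge0.
  - by apply: filterS aeV => x Hx; apply: cvgM; apply: cvgB => //; exact: cvg_cst.
  - move=> K; exists (maxn K n); first exact: leq_maxl.
    rewrite itg_sqr; last exact: sq_integrableB.
    rewrite lee_fin ler_sqr ?nnegrE ?norm2_ge0//.
    apply: le_trans (ft n (maxn K n) (leq_maxr _ _)).
    apply: le_trans (norm2_sum _ L2f).
    rewrite le_eqVlt; apply/orP; left; apply/eqP; congr norm2.
    apply/funext => x; rewrite /S (big_cat_nat (n := n)) ?leq_maxr//=.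
    by rewrite addrAC subrr add0r.
have L2VS n : sq_integrable mu (fun x => V x - S n x).
  apply: sq_integrableP; first exact: measurable_funB.
  exact: le_lt_trans (key n) (ltry _).
exists V.
  have := sq_integrableD (L2VS 0%N) (L2S 0%N).
  by under eq_fun do rewrite subrK.
move=> n; have := key n; rewrite itg_sqr//.
by rewrite lee_fin ler_sqr ?nnegrE ?norm2_ge0.
Qed.

Let third_sum (n m : nat) : (n <= m)%N ->
  \sum_(n <= j < m) (3^-1 : R) ^+ j <= 3 / 2 * (3^-1 : R) ^+ n.
Proof.
move=> nm.
suff -> : \sum_(n <= j < m) (3^-1 : R) ^+ j = 3 / 2 * (3^-1 ^+ n - 3^-1 ^+ m).
  have : 0 <= (3^-1 : R) ^+ m by rewrite exprn_ge0.
  lra.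
elim: m nm => [|m IH]; first by rewrite leqn0 => /eqP ->; rewrite big_geq// subrr mulr0.
rewrite leq_eqVlt => /orP[/eqP->|]; first by rewrite big_geq// subrr mulr0.
by rewrite ltnS => nm; rewrite big_nat_recr//= IH// exprS; field.
Qed.

(** The gliding hump: were the norms unbounded, choosing signs one at a time in
    the sum of [3 ^- j *: us (k j) / norm2 (us (k j))] with
    [norm2 (us (k j)) >= 4 ^+ j] would make the [j]-th term dominate the [j]-th
    pairing. *)
Lemma uniform_boundedness (us : nat -> T -> R) :
  (forall k, sq_integrable mu (us k)) ->
  (forall v, sq_integrable mu v ->
     exists C : R, forall k, `|\int[mu]_x (us k x * v x)| <= C) ->
  exists K : R, forall k, norm2 mu (us k) <= K.
Proof.
move=> L2us Hus; apply: contrapT => /forallNP unb.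
have {}unb j : exists k, (4 : R) ^+ j < norm2 mu (us k).
  by have /existsNP[k /negP] := unb (4 ^+ j); rewrite -ltNge; exists k.
pose k_ j := projT1 (cid (unb j)).
have kP j : 4 ^+ j < norm2 mu (us (k_ j)) by exact: (projT2 (cid (unb j))).
pose n_ j := norm2 mu (us (k_ j)).
have n0 j : 0 < n_ j by apply: le_lt_trans (kP j); rewrite exprn_ge0.
pose hump j x := (3^-1 ^+ j / n_ j) * us (k_ j) x.
have L2h j : sq_integrable mu (hump j) by exact: sq_integrableZ.
have nh j : norm2 mu (hump j) = 3^-1 ^+ j.
  rewrite norm2Z// ger0_norm ?divr_ge0 ?exprn_ge0 ?(ltW (n0 j))//.
  by rewrite -mulrA mulVf ?mulr1// lt0r_neq0.
pose pair u v := \int[mu]_x (u x * v x).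
pose sgn j (s : T -> R) : R := if 0 <= pair (us (k_ j)) s then 1 else -1.
pose s_ := fix s_ (j : nat) : T -> R := match j with
  | 0%N => fun=> 0
  | j'.+1 => fun x => s_ j' x + sgn j' (s_ j') * hump j' x end.
pose f j x := sgn j (s_ j) * hump j x.
have sE n x : s_ n x = \sum_(0 <= j < n) f j x.
  elim: n => [|n IH]; first by rewrite big_geq.
  by rewrite big_nat_recr//= -IH.
have L2f j : sq_integrable mu (f j) by exact: sq_integrableZ.
have L2s n : sq_integrable mu (s_ n).
  by rewrite (funext (sE n)); exact: sq_integrable_sum.
have nf j : norm2 mu (f j) = 3^-1 ^+ j.
  by rewrite norm2Z// nh /sgn; case: ifP; rewrite ?normrN normr1 mul1r.
have [V L2V HV] := @sq_integrable_series f (fun n => 3 / 2 * 3^-1 ^+ n) L2f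
  ltac:(by move=> n m nm; under eq_bigr do rewrite nf; exact: third_sum).
have [C HC] := Hus _ L2V.
suff low j : 2^-1 * (4 / 3) ^+ j <= C.
  have /(_ (2 * C))[j] : forall x : R, exists j, x < (4 / 3) ^+ j.
    move=> x; have bern j : 1 + j%:R / 3 <= (4 / 3 : R) ^+ j.
      elim: j => [|j IH]; first by rewrite mul0r addr0.
      rewrite exprS; have : 0 <= (j%:R : R) by [].
      by rewrite -natr1; lra.
    exists (Num.truncn (3 * `|x|)).+1; apply: lt_le_trans (bern _).
    have := truncnS_gt (3 * `|x|); have := ler_norm x; lra.
  by have := low j; lra.
pose r x := V x - s_ j.+1 x.
have L2r : sq_integrable mu r by exact: sq_integrableB.
have nr : norm2 mu r <= 2^-1 * 3^-1 ^+ j.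
  have := HV j.+1; rewrite exprS mulrA (_ : 3 / 2 / 3 = 2^-1 :> R); last by field.
  by rewrite /r (funext (sE j.+1)).
have pairD u v w : sq_integrable mu u -> sq_integrable mu v -> sq_integrable mu w ->
    pair u (fun x => v x + w x) = pair u v + pair u w.
  move=> L2u L2v L2w; rewrite /pair -RintegralD//; try exact: sq_integrable_mul.
  by apply: eq_Rintegral => x _; rewrite mulrDr.
have pairZ u v c : sq_integrable mu u -> sq_integrable mu v ->
    pair u (fun x => c * v x) = c * pair u v.
  move=> L2u L2v; rewrite /pair -RintegralZl//; last exact: sq_integrable_mul.
  by apply: eq_Rintegral => x _; rewrite mulrCA.
have main : 3^-1 ^+ j * n_ j <= `|pair (us (k_ j)) (s_ j.+1)|.
  rewrite /= pairD//; last exact: sq_integrableZ.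
  rewrite pairZ// [pair _ (hump j)]pairZ//.
  have -> : pair (us (k_ j)) (us (k_ j)) = n_ j ^+ 2.
    by rewrite norm2_sqr; apply: eq_Rintegral => x _; rewrite expr2.
  rewrite (_ : 3^-1 ^+ j / n_ j * n_ j ^+ 2 = 3^-1 ^+ j * n_ j); last first.
    by field; rewrite ?lt0r_neq0.
  have p0 : 0 <= 3^-1 ^+ j * n_ j by rewrite mulr_ge0 ?exprn_ge0 ?(ltW (n0 j)).
  rewrite /sgn; case: ifPn => [h|]; first by rewrite mul1r ger0_norm ?addr_ge0// lerDr.
  rewrite -ltNge => h; rewrite mulN1r ltr0_norm; last by lra.
  lra.
have tail : `|pair (us (k_ j)) r| <= 2^-1 * (3^-1 ^+ j * n_ j).
  apply: (le_trans (cauchy_schwarz (L2us _) L2r)).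
  rewrite (_ : 2^-1 * _ = n_ j * (2^-1 * 3^-1 ^+ j)); last by ring.
  by apply: ler_wpM2l => //; exact: norm2_ge0.
have VE : pair (us (k_ j)) V = pair (us (k_ j)) (s_ j.+1) + pair (us (k_ j)) r.
  rewrite -(pairD _ _ _ (L2us _) (L2s j.+1) L2r); apply: eq_Rintegral => x _.
  by rewrite /r addrC subrK.
have := HC (k_ j); rewrite -/(pair _ _) VE => HCj.
have : 2^-1 * (3^-1 ^+ j * n_ j) <= C.
  have := ler_normB (pair (us (k_ j)) (s_ j.+1) + pair (us (k_ j)) r) (pair (us (k_ j)) r).
  rewrite addrK; lra.
apply: le_trans; rewrite ler_pM2l// exprMn mulrC.
by apply: ler_wpM2l; [rewrite exprn_ge0|exact/ltW/kP].
Qed.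

End uniform_boundedness.

Section two_tangents.
Context {R : realType}.

(** Linearise first in [zeta], then in [xi] at the discretised parameter
    [floor_mul h zeta].  For [zeta] beyond [N] the bound only says that [g] is
    nonnegative; the price, of order [1 / N], is paid by the last term. *)
Lemma convex_above_two_tangents (g : R -> R -> R) (B0 B J N a b h : R) :
  (forall eta, convex_on_line (g ^~ eta)) ->
  (forall xi, convex_on_line (g xi)) ->
  (forall xi eta, 0 <= g xi eta) ->
  (forall xi eta, `|xi| <= J + 2 -> `|eta| <= J + 2 -> g xi eta <= B0) ->
  (forall xi eta, `|xi| <= N + 2 -> `|eta| <= N + 2 -> g xi eta <= B) ->
  B0 <= B -> 0 < N -> J <= N -> `|a| <= J -> `|b| <= J -> 0 < h -> h <= 1 ->
  forall xi zeta,
  g a b + (g a (b + h) - g a b) / h * (zeta - b)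
    + (if `|zeta| <= N then (g (a + h) (floor_mul h zeta) - g a (floor_mul h zeta)) / h
       else 0) * (xi - a)
  <= g xi zeta + 6 * B * h * (1 + `|xi - a|)
     + B0 / N * (`|zeta| + `|zeta| * `|zeta - b|).
Proof.
move=> c1 c2 g0 gB0 gB B0B N0 JN aJ bJ h0 h1 xi zeta.
have J0 : 0 <= J by exact: le_trans (normr_ge0 _) aJ.
have B00 : 0 <= B0 by apply: le_trans (g0 0 0) (gB0 _ _ _ _); rewrite normr0; lra.
have lip : forall s t, `|s| <= J + 1 -> `|t| <= J + 1 ->
    `|g a s - g a t| <= B0 * `|s - t|.
  move=> s t sN tN; apply: (convex_lipschitz (N := J) (c2 a)) => //.
  by move=> r rN; apply: gB0 => //; lra.
have bh s : b <= s -> s <= b + h -> `|g a s - g a b| <= B0 * `|s - b|.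
  move=> s1 s2; apply: lip; last by lra.
  by move: bJ; rewrite !ler_norml => /andP[? ?]; apply/andP; split; lra.
set t := (g a (b + h) - g a b) / h.
have Q1 := convex_above_quotient (c2 a) h0 bh zeta; rewrite -/t in Q1.
have tB : `|t| <= B0.
  rewrite /t normrM normfV (gtr0_norm h0) ler_pdivrMr//.
  have := bh (b + h) (ltac:(lra)) (lexx _).
  by rewrite (_ : b + h - b = h) ?(gtr0_norm h0)//; ring.
have Bh : B0 * h <= B * h by rewrite ler_wpM2r// ltW.
have Bh0 : 0 <= B0 * h by rewrite mulr_ge0// ltW.
have P0 : 0 <= B0 / N * (`|zeta| + `|zeta| * `|zeta - b|).
  by rewrite mulr_ge0 ?divr_ge0 ?addr_ge0 ?mulr_ge0// ltW.
have Bx : 0 <= B * h * `|xi - a| by rewrite mulr_ge0//; lra.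
case: ifPn => [zN|]; last first.
  rewrite -ltNge => zN; rewrite mul0r addr0.
  have gab : g a b <= B0 by apply: gB0; lra.
  have tz : t * (zeta - b) <= B0 * `|zeta - b|.
    by apply: le_trans (ler_norm _) _; rewrite normrM ler_wpM2r.
  have := g0 xi zeta.
  suff : B0 * (1 + `|zeta - b|) <= B0 / N * (`|zeta| + `|zeta| * `|zeta - b|) by lra.
  rewrite -mulrA ler_wpM2l// (_ : `|zeta| + `|zeta| * `|zeta - b| = `|zeta| * (1 + `|zeta - b|)); last by ring.
  rewrite mulrA ler_peMl ?addr_ge0//.
  by rewrite mulrC ler_pdivlMr// mul1r ltW.
have Q2 := @convex_above_frozen_quotient _ g B N a zeta (floor_mul h zeta) h c1 c2 g0 gB
  (le_trans aJ JN) zN (floor_mul_near _ h0) h0 h1 xi.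
set P := B0 / N * _ in P0 *; set D := _ / h in Q2 *.
set r := `|xi - a| in Bx Q2 *.
have -> : 6 * B * h * (1 + r) = 6 * (B * h) + 6 * (B * h * r) by ring.
rewrite (_ : 4 * B * h * (1 + r) = 4 * (B * h) + 4 * (B * h * r)) in Q2; last by ring.
lra.
Qed.

End two_tangents.

Section finite_product.
Context d1 d2 (T1 : measurableType d1) (T2 : measurableType d2) {R : realType}.
Variables (m1 : {finite_measure set T1 -> \bar R})
          (m2 : {finite_measure set T2 -> \bar R}).

Lemma finite_product_lty : ((m1 \x m2)%E setT < +oo)%E.
Proof.
rewrite -setXTT product_measure1E//.
by rewrite lte_mul_pinfty ?fin_num_measure// finite_measure_lty.
Qed.

Lemma itg_fst (f : T1 -> R) : measurable_fun setT f -> (forall x, 0 <= f x) ->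
  itg (m1 \x m2)%E (f \o fst) = (itg m1 f * m2 setT)%E.
Proof.
move=> mf f0; rewrite /itg fubini_tonelli1//=.
- rewrite /fubini_F/=; under eq_integral do rewrite integral_cst//.
  rewrite ge0_integralZr//; [exact/measurable_EFinP|].
  by move=> x _; rewrite lee_fin.
- by apply/measurable_EFinP; exact: measurableT_comp.
- by move=> z; rewrite lee_fin.
Qed.

Lemma itg_snd (f : T2 -> R) : measurable_fun setT f -> (forall x, 0 <= f x) ->
  itg (m1 \x m2)%E (f \o snd) = (itg m2 f * m1 setT)%E.
Proof.
move=> mf f0; rewrite /itg fubini_tonelli2//=.
- rewrite /fubini_G/=; under eq_integral do rewrite integral_cst//.
  rewrite ge0_integralZr//; [exact/measurable_EFinP|].
  by move=> x _; rewrite lee_fin.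
- by apply/measurable_EFinP; exact: measurableT_comp.
- by move=> z; rewrite lee_fin.
Qed.

End finite_product.

Section weak_limit.
Context d (T : measurableType d) {R : realType}.
Variable mu : {finite_measure set T -> \bar R}.
Local Notation mu2 := (mu \x mu)%E.

Lemma integrable_bounded_mul (f : T -> R) (D : T * T -> R) (B : R) :
  sq_integrable mu f -> measurable_fun setT D -> (forall z, `|D z| <= B) ->
  mu2.-integrable setT (EFin \o (fun z => D z * f z.1)) /\
  mu2.-integrable setT (EFin \o (fun z => D z * f z.2)).
Proof.
move=> L2f mD DB; have [mf _] := L2f.
have B0 : 0 <= B by exact: le_trans (normr_ge0 _) (DB (point, point)).
have fin : (itg mu (fun x => `|f x|)%R < +oo)%E.
  exact: le_lt_trans (itg_norm_le L2f) (ltry _).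
have muT := finite_measure_lty mu.
have mn : measurable_fun setT (fun x => `|f x|) by exact: measurableT_comp.
have n0 x : 0 <= `|f x| by [].
split.
- have i1 : mu2.-integrable setT (EFin \o (fun z : T * T => `|f z.1|)).
    apply: integrable_itg => //; first exact: (measurableT_comp mn).
    rewrite [X in (X < _)%E](_ : _ = (itg mu (fun x => `|f x|)%R * mu setT)%E).
      by rewrite lte_mul_pinfty// ?itg_ge0// ge0_fin_numE ?itg_ge0.
    exact: itg_fst.
  apply: (le_integrable measurableT _ _ (integrableZl measurableT B i1)).
    by apply/measurable_EFinP; apply: measurable_funM => //; exact: measurableT_comp.
  move=> z _ /=; rewrite lee_fin !normrM normr_id (ger0_norm B0).
  by rewrite ler_wpM2r.
- have i1 : mu2.-integrable setT (EFin \o (fun z : T * T => `|f z.2|)).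
    apply: integrable_itg => //; first exact: (measurableT_comp mn).
    rewrite [X in (X < _)%E](_ : _ = (itg mu (fun x => `|f x|)%R * mu setT)%E).
      by rewrite lte_mul_pinfty// ?itg_ge0// ge0_fin_numE ?itg_ge0.
    exact: itg_snd.
  apply: (le_integrable measurableT _ _ (integrableZl measurableT B i1)).
    by apply/measurable_EFinP; apply: measurable_funM => //; exact: measurableT_comp.
  move=> z _ /=; rewrite lee_fin !normrM normr_id (ger0_norm B0).
  by rewrite ler_wpM2r.
Qed.


Variables (w : nat -> T -> R) (K : R).
Hypothesis L2w : forall k, sq_integrable mu (w k).
Hypothesis wK : forall k, norm2 mu (w k) <= K.
Hypothesis w0 : forall v, sq_integrable mu v ->
  \int[mu]_x (w k x * v x) @[k --> \oo] --> 0.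

(** Freezing [y], weak convergence gives convergence to zero of the inner
    integral; dominated convergence then gives it in the mean over [y]. *)
Lemma weakly_null_kernel (D : T * T -> R) (B : R) :
  measurable_fun setT D -> (forall z, `|D z| <= B) ->
  (forall k, measurable_fun setT (fun y => \int[mu]_x (D (x, y) * w k x))) /\
  itg mu (fun y => `|\int[mu]_x (D (x, y) * w k x)|) @[k --> \oo] --> 0%E.
Proof.
move=> mD DB; have B0 : 0 <= B by exact: le_trans (normr_ge0 _) (DB (point, point)).
have K0 : 0 <= K by exact: le_trans (norm2_ge0 _ _) (wK 0%N).
have mDy y : measurable_fun setT (fun x => D (x, y)).
  by apply: (measurableT_comp mD); exact: measurable_pair2.
have L2D y : sq_integrable mu (fun x => D (x, y)).
  exact: (@sq_integrable_bounded _ _ _ _ _ B).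
have mW k : measurable_fun setT (fun y => \int[mu]_x (D (x, y) * w k x)).
  apply: (measurableT_comp (@fine_measurable _ setT measurableT)).
  have [i1 _] := integrable_bounded_mul (L2w k) mD DB.
  exact: (measurable_fubini_G i1).
split=> //.
have -> : 0%E = itg mu (fun=> 0) :> \bar R by rewrite itg_cst mul0e.
apply: (@bounded_cvg_itg _ _ _ _ _ _ _ (B * (K * norm2 mu (fun=> 1)))).
- exact: finite_measure_lty.
- by move=> k; exact: measurableT_comp.
- exact: measurable_cst.
- move=> k y; rewrite normr_id.
  have iw := sq_integrable_integrable (L2w k).
  have iDw := sq_integrable_mul (L2D y) (L2w k).
  apply: (le_trans (le_normr_Rintegral measurableT iDw)).
  apply: (@le_trans _ _ (\int[mu]_x (B * `|w k x|))).
    apply: le_Rintegral => //.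
    - exact: (integrable_norm iDw).
    - by have := integrableZl measurableT B (integrable_norm iw); apply: eq_integrable.
    - by move=> x _; rewrite normrM ler_wpM2r.
  rewrite RintegralZl//; last exact: (integrable_norm iw).
  rewrite ler_wpM2l//.
  have := itg_norm_le (L2w k); rewrite /itg => H.
  rewrite -lee_fin /Rintegral fineK; last first.
    by apply: integrable_fin_num => //; exact: (integrable_norm iw).
  apply: (le_trans H); rewrite lee_fin ler_wpM2r ?norm2_ge0//; exact: wK.
- apply/nearW => y; apply/norm_cvg0P.
  by have := w0 (L2D y); under eq_fun do under eq_Rintegral do rewrite mulrC.
Qed.

Lemma weakly_null_kernel_fst (D : T * T -> R) (B : R) (theta : nat -> T -> R) :
  measurable_fun setT D -> (forall z, `|D z| <= B) ->
  (forall k, measurable_fun setT (theta k)) -> (forall k y, `|theta k y| <= 1) ->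
  \int[mu2]_z (theta k z.2 * D z * w k z.1) @[k --> \oo] --> 0.
Proof.
move=> mD DB mth th1; have [mW H] := weakly_null_kernel mD DB.
have mtD k : measurable_fun setT (fun z => theta k z.2 * D z).
  by apply: measurable_funM => //; exact: measurableT_comp.
have tDB k z : `|theta k z.2 * D z| <= B.
  by rewrite normrM; apply: le_trans (DB z); rewrite ler_piMl.
have iz k := (integrable_bounded_mul (L2w k) (mtD k) (tDB k)).1.
apply/norm_cvg0P.
suff : (`|\int[mu2]_z (theta k z.2 * D z * w k z.1)|)%:E @[k --> \oo] --> 0%E.
  by move/fine_cvgP => [].
apply: (@squeeze_cvge _ _ _ _ (cst 0%E) _ _ _ _ (cvg_cst _) H).
apply: nearW => k; rewrite lee_fin normr_ge0/=.
rewrite EFin_normr_Rintegral// -(integral21_prod_meas1 (iz k)).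
have E y : fubini_G mu (EFin \o (fun z => theta k z.2 * D z * w k z.1)) y =
    (theta k y * \int[mu]_x (D (x, y) * w k x))%:E.
  rewrite /fubini_G/=.
  have mDy : measurable_fun setT (fun x => D (x, y)).
    by apply: (measurableT_comp mD); exact: measurable_pair2.
  have iy : mu.-integrable setT (EFin \o (fun x => D (x, y) * w k x)).
    by apply: sq_integrable_mul => //; exact: (@sq_integrable_bounded _ _ _ _ _ B).
  rewrite -RintegralZl// /Rintegral fineK.
    by apply: eq_integral => x _; rewrite mulrA.
  apply: integrable_fin_num => //.
  by have := integrableZl measurableT (theta k y) iy; apply: eq_integrable.
under eq_integral do rewrite E.
apply: (le_trans (le_abse_integral _ _ _)) => //.
  by apply/measurable_EFinP; exact: measurable_funM.
apply: le_itg => //.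
- by apply: measurableT_comp => //; exact: measurable_funM.
- exact: measurableT_comp.
- by move=> y; rewrite normrM ler_piMl.
Qed.

Lemma weakly_null_kernel_snd (D : T * T -> R) (B : R) :
  measurable_fun setT D -> (forall z, `|D z| <= B) ->
  \int[mu2]_z (D z * w k z.2) @[k --> \oo] --> 0.
Proof.
move=> mD DB.
have mD' : measurable_fun setT (fun z : T * T => D (z.2, z.1)).
  apply: (measurableT_comp mD); apply/measurable_fun_pairP; split.
    exact: measurable_snd.
  exact: measurable_fst.
have [mW H] := weakly_null_kernel mD' (fun z => DB (z.2, z.1)).
have iz k := (integrable_bounded_mul (L2w k) mD DB).2.
apply/norm_cvg0P.
suff : (`|\int[mu2]_z (D z * w k z.2)|)%:E @[k --> \oo] --> 0%E.
  by move/fine_cvgP => [].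
apply: (@squeeze_cvge _ _ _ _ (cst 0%E) _ _ _ _ (cvg_cst _) H).
apply: nearW => k; rewrite lee_fin normr_ge0/=.
rewrite EFin_normr_Rintegral// -(integral12_prod_meas1 (iz k)).
have E x : fubini_F mu (EFin \o (fun z => D z * w k z.2)) x =
    (\int[mu]_y (D (x, y) * w k y))%:E.
  rewrite /fubini_F/=.
  have mDx : measurable_fun setT (fun y => D (x, y)).
    by apply: (measurableT_comp mD); exact: measurable_pair1.
  have iy : mu.-integrable setT (EFin \o (fun y => D (x, y) * w k y)).
    by apply: sq_integrable_mul => //; exact: (@sq_integrable_bounded _ _ _ _ _ B).
  by rewrite /Rintegral fineK//; exact: integrable_fin_num.
under eq_integral do rewrite E.
apply: (le_trans (le_abse_integral _ _ _)) => //.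
exact/measurable_EFinP/mW.
Qed.

End weak_limit.

(** * Weak lower semicontinuity of separately convex double integrals *)

Lemma int_window (i : int) (M : nat) : - Posz M <= i -> i <= Posz M ->
  exists2 k : nat, k \in iota 0 (2 * M).+1 & i = Posz k - Posz M.
Proof.
move=> Mi iM; exists (absz (i + Posz M)%R); last by lia.
by rewrite mem_iota; lia.
Qed.

Lemma cvg_sum0 (R : realType) (I : Type) (s : seq I) (f : nat -> I -> R) :
  (forall i, f k i @[k --> \oo] --> 0) ->
  \sum_(i <- s) f k i @[k --> \oo] --> 0.
Proof.
move=> f0; elim: s => [|i s IH].
  by under eq_fun do rewrite big_nil; exact: cvg_cst.
under eq_fun do rewrite big_cons.
have := cvgD (f0 i) IH; rewrite addr0; exact.
Qed.

Lemma cvg0_small (R : realType) (f : nat -> R) (e : R) :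
  f k @[k --> \oo] --> 0 -> 0 < e ->
  exists K, forall k, (K <= k)%N -> `|f k| <= e.
Proof.
move=> /cvgrPdist_le f0 e0; have [K _ HK] := f0 _ e0.
by exists K => k Kk; have := HK k Kk; rewrite /= sub0r normrN.
Qed.

Lemma norm_sub_le (R : realDomainType) (a b B : R) :
  0 <= a -> a <= B -> 0 <= b -> b <= B -> `|a - b| <= B.
Proof. by move=> *; rewrite ler_norml; apply/andP; split; lra. Qed.

Section weak_lsc.
Context d (T : measurableType d) {R : realType}.
Variable mu : {finite_measure set T -> \bar R}.
Local Notation mu2 := (mu \x mu)%E.

Definition weakly_cvg (us : nat -> T -> R) (u : T -> R) :=
  forall v, sq_integrable mu v ->
    \int[mu]_x (us k x * v x) @[k --> \oo] --> \int[mu]_x (u x * v x).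

Variables (us : nat -> T -> R) (u : T -> R).
Hypothesis L2us : forall k, sq_integrable mu (us k).
Hypothesis L2u : sq_integrable mu u.
Hypothesis us_u : weakly_cvg us u.

Lemma weakly_cvg_bounded : exists K, forall k, norm2 mu (us k) <= K.
Proof.
apply: uniform_boundedness => // v L2v.
have /cvg_seq_bounded[M [_ HM]] := @cvgP _ _ _ (us_u L2v).
by exists (M + 1) => k; apply: HM => //; rewrite ltrDl.
Qed.

Let w k x := us k x - u x.

Let L2w k : sq_integrable mu (w k).
Proof. exact: sq_integrableB. Qed.

Let w0 v : sq_integrable mu v -> \int[mu]_x (w k x * v x) @[k --> \oo] --> 0.
Proof.
move=> L2v.
have E k : \int[mu]_x (w k x * v x) =
    \int[mu]_x (us k x * v x) - \int[mu]_x (u x * v x).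
  rewrite -RintegralB//; try exact: sq_integrable_mul.
  by apply: eq_Rintegral => x _; rewrite /w mulrBl.
under eq_fun do rewrite E.
by apply/subr_cvg0; exact: us_u.
Qed.

Variables (g : T * T -> R -> R -> R) (E : nat -> set (T * T)).
Hypothesis mg : forall xi zeta, measurable_fun setT (fun z => g z xi zeta).
Hypothesis cg : forall z, continuous (fun v : R * R => g z v.1 v.2).
Hypothesis g0 : forall z xi zeta, 0 <= g z xi zeta.
Hypothesis c1 : forall z eta, convex_on_line ((g z) ^~ eta).
Hypothesis c2 : forall z xi, convex_on_line (g z xi).
Hypothesis mE : forall j, measurable (E j).
Hypothesis ndE : forall i j, (i <= j)%N -> E i `<=` E j.
Hypothesis coverE : forall z, exists j, E j z.
Hypothesis gE : forall (j : nat) (N : R), exists B : R,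
  forall z, E j z -> forall xi eta : R,
  `|xi| <= N -> `|eta| <= N -> g z xi eta <= B.

Let mu_ : measurable_fun setT u. Proof. by case: L2u. Qed.
Let mus k : measurable_fun setT (us k). Proof. by case: (L2us k). Qed.
Let m1 (f : T -> R) : measurable_fun setT f ->
  measurable_fun setT (fun z : T * T => f z.1).
Proof. by move=> mf; exact: measurableT_comp. Qed.
Let m2 (f : T -> R) : measurable_fun setT f ->
  measurable_fun setT (fun z : T * T => f z.2).
Proof. by move=> mf; exact: measurableT_comp. Qed.

Let F j := E j `&` [set z | `|u z.1| <= j%:R] `&` [set z | `|u z.2| <= j%:R].

Let mF j : measurable (F j).
Proof.
have ml (f : T * T -> R) : measurable_fun setT f -> measurable [set z | `|f z| <= j%:R].
  move=> mf.
  rewrite (_ : [set z | _] = setT `&` ((fun z => `|f z|) @^-1` `]-oo, j%:R]%classic)).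
    by apply: measurableT_comp.
  by rewrite setTI; apply/seteqP; split => z /=; rewrite in_itv.
by apply: measurableI; [apply: measurableI => //|]; apply: ml; [exact: m1|exact: m2].
Qed.

Let energy (a : T -> R) := itg mu2 (fun z => g z (a z.1) (a z.2)).

(** The truncated domain [F j] makes the energy density of [u] and its tangents
    bounded, with constants independent of the truncation of [us k]. *)
Lemma truncated_weak_lsc (j : nat) (C e : R) : 0 < e ->
  (forall K, exists2 k, (K <= k)%N & (energy (us k) <= C%:E)%E) ->
  (itg mu2 (fun z => (\1_(F j) z * g z (u z.1) (u z.2))%R) <= (C + e)%:E)%E.
Proof.
move=> e0 HC.
have [K0 usK] := weakly_cvg_bounded.
have K00 : 0 <= K0 by exact: le_trans (norm2_ge0 _ _) (usK 0%N).
pose K := K0 + norm2 mu u.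
have K0_ : 0 <= K by rewrite addr_ge0 ?norm2_ge0.
have wK k : norm2 mu (w k) <= K.
  have := norm2D (L2us k) (sq_integrableZ (-1) L2u).
  rewrite norm2Z// normrN1 mul1r => H.
  apply: (@le_trans _ _ (norm2 mu (us k) + norm2 mu u)); last by rewrite lerD2r.
  apply: le_trans H; rewrite le_eqVlt; apply/orP; left; apply/eqP.
  by congr norm2; apply/funext => x; rewrite mulN1r.
pose m := norm2 mu (fun=> 1 : R).
have m0 : 0 <= m by exact: norm2_ge0.
have mE2 : fine (mu setT) = m ^+ 2.
  by rewrite norm2_sqr; under eq_Rintegral do rewrite expr1n; rewrite Rintegral_cst// mul1r.
have [B0' HB0'] := gE j (j%:R + 2).
pose B0 := Num.max 0 B0'.
have B00 : 0 <= B0 by rewrite le_max lexx.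
have HB0 z : E j z -> forall xi eta, `|xi| <= j%:R + 2 -> `|eta| <= j%:R + 2 ->
    g z xi eta <= B0.
  by move=> Ez xi eta xiN etaN; rewrite le_max (HB0' z)// orbT.
(* [c2] times [norm2]-bounds of the tail term is at most [e / 3] *)
pose Q := B0 * (K0 * m + K0 * K) * m ^+ 2.
have Q0 : 0 <= Q by rewrite /Q mulr_ge0 ?exprn_ge0// mulr_ge0// addr_ge0// mulr_ge0.
pose N : R := j%:R + 1 + 3 * Q / e.
have QN : 0 <= 3 * Q / e by apply: divr_ge0; [exact: mulr_ge0|exact: ltW].
have N0 : 0 < N by rewrite /N ltr_wpDr// ltr_wpDl.
have jN : j%:R <= N by rewrite /N -addrA lerDl addr_ge0.
have QNe : Q / N <= e / 3.
  rewrite ler_pdivrMr// -ler_pdivrMl ?divr_gt0// invf_div mulrAC.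
  by rewrite /N lerDr addr_ge0.
have [B' HB'] := gE j (N + 2).
pose B := Num.max B0 B'.
have B0B : B0 <= B by rewrite le_max lexx.
have B_0 : 0 <= B by exact: le_trans B0B.
have HB z : E j z -> forall xi eta, `|xi| <= N + 2 -> `|eta| <= N + 2 ->
    g z xi eta <= B.
  by move=> Ez xi eta xiN etaN; rewrite le_max (HB' z)// orbT.
pose P := 6 * B * (m ^+ 2 + K * m) * m ^+ 2.
have P0 : 0 <= P.
  by rewrite /P mulr_ge0 ?exprn_ge0// mulr_ge0 ?mulr_ge0// addr_ge0 ?exprn_ge0// mulr_ge0.
pose h : R := (1 + 3 * P / e)^-1.
have PN : 0 <= 3 * P / e by apply: divr_ge0; [exact: mulr_ge0|exact: ltW].
have hd : 0 < 1 + 3 * P / e by rewrite ltr_pwDl.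
have h0 : 0 < h by rewrite invr_gt0.
have h1 : h <= 1 by rewrite invf_le1// lerDl.
have Ph : P * h <= e / 3.
  rewrite /h ler_pdivrMr// -ler_pdivrMl ?divr_gt0// invf_div mulrAC; lra.
(* the finitely many values of [floor_mul h] on [-N, N] *)
pose Z : seq R := undup [seq h * (Posz i - Posz (Num.trunc (N / h)).+1)%:~R
  | i <- iota 0 (2 * (Num.trunc (N / h)).+1).+1].
have ZP t : `|t| <= N -> floor_mul h t \in Z.
  move=> tN; rewrite mem_undup /floor_mul.
  set M := (Num.trunc (N / h)).+1.
  have NM : N / h < M%:R by exact: truncnS_gt.
  have th : `|t / h| <= N / h by rewrite normrM normfV (gtr0_norm h0) ler_pM2r// invr_gt0.
  have Mt : (- Posz M <= Num.floor (t / h)).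
    rewrite floor_ge_int rmorphN/=; move: th; rewrite ler_norml => /andP[th _].
    by apply: le_trans th; rewrite lerN2 ltW.
  have tM : Num.floor (t / h) <= Posz M.
    rewrite -(ler_int R); apply: (le_trans (floor_le _)).
    by move: th; rewrite ler_norml => /andP[_ th]; apply: (le_trans th); rewrite ltW.
  have [k km ->] := int_window Mt tM.
  by apply/mapP; exists k.
pose s (zeta : R) (z : T * T) := \1_(F j) z * ((g z (u z.1 + h) zeta - g z (u z.1) zeta) / h).
pose t (z : T * T) := \1_(F j) z * ((g z (u z.1) (u z.2 + h) - g z (u z.1) (u z.2)) / h).
pose theta zeta k x : R := \1_[set y | `|us k y| <= N /\ floor_mul h (us k y) = zeta] x.
have jj2 : j%:R <= j%:R + 2 :> R by rewrite lerDl.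
have FE z : F j z -> [/\ E j z, `|u z.1| <= j%:R & `|u z.2| <= j%:R] by move=> [[]].
have m1F : measurable_fun setT (\1_(F j) : T * T -> R) by exact: measurable_indic.
have mtheta zeta k : measurable_fun setT (theta zeta k).
  apply: measurable_indic.
  rewrite (_ : [set y | _] = (setT `&` ((fun y => `|us k y|) @^-1` `]-oo, N]%classic)) `&`
      (setT `&` ((floor_mul h \o us k) @^-1` [set zeta]))).
    apply: measurableI; first by apply: measurableT_comp.
    by apply: (measurableT_comp (measurable_floor_mul h0)).
  by rewrite !setTI; apply/seteqP; split => y /=; rewrite in_itv.
have theta1 zeta k y : `|theta zeta k y| <= 1.
  by rewrite /theta indicE; case: (_ \in _); rewrite ?normr1 ?normr0.
have mu1h : measurable_fun setT (fun z : T * T => u z.1 + h).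
  by apply: measurable_funD => //; exact: m1.
have mu2h : measurable_fun setT (fun z : T * T => u z.2 + h).
  by apply: measurable_funD => //; exact: m2.
have ms zeta : measurable_fun setT (s zeta).
  apply: measurable_funM => //; apply: measurable_funM => //.
  by apply: measurable_funB; apply: (measurable_caratheodory mg cg) => //; exact: m1.
have mt : measurable_fun setT t.
  apply: measurable_funM => //; apply: measurable_funM => //.
  by apply: measurable_funB; apply: (measurable_caratheodory mg cg) => //; [exact: m1|exact: m1|exact: m2].
have sB zeta : exists Bs, forall z, `|s zeta z| <= Bs.
  have [B1 HB1] := gE j (j%:R + 1 + `|zeta|).
  exists (`|B1| / h) => z; rewrite /s indicE; case: (boolP (z \in _)) => [|_]; last first.
    by rewrite mul0r normr0 divr_ge0// ltW.
  rewrite inE => /FE[Ez uz1 uz2]; rewrite mul1r normrM normfV (gtr0_norm h0).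
  rewrite ler_pM2r ?invr_gt0//.
  have b1 : g z (u z.1 + h) zeta <= B1.
    apply: HB1 => //; last by rewrite lerDr addr_ge0.
    apply: (le_trans (ler_normD _ _)); rewrite (gtr0_norm h0) -addrA lerD//.
    by apply: (le_trans h1); rewrite lerDl.
  have b2 : g z (u z.1) zeta <= B1.
    by apply: HB1 => //; rewrite ?lerDr ?addr_ge0// -addrA (le_trans uz1)// lerDl addr_ge0.
  by apply: (le_trans _ (ler_norm B1)); exact: norm_sub_le.
have [Bt tB] : exists Bt, forall z, `|t z| <= Bt.
  exists (B0 / h) => z; rewrite /t indicE; case: (boolP (z \in _)) => [|_]; last first.
    by rewrite mul0r normr0 divr_ge0// ltW.
  rewrite inE => /FE[Ez uz1 uz2]; rewrite mul1r normrM normfV (gtr0_norm h0).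
  rewrite ler_pM2r ?invr_gt0//.
  have b1 : g z (u z.1) (u z.2 + h) <= B0.
    apply: HB0 => //; first exact: le_trans jj2.
    apply: (le_trans (ler_normD _ _)); rewrite (gtr0_norm h0) lerD//.
    by apply: (le_trans h1); rewrite ler1n.
  have b2 : g z (u z.1) (u z.2) <= B0 by apply: HB0 => //; exact: le_trans jj2.
  exact: norm_sub_le.
pose Psi (k : nat) (z : T * T) : R := \sum_(zeta <- Z) theta zeta k z.2 * s zeta z * w k z.1.
pose chi1 (k : nat) (z : T * T) : R := 6 * B * h * (1 + `|w k z.1|).
pose chi2 (k : nat) (z : T * T) : R := B0 / N * (`|us k z.2| + `|us k z.2| * `|w k z.2|).
have chi1_0 k (z : T * T) : 0 <= chi1 k z by rewrite !mulr_ge0 ?addr_ge0// ltW.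
have chi2_0 k (z : T * T) : 0 <= chi2 k z.
  have N0' := ltW N0; apply: mulr_ge0; first exact: divr_ge0.
  by apply: addr_ge0 => //; exact: mulr_ge0.
have pointwise k z : \1_(F j) z * g z (u z.1) (u z.2) + t z * w k z.2 + Psi k z <=
    g z (us k z.1) (us k z.2) + chi1 k z + chi2 k z.
  case: (boolP (z \in F j)) => zF; last first.
    rewrite /t /Psi big1 => [|zeta _].
      by rewrite indicE (negbTE zF) !mul0r !addr0 !addr_ge0.
    by rewrite /s indicE (negbTE zF) mul0r mulr0 mul0r.
  have [Ez uz1 uz2] : [/\ E j z, `|u z.1| <= j%:R & `|u z.2| <= j%:R].
    by apply: FE; rewrite inE in zF.
  have := @convex_above_two_tangents _ (g z) B0 B j%:R N (u z.1) (u z.2) h (c1 z) (c2 z)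
    (g0 z) (HB0 z Ez) (HB z Ez) B0B N0 jN uz1 uz2 h0 h1 (us k z.1) (us k z.2).
  have -> : Psi k z = (if `|us k z.2| <= N then
      (g z (u z.1 + h) (floor_mul h (us k z.2)) - g z (u z.1) (floor_mul h (us k z.2))) / h
      else 0) * (us k z.1 - u z.1).
    rewrite /Psi; case: ifPn => usN; last first.
      rewrite mul0r big1// => zeta _; rewrite /theta indicE memNset ?mul0r//.
      by move=> [/=]; rewrite (negbTE usN).
    rewrite (bigD1_seq (floor_mul h (us k z.2))) ?undup_uniq ?ZP//=.
    rewrite big1 ?addr0 => [|zeta zetaN]; last first.
      rewrite /theta indicE memNset ?mul0r//= => -[_ zE].
      by move: zetaN; rewrite zE eqxx.
    by rewrite /theta indicE mem_set//= mul1r /s indicE zF mul1r.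
  by rewrite /t indicE zF !mul1r /chi1 /chi2 /w.
have I2 : \int[mu2]_z (t z * w k z.2) @[k --> \oo] --> 0.
  exact: (weakly_null_kernel_snd L2w wK w0 mt tB).
have I3 : \sum_(zeta <- Z) \int[mu2]_z (theta zeta k z.2 * s zeta z * w k z.1)
    @[k --> \oo] --> 0.
  apply: cvg_sum0 => zeta; have [Bs sBs] := sB zeta.
  exact: (weakly_null_kernel_fst L2w wK w0 (ms zeta) sBs (mtheta zeta) (theta1 zeta)).
have e6 : 0 < e / 6 by rewrite divr_gt0.
have [k1 Hk1] := cvg0_small I2 e6.
have [k2 Hk2] := cvg0_small I3 e6.
have [k kk gkC] := HC (maxn k1 k2).
have {Hk1} := Hk1 k (leq_trans (leq_maxl _ _) kk).
have {Hk2} := Hk2 k (leq_trans (leq_maxr _ _) kk).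
move=> J3 J2.
have mgk : measurable_fun setT (fun z => g z (us k z.1) (us k z.2)).
  by apply: (measurable_caratheodory mg cg); [exact: m1|exact: m2].
have igk : mu2.-integrable setT (EFin \o (fun z => g z (us k z.1) (us k z.2))).
  by apply: integrable_itg => //; exact: le_lt_trans gkC (ltry _).
have mgu : measurable_fun setT (fun z => \1_(F j) z * g z (u z.1) (u z.2)).
  apply: measurable_funM => //.
  by apply: (measurable_caratheodory mg cg); [exact: m1|exact: m2].
have gu0 z : 0 <= \1_(F j) z * g z (u z.1) (u z.2) by rewrite mulr_ge0.
have igu : mu2.-integrable setT (EFin \o (fun z => \1_(F j) z * g z (u z.1) (u z.2))).
  apply: (@bounded_integrable _ _ _ _ (finite_product_lty mu mu) _ B0) => // z.
  rewrite ger0_norm// indicE; case: (boolP (z \in _)) => [|_]; last by rewrite mul0r.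
  by rewrite inE mul1r => /FE[Ez uz1 uz2]; apply: HB0 => //; exact: le_trans jj2.
have it : mu2.-integrable setT (EFin \o (fun z => t z * w k z.2)).
  by have [] := integrable_bounded_mul (L2w k) mt tB.
have is_ zeta : mu2.-integrable setT
    (EFin \o (fun z => theta zeta k z.2 * s zeta z * w k z.1)).
  have [Bs sBs] := sB zeta.
  apply: (integrable_bounded_mul (L2w k) (B := Bs) _ _).1.
    by apply: measurable_funM => //; exact: m2.
  by move=> z; rewrite normrM (le_trans _ (sBs z))// ler_piMl.
have iPsi : mu2.-integrable setT (EFin \o Psi k).
  have : mu2.-integrable setT
      (fun z => \sum_(zeta <- Z) (theta zeta k z.2 * s zeta z * w k z.1)%:E)%E.
    by apply: integrable_sum => // zeta _; exact: is_.
  by apply: eq_integrable => // z _; rewrite /= -sumEFin.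
have mw : measurable_fun setT (w k) by case: (L2w k).
have mchi1 : measurable_fun setT (chi1 k).
  apply: measurable_funM => //; apply: measurable_funD => //.
  by apply: measurableT_comp => //; exact: m1.
have mchi2 : measurable_fun setT (chi2 k).
  apply: measurable_funM => //; apply: measurable_funD.
    by apply: measurableT_comp => //; exact: m2.
  by apply: measurable_funM; apply: measurableT_comp => //; exact: m2.
have muE : mu setT = (m ^+ 2)%:E by rewrite -mE2 fineK// fin_num_measure.
have nw : measurable_fun setT (fun x => `|w k x|) by exact: measurableT_comp.
have nus : measurable_fun setT (fun x => `|us k x|) by exact: measurableT_comp.
have ichi1 : (itg mu2 (chi1 k) <= (e / 3)%:E)%E.
  have mm : measurable_fun setT (fun x => 1 + `|w k x|) by exact: measurable_funD.
  rewrite /chi1 itgZ; last 3 first.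
  - by apply: measurable_funD => //; apply: measurableT_comp => //; exact: m1.
  - by move=> z; rewrite addr_ge0.
  - by rewrite !mulr_ge0// ltW.
  rewrite [X in (_ * X)%E](_ : _ = (itg mu (fun x => 1 + `|w k x|)%R * mu setT)%E); last first.
    by apply: itg_fst => // x; rewrite addr_ge0.
  rewrite itgD// itg_cst muE mul1e.
  apply: (@le_trans _ _ ((6 * B * h)%:E *
      (((m ^+ 2)%:E + (K * m)%:E) * (m ^+ 2)%:E))%E).
    apply: lee_wpmul2l; first by rewrite lee_fin !mulr_ge0// ltW.
    apply: lee_wpmul2r; first by rewrite lee_fin exprn_ge0.
    apply: leeD; first by rewrite le_eqVlt; apply/orP; left; apply/eqP; exact: muE.
    by apply: (le_trans (itg_norm_le (L2w k))); rewrite lee_fin ler_wpM2r.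
  rewrite -EFinD -!EFinM lee_fin; apply: le_trans Ph.
  by rewrite le_eqVlt; apply/orP; left; apply/eqP; rewrite /P; ring.
have ichi2 : (itg mu2 (chi2 k) <= (e / 3)%:E)%E.
  have mm : measurable_fun setT (fun x => `|us k x| * `|w k x|) by exact: measurable_funM.
  have mm' : measurable_fun setT (fun x => `|us k x| + `|us k x| * `|w k x|).
    exact: measurable_funD.
  rewrite /chi2 itgZ; last 3 first.
  - exact: (m2 mm').
  - by move=> z; rewrite addr_ge0 ?mulr_ge0.
  - by rewrite divr_ge0// ltW.
  rewrite [X in (_ * X)%E](_ : _ =
    (itg mu (fun x => `|us k x| + `|us k x| * `|w k x|)%R * mu setT)%E); last first.
    by apply: itg_snd => // x; rewrite addr_ge0 ?mulr_ge0.
  rewrite itgD//.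
  rewrite muE.
  apply: (@le_trans _ _ ((B0 / N)%:E *
      (((K0 * m)%:E + (K0 * K)%:E) * (m ^+ 2)%:E))%E).
    apply: lee_wpmul2l; first by rewrite lee_fin divr_ge0// ltW.
    apply: lee_wpmul2r; first by rewrite lee_fin exprn_ge0.
    apply: leeD.
      by apply: (le_trans (itg_norm_le (L2us k))); rewrite lee_fin ler_wpM2r.
    have L2nu := sq_integrable_norm (L2us k); have L2nw := sq_integrable_norm (L2w k).
    have := cauchy_schwarz L2nu L2nw; rewrite !norm2_norm ger0_norm; last first.
      by apply: Rintegral_ge0 => x _; rewrite mulr_ge0.
    rewrite -lee_fin /Rintegral fineK; last first.
      by apply: integrable_fin_num => //; exact: sq_integrable_mul.
    move/le_trans; apply; rewrite lee_fin.
    by apply: ler_pM; rewrite ?norm2_ge0.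
  rewrite -EFinD -!EFinM lee_fin; apply: le_trans QNe.
  by rewrite le_eqVlt; apply/orP; left; apply/eqP; rewrite /Q; ring.
have jchi1 := integrable_itg mchi1 (chi1_0 k) (le_lt_trans ichi1 (ltry _)).
have jchi2 := integrable_itg mchi2 (chi2_0 k) (le_lt_trans ichi2 (ltry _)).
have iD (f1 f2 : T * T -> R) : mu2.-integrable setT (EFin \o f1) ->
    mu2.-integrable setT (EFin \o f2) ->
    mu2.-integrable setT (EFin \o (fun z => f1 z + f2 z)).
  by move=> i1 i2; have := integrableD measurableT i1 i2; apply: eq_integrable.
have := le_Rintegral measurableT (iD _ _ (iD _ _ igu it) iPsi)
  (iD _ _ (iD _ _ igk jchi1) jchi2) (fun z _ => pointwise k z).
rewrite !RintegralD//; try exact: iD.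
rewrite Rintegral_sum//; set I3k := \sum_(zeta <- Z) _ in J3 *.
have fineb (f : T * T -> R) c : mu2.-integrable setT (EFin \o f) ->
    (itg mu2 f <= c%:E)%E -> \int[mu2]_z f z <= c.
  by move=> fi fc; rewrite -lee_fin /Rintegral fineK//; exact: integrable_fin_num.
have := fineb _ _ igk gkC; have := fineb _ _ jchi1 ichi1; have := fineb _ _ jchi2 ichi2.
rewrite {1}/itg -lee_fin => b1 b2 b3 main.
rewrite -[leLHS]fineK; last exact: integrable_fin_num.
rewrite lee_fin.
move: J2 J3; rewrite !ler_norml => /andP[J2 _] /andP[J3 _].
move: main; rewrite lee_fin in b1; rewrite /Rintegral in J2 J3 b1 b2 b3 *; lra.
Qed.

(** If [u k] converges weakly to [u], the energy of [u] is at most any level that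
    the energies of the [us k] reach infinitely often. *)
Theorem weak_lower_semicontinuity (C : R) :
  (forall K, exists2 k, (K <= k)%N & (energy (us k) <= C%:E)%E) ->
  (energy u <= C%:E)%E.
Proof.
move=> HC.
have mgu : measurable_fun setT (fun z => g z (u z.1) (u z.2)).
  by apply: (measurable_caratheodory mg cg); [exact: m1|exact: m2].
apply: (@fatou_bound _ _ _ _ (fun j z => \1_(F j) z * g z (u z.1) (u z.2))).
- by move=> j; apply: measurable_funM => //; exact: measurable_indic.
- exact: mgu.
- by move=> j z; rewrite mulr_ge0.
- by move=> z.
- apply: aeW => z; apply: cvg_near_cst.
  have [j0 Ej0] := coverE z.
  near=> j.
  rewrite indicE mem_set/= ?mul1r//; split; [split|].
  - apply: (@ndE j0) => //; near: j; exact: nbhs_infty_ge.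
  - by near: j; exact: nbhs_infty_ger.
  - by near: j; exact: nbhs_infty_ger.
- move=> K; exists K => //; apply/lee_addgt0Pr => e e0.
  by rewrite -EFinD; exact: truncated_weak_lsc.
Unshelve. all: by end_near. Qed.

End weak_lsc.

(** * A partition of unity on a cubic lattice *)

Section norms_rV.
Context {R : realType} (n : nat).
Implicit Types v x y : 'rV[R]_n.

Lemma coord_le_norm v i : `|v ord0 i| <= `|v|.
Proof. by rewrite [leRHS]/Num.norm /= mx_normrE; apply/bigmax_geP; right; exists (ord0, i). Qed.

Lemma norm_le_coord v (c : R) : 0 <= c -> (forall i, `|v ord0 i| <= c) -> `|v| <= c.
Proof.
move=> c0 vc; rewrite [leLHS]/Num.norm /= mx_normrE; apply/bigmax_leP; split=> // -[i j] _ /=.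
by rewrite ord1.
Qed.

Lemma enorm_ge0 v : 0 <= enorm v.
Proof. exact: sqrtr_ge0. Qed.

Lemma norm_le_enorm v : `|v| <= enorm v.
Proof.
apply: norm_le_coord => [|i]; first exact: enorm_ge0.
rewrite -sqrtr_sqr; apply: ler_wsqrtr.
by rewrite (bigD1 i)//= lerDl sumr_ge0// => j _; exact: sqr_ge0.
Qed.

Lemma enorm_le_norm v : enorm v <= n%:R * `|v|.
Proof.
have [n0|n0] := posnP n.
  rewrite /enorm big1 ?sqrtr0 ?mulr_ge0// => i _.
  by have := ltn_ord i; lia.
rewrite -(@ger0_norm _ (n%:R * `|v|)) ?mulr_ge0// -sqrtr_sqr; apply: ler_wsqrtr.
apply: (@le_trans _ _ (\sum_(i < n) `|v| ^+ 2)).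
  apply: ler_sum => i _; rewrite -(real_normK (num_real (v ord0 i))).
  by rewrite lerXn2r ?nnegrE// coord_le_norm.
rewrite sumr_const card_ord -[leLHS]mulr_natl exprMn ler_wpM2r ?exprn_ge0//.
by rewrite expr2 ler_peMr// ler1n.
Qed.

Lemma measurable_enorm_sub :
  measurable_fun setT (fun z : 'rV[R]_n * 'rV[R]_n => enorm (z.1 - z.2)).
Proof.
apply: (measurableT_comp (continuous_measurable_fun (@sqrt_continuous R))).
apply: measurable_sum => i; apply: measurable_funX.
under eq_fun do rewrite !mxE.
apply: measurable_funB.
  exact: (measurableT_comp (@measurable_coord_rV R n i) measurable_fst).
exact: (measurableT_comp (@measurable_coord_rV R n i) measurable_snd).
Qed.

End norms_rV.

Section tent.
Context {R : realType}.

Definition tent (t : R) : R := Num.max 0 (1 - `|t|).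

Lemma tent_ge0 t : 0 <= tent t. Proof. by rewrite le_max lexx. Qed.

Lemma tent_le1 t : tent t <= 1.
Proof. by rewrite ge_max ler01 /= gerBl. Qed.

Lemma tent_eq0 t : 1 <= `|t| -> tent t = 0.
Proof. by move=> t1; apply/eqP; rewrite eq_le tent_ge0 andbT ge_max lexx /= subr_le0. Qed.

Lemma tent_lipschitz s t : `|tent s - tent t| <= `|s - t|.
Proof.
wlog st : s t / `|s| <= `|t|.
  move=> H; have [|/ltW ts] := leP `|s| `|t|; first exact: H.
  by rewrite distrC (distrC s); exact: H.
have tst : tent t <= tent s by rewrite /tent le_max2// lerD2l lerN2.
rewrite ger0_norm ?subr_ge0//.
have := ler_distD 0 t s; rewrite !subr0 sub0r normrN => _.
have := lerB_dist t s; rewrite (distrC t) /tent.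
by case: (leP 0 (1 - `|s|)); case: (leP 0 (1 - `|t|)); have := normr_ge0 (s - t); lra.
Qed.

Lemma sum_tent (N : nat) t : 0 <= t -> t <= N%:R ->
  \sum_(k < N.+1) tent (t - k%:R) = 1.
Proof.
move=> t0 tN.
have : forall M : nat, \sum_(k < M.+1) tent (t - k%:R) = if t <= M%:R then 1 else tent (t - M%:R).
  elim=> [|M IH].
    rewrite big_ord_recr big_ord0 /= add0r; case: ifPn => // t0'.
    have -> : t = 0 by apply/eqP; rewrite eq_le t0 t0'.
    by rewrite subrr /tent normr0 subr0 max_r.
  rewrite big_ord_recr /= IH -natr1; case: ifPn => tM.
    rewrite ifT; last by lra.
    by rewrite tent_eq0 ?addr0// ler0_norm; lra.
  rewrite -ltNge in tM; case: ifPn => tM1.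
    rewrite /tent ger0_norm; last by lra.
    rewrite ler0_norm; last by lra.
    by rewrite !max_r; lra.
  rewrite -ltNge in tM1; rewrite (@tent_eq0 (t - M%:R)) ?add0r// ger0_norm; lra.
by move=> ->; rewrite tN.
Qed.

Lemma count_tent (N : nat) (t : R) : \sum_(k < N) (`|t - k%:R| < 1)%R%:R <= 2 :> R.
Proof.
have : forall M : nat, \sum_(k < M) (`|t - k%:R| < 1)%R%:R <=
    (t < M%:R)%R%:R + (t < M%:R - 1)%R%:R :> R.
  elim=> [|M IH]; first by rewrite big_ord0 addr_ge0.
  rewrite big_ord_recr /= -natr1 addrK; apply: (le_trans (lerD IH (lexx _))).
  rewrite ltr_norml.
  case: (ltP t M%:R) => h1; case: (ltP t (M%:R - 1)) => h2;
  case: (ltP t (M%:R + 1)) => h3; case: (ltP (-1) (t - M%:R)) => h4;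
  case: (ltP (t - M%:R) 1) => h5 /=; lra.
move=> /(_ N)/le_trans; apply.
by case: (t < _); case: (t < _) => /=; lra.
Qed.

End tent.

Section lattice.
Context {R : realType} (n N : nat) (eps b : R).
Hypothesis eps0 : 0 < eps.
Local Notation I := {ffun 'I_n -> 'I_N.+1}.
Implicit Types (i : I) (x y : 'rV[R]_n).

Definition lattice_cell i : set 'rV[R]_n :=
  [set x | forall l, `|(x ord0 l + b) / eps - (i l : nat)%:R| < 1].

Definition lattice_bump i x : R := \prod_l tent ((x ord0 l + b) / eps - (i l : nat)%:R).

Lemma lattice_bump_ge0 i x : 0 <= lattice_bump i x.
Proof. by apply: prodr_ge0 => l _; exact: tent_ge0. Qed.

Lemma lattice_bump_support i x : lattice_bump i x != 0 -> lattice_cell i x.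
Proof.
move=> ix l; rewrite ltNge; apply: contra ix => l1.
by rewrite /lattice_bump (bigD1 l)//= tent_eq0 ?mul0r.
Qed.

Lemma sum_lattice_bump x : (forall l, 0 <= (x ord0 l + b) / eps <= N%:R) ->
  \sum_(i : I) lattice_bump i x = 1.
Proof.
move=> xN.
rewrite -(bigA_distr_bigA (fun l (k : 'I_N.+1) => tent ((x ord0 l + b) / eps - k%:R))).
by rewrite big1// => l _; have /andP[x0 xl] := xN l; rewrite sum_tent.
Qed.

Lemma lattice_overlap x : \sum_(i : I) \1_(lattice_cell i) x <= 2 ^+ n :> R.
Proof.
apply: (@le_trans _ _ (\sum_(i : I) \prod_l
    (`|(x ord0 l + b) / eps - (i l : nat)%:R| < 1)%R%:R)).
  apply: ler_sum => i _; rewrite indicE; case: (boolP (x \in _)) => [|_].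
    rewrite inE => xi; rewrite big1// => l _; by rewrite (xi l).
  by apply: prodr_ge0.
rewrite -(bigA_distr_bigA (fun l (k : 'I_N.+1) => (`|(x ord0 l + b) / eps - k%:R| < 1)%R%:R)).
rewrite -[in leRHS](card_ord n) -prodr_const; apply: ler_prod => l _.
by rewrite sumr_ge0//= count_tent.
Qed.

Lemma lattice_cell_diam i x y : lattice_cell i x -> lattice_cell i y ->
  `|x - y| <= 2 * eps.
Proof.
move=> xi yi; apply: norm_le_coord => [|l]; first by rewrite mulr_ge0// ltW.
rewrite !mxE; have := xi l; have := yi l.
set k := (i l : nat)%:R => yl xl.
have -> : x ord0 l - y ord0 l =
    ((x ord0 l + b) / eps - k - ((y ord0 l + b) / eps - k)) * eps.
  by field; rewrite gt_eqF.
rewrite normrM (gtr0_norm eps0) ler_wpM2r ?(ltW eps0)//.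
by apply: (le_trans (ler_normB _ _)); lra.
Qed.

Lemma measurable_lattice_cell i : measurable (lattice_cell i).
Proof.
rewrite (_ : lattice_cell i = \bigcap_(l in [set: 'I_n])
    (setT `&` ((fun x : 'rV[R]_n => (x ord0 l + b) / eps - (i l : nat)%:R) @^-1` `]-1, 1[%classic))).
  apply: fin_bigcap_measurable => //= l _.
  have : measurable_fun setT (fun x : 'rV[R]_n => (x ord0 l + b) / eps - (i l : nat)%:R).
    apply: measurable_funB => //; apply: measurable_funM => //.
    by apply: measurable_funD => //; exact: measurable_coord_rV.
  exact.
apply/seteqP; split => [x xi l _|x xi l].
  by split => //=; rewrite in_itv /= -ltr_norml; exact: xi.
by have [_ /=] := xi l Logic.I; rewrite in_itv /= -ltr_norml.
Qed.

Lemma measurable_lattice_bump i : measurable_fun setT (lattice_bump i).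
Proof.
apply: measurable_prod => l _.
rewrite /tent; apply: measurable_maxr => //; apply: measurable_funB => //.
apply: measurableT_comp => //; apply: measurable_funB => //; apply: measurable_funM => //.
by apply: measurable_funD => //; exact: measurable_coord_rV.
Qed.

Lemma prod_lipschitz (J : Type) (s : seq J) (f g : J -> R) :
  (forall l, 0 <= f l <= 1) -> (forall l, 0 <= g l <= 1) ->
  `|\prod_(l <- s) f l - \prod_(l <- s) g l| <= \sum_(l <- s) `|f l - g l|.
Proof.
move=> f01 g01; elim: s => [|l s IH]; first by rewrite !big_nil subrr normr0.
rewrite !big_cons.
have P0 : 0 <= \prod_(l <- s) f l by apply: prodr_ge0 => k _; case/andP: (f01 k).
have P1 : \prod_(l <- s) f l <= 1.
  by apply: prodr_ile1 => k _; exact: f01.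
have /andP[g0 g1] := g01 l.
set P := \prod_(l <- s) f l in P0 P1 IH *; set Q := \prod_(l <- s) g l in IH *.
have -> : f l * P - g l * Q = (f l - g l) * P + g l * (P - Q) by ring.
apply: (le_trans (ler_normD _ _)); apply: lerD.
  by rewrite normrM (ger0_norm P0) ler_piMr.
by rewrite normrM (ger0_norm g0) (le_trans _ IH)// ler_piMl.
Qed.

Lemma sum_lattice_bump_lipschitz x y :
  \sum_(i : I) `|lattice_bump i x - lattice_bump i y| <=
    2 * 2 ^+ n * n%:R * (`|x - y| / eps).
Proof.
set c := n%:R * (`|x - y| / eps).
have c0 : 0 <= c by rewrite mulr_ge0// divr_ge0// ltW.
apply: (@le_trans _ _ (\sum_(i : I) c * (\1_(lattice_cell i) x + \1_(lattice_cell i) y))).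
  apply: ler_sum => i _.
  have [xy|] := boolP ((lattice_bump i x == 0) && (lattice_bump i y == 0)).
    by case/andP : xy => /eqP -> /eqP ->; rewrite subrr normr0 mulr_ge0// addr_ge0.
  move=> xy.
  have le1 : 1 <= \1_(lattice_cell i) x + \1_(lattice_cell i) y :> R.
    move: xy; rewrite negb_and !indicE => /orP[]/lattice_bump_support xi.
      by rewrite mem_set// lerDl.
    by rewrite [y \in _]mem_set// lerDr.
  apply: (@le_trans _ _ c); last by rewrite ler_peMr.
  apply: (le_trans (prod_lipschitz _ _ _)).
  - by move=> l; rewrite tent_ge0 tent_le1.
  - by move=> l; rewrite tent_ge0 tent_le1.
  have -> : c = \sum_(l < n) (`|x - y| / eps) by rewrite sumr_const card_ord -[RHS]mulr_natl.
  apply: ler_sum => l _.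
  apply: (le_trans (tent_lipschitz _ _)).
  have -> : (x ord0 l + b) / eps - (i l : nat)%:R - ((y ord0 l + b) / eps - (i l : nat)%:R)
     = (x - y) ord0 l / eps by rewrite !mxE; field; rewrite gt_eqF.
  by rewrite normrM normfV (gtr0_norm eps0) ler_wpM2r ?invr_ge0 ?(ltW eps0)// coord_le_norm.
rewrite -mulr_sumr big_split /= [leRHS](_ : _ = c * (2 ^+ n + 2 ^+ n)); last first.
  by rewrite /c; ring.
by rewrite ler_wpM2l// lerD// lattice_overlap.
Qed.

End lattice.

(** * Lipschitz functions are dense in L2 *)

Lemma minr_lipschitz (R : realDomainType) (c p q : R) :
  `|Num.min c p - Num.min c q| <= `|p - q|.
Proof.
have N1 := ler_norm (p - q).
have N2 : q - p <= `|p - q| by rewrite distrC ler_norm.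
by rewrite ler_norml; case: (leP c p) => cp; case: (leP c q) => cq; apply/andP; split; lra.
Qed.

Lemma maxr_lipschitz (R : realDomainType) (c p q : R) :
  `|Num.max c p - Num.max c q| <= `|p - q|.
Proof.
have N1 := ler_norm (p - q).
have N2 : q - p <= `|p - q| by rewrite distrC ler_norm.
by rewrite ler_norml; case: (leP c p) => cp; case: (leP c q) => cq; apply/andP; split; lra.
Qed.

Section lipschitz_density.
Context {R : realType} (n : nat).
Variable mu : {finite_measure set 'rV[R]_n -> \bar R}.
Implicit Types (u v w : 'rV[R]_n -> R) (A B : set 'rV[R]_n).

Definition lipschitz_fun w := exists L : R, forall x y, `|w x - w y| <= L * `|x - y|.

Definition lipschitz_approximable_set A := measurable A /\
  forall e : R, 0 < e -> exists w, [/\ lipschitz_fun w, measurable_fun setT w,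
    (forall x, 0 <= w x <= 1) & (itg mu (fun x => (`|\1_A x - w x|)%R) <= e%:E)%E].

Let small_tail (f : nat -> 'rV[R]_n -> R) (e : R) :
  (forall k, measurable_fun setT (f k)) -> (forall k x, 0 <= f k x <= 1) ->
  (forall x, f k x @[k --> \oo] --> 0) -> 0 < e -> exists k, (itg mu (f k) <= e%:E)%E.
Proof.
move=> mf f01 f0 e0.
have : itg mu (f k) @[k --> \oo] --> itg mu (fun=> 0).
  apply: (@bounded_cvg_itg _ _ _ _ (finite_measure_lty mu) _ _ 1) => //.
    by move=> k x; have /andP[a b] := f01 k x; rewrite ger0_norm.
  exact: aeW.
rewrite itg_cst mul0e => /fine_cvgP[fin /cvgrPdist_le/(_ _ e0) H].
have [k [kfin]] := filter_ex (filterI fin H).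
rewrite sub0r normrN ger0_norm ?fine_ge0 ?itg_ge0//; last first.
  by move=> x; case/andP: (f01 k x).
by move=> ke; exists k; rewrite -(fineK kfin) lee_fin.
Qed.

Lemma measurable_dist_indic A w : measurable A -> measurable_fun setT w ->
  measurable_fun setT (fun x => `|\1_A x - w x|).
Proof.
by move=> mA mw; apply: measurableT_comp => //; apply: measurable_funB.
Qed.

Lemma approximable_halfspace (s a : R) (i : 'I_n) :
  lipschitz_approximable_set [set x | s * x ord0 i < a].
Proof.
have mc : measurable_fun setT (fun x : 'rV[R]_n => s * x ord0 i).
  by apply: measurable_funM => //; exact: measurable_coord_rV.
have mA : measurable [set x : 'rV[R]_n | s * x ord0 i < a].
  rewrite (_ : [set x | _] = setT `&` ((fun x : 'rV[R]_n => s * x ord0 i) @^-1` `]-oo, a[%classic)).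
    exact: mc.
  by rewrite setTI; apply/seteqP; split => x /=; rewrite in_itv.
split=> // e e0.
pose w (k : nat) (x : 'rV[R]_n) : R := Num.min 1 (k%:R * Num.max 0 (a - s * x ord0 i)).
have w0 k x : 0 <= w k x by rewrite le_min ler01 /= mulr_ge0// le_max lexx.
have w1 k x : w k x <= 1 by rewrite ge_min lexx.
have mw k : measurable_fun setT (w k).
  apply: measurable_minr => //; apply: measurable_funM => //.
  by apply: measurable_maxr => //; exact: measurable_funB.
have [k Hk] : exists k, (itg mu (fun x => (`|\1_[set x | s * x ord0 i < a] x - w k x|)%R) <= e%:E)%E.
  apply: small_tail => //.
  - by move=> k; exact: measurable_dist_indic.
  - move=> k x; rewrite normr_ge0 /= ler_norml indicE.
    by have := w0 k x; have := w1 k x; case: (_ \in _) => /= ? ?; apply/andP; split; lra.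
  - move=> x; rewrite indicE; have [xa|ax] := ltP (s * x ord0 i) a; last first.
      rewrite memNset /=; last by apply/negP; rewrite -leNgt.
      apply: cvg_near_cst; apply: nearW => k.
      by rewrite /w max_l ?subr_le0// mulr0 min_r// subrr normr0.
    rewrite mem_set//=; apply: cvg_near_cst.
    have xa0 : 0 < a - s * x ord0 i by rewrite subr_gt0.
    exists (Num.trunc ((a - s * x ord0 i)^-1)).+1 => // k /= tk.
    rewrite /w min_l ?subrr ?normr0// max_r ?(ltW xa0)//.
    rewrite -ler_pdivrMr// mul1r ltW//.
    by apply: (lt_le_trans (truncnS_gt _)); rewrite ler_nat.
exists (w k); split => //; last by move=> x; rewrite w0 w1.
exists (k%:R * `|s|) => x y.
apply: (le_trans (minr_lipschitz _ _ _)).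
rewrite -mulrBr normrM ger0_norm// -mulrA ler_wpM2l//.
apply: (le_trans (maxr_lipschitz _ _ _)).
rewrite (_ : a - _ - _ = - s * (x - y) ord0 i); last by rewrite !mxE; ring.
by rewrite normrM normrN ler_wpM2l// coord_le_norm.
Qed.

Lemma approximable_setC A :
  lipschitz_approximable_set A -> lipschitz_approximable_set (~` A).
Proof.
move=> [mA HA]; split; first exact: measurableC.
move=> e /HA[w [[L Lw] mw w01 we]]; exists (fun x => 1 - w x); split.
- by exists L => x y; rewrite (_ : _ - _ = w y - w x) 1?distrC//; ring.
- exact: measurable_funB.
- by move=> x; have := w01 x => /andP[? ?]; apply/andP; split; lra.
- suff -> : (fun x => `|\1_(~` A) x - (1 - w x)|) = (fun x => `|\1_A x - w x|) by [].
  apply/funext => x; rewrite !indicE in_setC; case: (x \in A) => /=.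
    by rewrite -normrN; congr `|_|; ring.
  by rewrite -[RHS]normrN; congr `|_|; ring.
Qed.

Lemma approximable_setU A B : lipschitz_approximable_set A ->
  lipschitz_approximable_set B -> lipschitz_approximable_set (A `|` B).
Proof.
move=> [mA HA] [mB HB]; split; first exact: measurableU.
move=> e e0; have e20 : 0 < e / 2 by rewrite divr_gt0.
have [w [[L Lw] mw w01 we]] := HA _ e20; have [v [[M Mv] mv v01 ve]] := HB _ e20.
exists (fun x => Num.max (w x) (v x)); split.
- exists (`|L| + `|M|) => x y.
  have h1 : `|w x - w y| <= `|L| * `|x - y|.
    by apply: (le_trans (Lw x y)); rewrite ler_wpM2r// ler_norm.
  have h2 : `|v x - v y| <= `|M| * `|x - y|.
    by apply: (le_trans (Mv x y)); rewrite ler_wpM2r// ler_norm.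
  have -> : Num.max (w x) (v x) - Num.max (w y) (v y) = Num.max (w x) (v x) -
      Num.max (w x) (v y) + (Num.max (v y) (w x) - Num.max (v y) (w y)).
    by rewrite (maxC (v y)) (maxC (v y)); ring.
  apply: (le_trans (ler_normD _ _)); rewrite mulrDl [leRHS]addrC; apply: lerD.
    exact: le_trans (maxr_lipschitz _ _ _) h2.
  exact: le_trans (maxr_lipschitz _ _ _) h1.
- exact: measurable_maxr.
- move=> x; have /andP[? ?] := w01 x; have /andP[? ?] := v01 x.
  by rewrite le_max ge_max; apply/andP; split; [apply/orP; left|apply/andP].
- rewrite (splitr e) EFinD.
  apply: le_trans (leeD we ve).
  rewrite -itgD//; try exact: measurable_dist_indic.
  apply: le_itg => //.
  + apply: measurable_dist_indic; [exact: measurableU|exact: measurable_maxr].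
  + by apply: measurable_funD; exact: measurable_dist_indic.
  move=> x; have /andP[? ?] := w01 x; have /andP[? ?] := v01 x.
  have -> : \1_(A `|` B) x = Num.max (\1_A x) (\1_B x) :> R.
    rewrite !indicE in_setU; case: (x \in A); case: (x \in B) => /=;
    [by rewrite maxxx|by rewrite max_l|by rewrite max_r|by rewrite maxxx].
  apply: (le_trans (ler_distD (Num.max (w x) (\1_B x)) _ _)); apply: lerD.
    by rewrite !(maxC _ (\1_B x)); exact: maxr_lipschitz.
  exact: maxr_lipschitz.
Qed.

Lemma approximable_bigcup (F : nat -> set 'rV[R]_n) :
  (forall k, lipschitz_approximable_set (F k)) ->
  lipschitz_approximable_set (\bigcup_k F k).
Proof.
move=> HF; have mU : measurable (\bigcup_k F k).
  by apply: bigcup_measurable => k _; case: (HF k).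
split=> // e e0; have e20 : 0 < e / 2 by rewrite divr_gt0.
pose U m := \big[setU/set0]_(k < m) F k.
have HU m : lipschitz_approximable_set (U m).
  elim: m => [|m IH]; rewrite /U ?big_ord0 ?big_ord_recr /=; last exact: approximable_setU.
  split => // e' e'0; exists (fun=> 0); split => //.
  - by exists 0 => x y; rewrite subrr normr0 mul0r.
  - by move=> x; rewrite lexx ler01.
  - under [X in itg _ X]eq_fun do rewrite indicE in_set0 subrr normr0.
    by rewrite itg_cst mul0e lee_fin ltW.
have [m Hm] : exists m, (itg mu (fun x => (`|\1_(\bigcup_k F k) x - \1_(U m) x|)%R) <= (e / 2)%:E)%E.
  apply: small_tail => //.
  - by move=> k; apply: measurable_dist_indic => //; apply: measurable_indic; case: (HU k).
  - by move=> k x; rewrite !indicE; case: (_ \in _); case: (_ \in _);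
      rewrite /= ?subrr ?subr0 ?sub0r ?normrN ?normr0 ?normr1 ?lexx ?ler01.
  - move=> x; apply: cvg_near_cst.
    have [[k0 _ Fx]|nF] := pselect ((\bigcup_k F k) x); last first.
      apply: nearW => k; rewrite !indicE memNset// memNset ?subrr ?normr0//.
      by rewrite /U -bigcup_mkord => -[j _ Fj]; apply: nF; exists j.
    exists k0.+1 => // k /= k0k.
    rewrite !indicE mem_set; last by exists k0.
    by rewrite mem_set ?subrr ?normr0// /U -bigcup_mkord; exists k0.
have [mUm /(_ _ e20)[w [Lw mw w01 we]]] := HU m.
exists w; split => //; rewrite (splitr e) EFinD.
apply: le_trans (leeD Hm we).
have m1 := measurable_dist_indic mU (measurable_indic mUm).
have m2 := measurable_dist_indic mUm mw.
rewrite -itgD//; apply: le_itg => //; first exact: measurable_dist_indic.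
  exact: measurable_funD.
by move=> x; exact: ler_distD.
Qed.

(** Lipschitz approximability defines a sigma-algebra which contains the
    half-spaces, hence the boxes, hence the open sets. *)
Lemma approximable_measurable A : measurable A -> lipschitz_approximable_set A.
Proof.
have H0 : lipschitz_approximable_set set0.
  have := @approximable_bigcup (fun=> set0); rewrite bigcup0//; apply => _.
  split => // e e0; exists (fun=> 0); split => //.
  - by exists 0 => x y; rewrite subrr normr0 mul0r.
  - by move=> x; rewrite lexx ler01.
  - under [X in itg _ X]eq_fun do rewrite indicE in_set0 subrr normr0.
    by rewrite itg_cst mul0e lee_fin ltW.
have HI B C : lipschitz_approximable_set B -> lipschitz_approximable_set C ->
    lipschitz_approximable_set (B `&` C).
  move=> HB HC; rewrite -(setCK B) -(setCK C) -setCU.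
  by apply/approximable_setC/approximable_setU; exact: approximable_setC.
apply: smallest_sub; first split => //.
- by move=> B HB; rewrite setTD; exact: approximable_setC.
- exact: approximable_bigcup.
move=> U oU; rewrite (open_rV_ratball oU) bigcup_mkcond.
have cov (G : 'rV[rat]_n * nat -> set 'rV[R]_n) :
    (forall q, lipschitz_approximable_set (G q)) -> lipschitz_approximable_set (\bigcup_q G q).
  move=> HG.
  rewrite (_ : \bigcup_q G q = \bigcup_k (if unpickle k is Some q then G q else set0)).
    by apply: approximable_bigcup => k; case: (unpickle k).
  apply/seteqP; split => [x [q _ Gq]|x [k _]]; last by case: (unpickle k) => // q; exists q.
  by exists (pickle q) => //; rewrite pickleK.
apply: cov => -[q k]; case: ifPn => // _.
rewrite ball_rVE ?invr_gt0//.
have -> : forall (c : 'rV[R]_n) (r : R), \bigcap_(i in [set: 'I_n])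
    ((fun y : 'rV[R]_n => y ord0 i) @^-1` ball (c ord0 i) r) =
  ~` \bigcup_(k : nat) (if @insub _ _ ('I_n : Type) k is Some i then
     ~` ([set x : 'rV[R]_n | 1 * x ord0 i < c ord0 i + r] `&`
         [set x : 'rV[R]_n | -1 * x ord0 i < r - c ord0 i]) else set0).
  move=> c r; rewrite setC_bigcup; apply/seteqP; split => [x xB j _|x xB i _].
    case: insubP => [i _ ij|_]; last by rewrite setC0.
    rewrite setCK; have := xB i Logic.I.
    by rewrite /= /ball /= ltr_distlC => /andP[? ?]; split; lra.
  have := xB i Logic.I; rewrite valK setCK /= => -[h1 h2].
  by rewrite /ball /= ltr_distlC; apply/andP; split; lra.
apply/approximable_setC/approximable_bigcup => j.
case: insubP => // i _ _; apply: approximable_setC.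
by apply: HI; exact: approximable_halfspace.
Qed.


Definition lipschitz_approximable u := sq_integrable mu u /\
  forall e : R, 0 < e -> exists w, [/\ lipschitz_fun w, sq_integrable mu w &
    norm2 mu (fun x => u x - w x) <= e].

Let approximable0 : lipschitz_approximable (fun=> 0).
Proof.
split; first exact: sq_integrable0.
move=> e e0; exists (fun=> 0); split; last 2 [exact: sq_integrable0].
  by exists 0 => x y; rewrite subrr normr0 mul0r.
by under eq_fun do rewrite subrr; rewrite norm20 ltW.
Qed.

Let approximableD u v : lipschitz_approximable u -> lipschitz_approximable v ->
  lipschitz_approximable (fun x => u x + v x).
Proof.
move=> [L2u Hu] [L2v Hv]; split; first exact: sq_integrableD.
move=> e e0; have e20 : 0 < e / 2 by rewrite divr_gt0.
have [w [[L Lw] L2w we]] := Hu _ e20; have [w' [[L' Lw'] L2w' we']] := Hv _ e20.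
exists (fun x => w x + w' x); split; last 2 [exact: sq_integrableD].
  exists (L + L') => x y.
  rewrite (_ : _ - _ = (w x - w y) + (w' x - w' y)); last by ring.
  by rewrite mulrDl (le_trans (ler_normD _ _))// lerD.
rewrite (_ : (fun x => _) = (fun x => (u x - w x) + (v x - w' x))); last first.
  by apply/funext => x; ring.
apply: (le_trans (norm2D _ _)); try exact: sq_integrableB.
by rewrite (splitr e) lerD.
Qed.

Let approximableZ u (c : R) : lipschitz_approximable u ->
  lipschitz_approximable (fun x => c * u x).
Proof.
move=> [L2u Hu]; split; first exact: sq_integrableZ.
move=> e e0; have c0 : 0 < `|c| + 1 by rewrite ltr_wpDl.
have [w [[L Lw] L2w we]] := Hu _ (divr_gt0 e0 c0).
exists (fun x => c * w x); split; last 2 [exact: sq_integrableZ].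
  exists (`|c| * L) => x y.
  by rewrite -mulrBr normrM -mulrA ler_wpM2l.
rewrite (_ : (fun x => _) = (fun x => c * (u x - w x))); last first.
  by apply/funext => x; ring.
rewrite norm2Z; last exact: sq_integrableB.
apply: (@le_trans _ _ (`|c| * (e / (`|c| + 1)))); first by rewrite ler_wpM2l.
by rewrite mulrA ler_pdivrMr// mulrC ler_pM2l// lerDl.
Qed.

Let approximable_indic A : measurable A -> lipschitz_approximable (\1_A).
Proof.
move=> mA; have [_ HA] := approximable_measurable mA.
have L2A : sq_integrable mu (\1_A).
  apply: (@sq_integrable_bounded _ _ _ _ _ 1) => // x.
  by rewrite indicE; case: (_ \in _); rewrite ?normr1 ?normr0.
split=> // e e0; have e20 : 0 < e ^+ 2 by rewrite exprn_gt0.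
have [w [Lw mw w01 we]] := HA _ e20.
have L2w : sq_integrable mu w.
  apply: (@sq_integrable_bounded _ _ _ _ _ 1) => // x.
  by have /andP[? ?] := w01 x; rewrite ger0_norm.
exists w; split => //.
rewrite -ler_sqr ?nnegrE ?norm2_ge0 ?(ltW e0)// -lee_fin -itg_sqr; last first.
  exact: sq_integrableB.
apply: le_trans we; apply: le_itg.
- by apply: measurable_funX; exact: measurable_funB.
- exact: measurable_dist_indic.
- by move=> x; exact: sqr_ge0.
- move=> x; rewrite -(real_normK (num_real _)) expr2 ler_piMr//.
  have /andP[? ?] := w01 x; rewrite indicE ler_norml.
  by case: (_ \in _) => /=; apply/andP; split; lra.
Qed.

Let norm2_dominated (f : nat -> 'rV[R]_n -> R) h (e : R) :
  (forall k, measurable_fun setT (f k)) -> sq_integrable mu h ->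
  (forall k x, `|f k x| <= `|h x|) -> (forall x, f k x @[k --> \oo] --> 0) ->
  0 < e -> exists k, norm2 mu (f k) <= e.
Proof.
move=> mf [mh ih] fh f0 e0.
have f2 k x : f k x ^+ 2 <= h x ^+ 2.
  by rewrite -(real_normK (num_real (f k x))) -(real_normK (num_real (h x))) lerXn2r ?nnegrE.
have L2f k : sq_integrable mu (f k).
  split=> //; apply: le_integrable ih => //.
    by apply/measurable_EFinP; exact: measurable_funX.
  by move=> x _ /=; rewrite lee_fin !ger0_norm ?sqr_ge0.
have := @dominated_cvg _ _ _ mu setT measurableT (fun k x => (f k x ^+ 2)%:E) (cst 0%E)
  (EFin \o (fun x => h x ^+ 2)).
rewrite integral0 => H.
have {}H : itg mu (fun x => f k x ^+ 2) @[k --> \oo] --> 0%E.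
  apply: H => //.
  - by move=> k; apply/measurable_EFinP; exact: measurable_funX.
  - move=> x _; apply: cvg_EFin; first exact: nearW.
    under eq_fun do rewrite expr2.
    by have := cvgM (f0 x) (f0 x); rewrite mulr0; exact.
  - by move=> k x _ /=; rewrite lee_fin ger0_norm ?sqr_ge0.
have e20 : 0 < e ^+ 2 by rewrite exprn_gt0.
move: H; under eq_fun do rewrite itg_sqr//.
move=> /fine_cvgP[_ /cvgrPdist_le/(_ _ e20) H].
have [k] := filter_ex H; rewrite /= sub0r normrN ger0_norm ?sqr_ge0//.
by rewrite ler_sqr ?nnegrE ?norm2_ge0 ?(ltW e0)// => ke; exists k.
Qed.

Let approximable_lim u : sq_integrable mu u ->
  (forall e : R, 0 < e -> exists2 v, lipschitz_approximable v &
     norm2 mu (fun x => u x - v x) <= e) -> lipschitz_approximable u.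
Proof.
move=> L2u Hu; split=> // e e0; have e20 : 0 < e / 2 by rewrite divr_gt0.
have [v [L2v Hv] uv] := Hu _ e20; have [w [Lw L2w we]] := Hv _ e20.
exists w; split=> //.
rewrite (_ : (fun x => _) = (fun x => (u x - v x) + (v x - w x))); last first.
  by apply/funext => x; ring.
apply: (le_trans (norm2D _ _)); try exact: sq_integrableB.
by rewrite (splitr e) lerD.
Qed.

Let approximable_nonneg u : sq_integrable mu u -> (forall x, 0 <= u x) ->
  lipschitz_approximable u.
Proof.
move=> L2u u0; have [mu_ _] := L2u; apply: approximable_lim => // e e0.
have mE : measurable_fun setT (EFin \o u) by exact/measurable_EFinP.
have u0E x : setT x -> (0 <= (EFin \o u) x)%E by move=> _; rewrite lee_fin.
pose g (k : nat) : 'rV[R]_n -> R := nnsfun_approx measurableT mE k.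
have gu k x : 0 <= g k x <= u x.
  apply/andP; split; first exact: fun_ge0.
  by rewrite -lee_fin /g nnsfun_approxE; exact: le_approx.
have mg k : measurable_fun setT (g k) by exact: measurable_funP.
have [||||k Hk] := @norm2_dominated (fun k x => u x - g k x) u e _ L2u.
- by move=> k; exact: measurable_funB.
- move=> k x; have /andP[? ?] := gu k x.
  by rewrite !ger0_norm ?subr_ge0// lerBlDr lerDl.
- move=> x; have : g k x @[k --> \oo] --> u x.
    have := cvg_nnsfun_approx measurableT mE u0E (x := x) Logic.I.
    by move=> /fine_cvgP[].
  move=> gx; have := cvgB (cvg_cst (u x)) gx.
  by rewrite subrr; exact.
- exact: e0.
exists (g k) => //.
have mgy y : measurable (g k @^-1` [set y]).
  by rewrite -[X in measurable X]setTI; exact: mg.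
have -> : g k = _ := funext (fimfunEord (nnsfun_approx measurableT mE k)).
elim: (index_enum _) => [|y s IH].
  by under eq_fun do rewrite big_nil.
under eq_fun do rewrite big_cons.
by apply: approximableD => //; apply: approximableZ; exact: approximable_indic.
Qed.

Theorem lipschitz_dense u : sq_integrable mu u -> forall e : R, 0 < e ->
  exists w, [/\ lipschitz_fun w, sq_integrable mu w &
    norm2 mu (fun x => u x - w x) <= e].
Proof.
move=> L2u; have [mu_ iu] := L2u.
suff [] : lipschitz_approximable u by [].
have part (s : R) : `|s| <= 1 -> sq_integrable mu (fun x => Num.max 0 (s * u x)).
  move=> s1; have ms : measurable_fun setT (fun x => Num.max 0 (s * u x)).
    by apply: measurable_maxr => //; exact: measurable_funM.
  split=> //; apply: le_integrable iu => //.
    by apply/measurable_EFinP; exact: measurable_funX.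
  move=> x _ /=; rewrite lee_fin !ger0_norm ?sqr_ge0//.
  rewrite -(real_normK (num_real (u x))) lerXn2r ?nnegrE ?le_max ?lexx//.
  rewrite ge_max normr_ge0 /= (le_trans (ler_norm _))// normrM ler_piMl//.
have -> : u = fun x => Num.max 0 (1 * u x) + -1 * Num.max 0 (-1 * u x).
  apply/funext => x; rewrite mul1r !mulN1r.
  have [u0|u0] := leP 0 (u x); first by rewrite max_l ?subr0// oppr_le0.
  by rewrite max_r ?oppr_ge0 ?(ltW u0)// add0r opprK.
apply: approximableD; last apply: approximableZ; apply: approximable_nonneg.
- by apply: part; rewrite normr1.
- by move=> x; rewrite le_max lexx.
- by apply: part; rewrite normrN1.
- by move=> x; rewrite le_max lexx.
Qed.

End lipschitz_density.

(** * Means over the cells of a finite cover *)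

Section cell_means.
Context d (X : measurableType d) {R : realType}.
Variable nu : {measure set X -> \bar R}.
Hypothesis nuoo : (nu setT < +oo)%E.
Variables (I : finType) (Q : I -> set X).
Hypothesis mQ : forall i, measurable (Q i).
Implicit Types (F G : X -> R) (i : I).

Definition cell_mean i F : R := (\int[nu]_x (\1_(Q i) x * F x)) / fine (nu (Q i)).

Let nuQoo i : nu (Q i) \is a fin_num.
Proof.
rewrite ge0_fin_numE//; apply: le_lt_trans nuoo.
by apply: le_measure; rewrite ?inE.
Qed.

Let integrable_cell i F : nu.-integrable setT (EFin \o F) ->
  nu.-integrable setT (EFin \o (fun x => \1_(Q i) x * F x)).
Proof.
move=> iF; apply: (le_integrable measurableT _ _ iF).
  apply/measurable_EFinP; apply: measurable_funM; first exact: measurable_indic.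
  by apply/measurable_EFinP; exact: measurable_int iF.
move=> x _ /=; rewrite lee_fin normrM indicE ler_piMl//.
by case: (_ \in _); rewrite ?normr1 ?normr0.
Qed.

Lemma ae_cell_pos : {ae nu, forall x, forall i, Q i x -> 0 < fine (nu (Q i))}.
Proof.
apply: filter_forall => i.
have [Q0|Q0] := eqVneq (fine (nu (Q i))) 0; last first.
  by apply: aeW => x _; rewrite lt_neqAle eq_sym Q0 fine_ge0.
exists (Q i); split => //; first by rewrite -(fineK (nuQoo i)) Q0.
by move=> x /= H; apply: contrapT => xQ; apply: H => /xQ.
Qed.

Lemma integral_cell i F :
  (\int[nu]_x (\1_(Q i) x * F x)%:E)%E = (\int[nu]_(x in Q i) (F x)%:E)%E.
Proof.
rewrite [RHS]integral_mkcond; apply: eq_integral => x _.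
rewrite (restrict_EFin F) /= patchE indicE; case: (_ \in _); first by rewrite mul1r.
by rewrite mul0r.
Qed.

Lemma cell_mean_ge0 i F : (forall x, 0 <= F x) -> 0 <= cell_mean i F.
Proof.
move=> F0; apply: divr_ge0; last exact: fine_ge0.
by apply: Rintegral_ge0 => x _; rewrite mulr_ge0.
Qed.

Lemma cell_meanD i F G : nu.-integrable setT (EFin \o F) ->
  nu.-integrable setT (EFin \o G) ->
  cell_mean i (fun x => F x + G x) = cell_mean i F + cell_mean i G.
Proof.
move=> iF iG; rewrite /cell_mean -mulrDl -RintegralD//; try exact: integrable_cell.
by congr (_ / _); apply: eq_Rintegral => x _; rewrite mulrDr.
Qed.

Lemma cell_meanZ i F k : nu.-integrable setT (EFin \o F) ->
  cell_mean i (fun x => k * F x) = k * cell_mean i F.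
Proof.
move=> iF; rewrite /cell_mean mulrA -RintegralZl//; last exact: integrable_cell.
by congr (_ / _); apply: eq_Rintegral => x _; rewrite mulrCA.
Qed.

Lemma cell_mean_cst i c : 0 < fine (nu (Q i)) -> cell_mean i (fun=> c) = c.
Proof.
move=> Q0; have icst : nu.-integrable setT (EFin \o (\1_(Q i) : X -> R)).
  apply: (bounded_integrable nuoo (B := 1)) => // x.
  by rewrite indicE; case: (_ \in _); rewrite ?normr1 ?normr0.
rewrite /cell_mean RintegralZr// (_ : Rintegral _ _ _ = fine (nu (Q i))).
  by rewrite mulrAC divff ?mul1r// lt0r_neq0.
by rewrite /Rintegral integral_indic// setIT.
Qed.

Lemma le_cell_mean i F G : nu.-integrable setT (EFin \o F) ->
  nu.-integrable setT (EFin \o G) -> (forall x, Q i x -> F x <= G x) ->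
  cell_mean i F <= cell_mean i G.
Proof.
move=> iF iG FG; rewrite /cell_mean ler_wpM2r ?invr_ge0 ?fine_ge0//.
apply: le_Rintegral => //; try exact: integrable_cell.
move=> x _; rewrite indicE; case: (boolP (x \in Q i)) => [|_]; last by rewrite !mul0r.
by rewrite inE !mul1r => /FG.
Qed.

Lemma le_norm_cell_mean i F : nu.-integrable setT (EFin \o F) ->
  `|cell_mean i F| <= cell_mean i (fun x => `|F x|).
Proof.
move=> iF; have f0 : 0 <= fine (nu (Q i)) by exact: fine_ge0.
rewrite /cell_mean normrM normfV (ger0_norm f0) ler_wpM2r ?invr_ge0//.
apply: (le_trans (le_normr_Rintegral _ _)) => //; first exact: integrable_cell.
rewrite le_eqVlt; apply/orP; left; apply/eqP; apply: eq_Rintegral => x _.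
by rewrite normrM ger0_norm.
Qed.

Lemma cell_mean_measure i F : nu.-integrable setT (EFin \o F) ->
  cell_mean i F * fine (nu (Q i)) = \int[nu]_x (\1_(Q i) x * F x).
Proof.
move=> iF; have [Q0|Q0] := eqVneq (fine (nu (Q i))) 0; last by rewrite divfK.
rewrite Q0 mulr0 /Rintegral integral_cell null_set_integral//.
  apply: (measurable_funS measurableT) => //; exact: measurable_int iF.
by rewrite -(fineK (nuQoo i)) Q0.
Qed.

Variable c : R.
Hypothesis overlap : forall x, \sum_i \1_(Q i) x <= c.

(** Averaging over the cells is bounded in L1: the weight that a point gives
    to its cells is at most the overlap, whatever the measures of the cells. *)
Lemma itg_sum_cell_mean F : nu.-integrable setT (EFin \o F) -> (forall x, 0 <= F x) ->
  (itg nu (fun x => (\sum_i \1_(Q i) x * cell_mean i F)%R) <= c%:E * itg nu F)%E.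
Proof.
move=> iF F0.
have mF : measurable_fun setT F by apply/measurable_EFinP; exact: measurable_int iF.
have mI i : measurable_fun setT (\1_(Q i) : X -> R) by exact: measurable_indic.
have I0 i x : 0 <= \1_(Q i) x :> R by rewrite indicE.
rewrite itg_sum; last 2 first.
- by move=> i; exact: measurable_funM.
- by move=> i x; rewrite mulr_ge0// cell_mean_ge0.
have E i : itg nu (fun x => \1_(Q i) x * cell_mean i F) = itg nu (fun x => \1_(Q i) x * F x).
  under eq_fun do rewrite mulrC.
  rewrite itgZ// ?cell_mean_ge0// itg_indic// -(fineK (nuQoo i)) -EFinM cell_mean_measure//.
  by rewrite /Rintegral fineK//; apply: integrable_fin_num => //; exact: integrable_cell.
rewrite (eq_bigr _ (fun i _ => E i)) -itg_sum; last 2 first.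
- by move=> i; exact: measurable_funM.
- by move=> i x; rewrite mulr_ge0.
have c0 : 0 <= c by apply: le_trans (overlap point); exact: sumr_ge0.
rewrite -itgZ//; apply: le_itg.
- by apply: measurable_sum => i; exact: measurable_funM.
- exact: measurable_funM.
- by move=> x; apply: sumr_ge0 => i _; rewrite mulr_ge0.
- by move=> x; rewrite -mulr_suml ler_wpM2r.
Qed.

Lemma cell_mean_power i F (p s : R) : nu.-integrable setT (EFin \o F) ->
  nu.-integrable setT (EFin \o (fun x => F x `^ p)) ->
  (forall x, 0 <= F x) -> 1 <= p -> 0 <= s -> 0 < fine (nu (Q i)) ->
  cell_mean i (fun x => F x `^ p) <= s `^ p -> cell_mean i F <= s.
Proof.
move=> iF iFp F0 p1 s0 Q0.
have mF : measurable_fun setT F by apply/measurable_EFinP; exact: measurable_int iF.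
rewrite /cell_mean !ler_pdivrMr// -!lee_fin /Rintegral !fineK; last 2 first.
- by apply: integrable_fin_num => //; exact: integrable_cell.
- by apply: integrable_fin_num => //; exact: integrable_cell.
rewrite !integral_cell !EFinM fineK// ![(_ * nu _)%E]muleC.
apply: power_mean => //.
- by rewrite -ge0_fin_numE.
- exact: measurable_funS mF.
Qed.

End cell_means.

(** * Smoothing at a given scale *)

(** A combination with zero total weight only sees the differences between
    values carrying a positive weight and values carrying a negative one. *)
Lemma zero_sum_bound (R : realFieldType) (I : finType) (a c : I -> R) (D : R) :
  \sum_i a i = 0 -> (forall i j, 0 < a i -> a j < 0 -> `|c i - c j| <= D) ->
  0 <= D -> `|\sum_i a i * c i| <= (\sum_i `|a i|) / 2 * D.
Proof.
move=> a0 cD D0.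
pose p i := Num.max 0 (a i); pose q i := Num.max 0 (- a i).
have p0 i : 0 <= p i by rewrite le_max lexx.
have q0 i : 0 <= q i by rewrite le_max lexx.
have pq i : a i = p i - q i.
  by rewrite /p /q; case: (leP 0 (a i)) => h; [rewrite max_l|rewrite max_r]; lra.
have npq i : `|a i| = p i + q i.
  rewrite /p /q; case: (leP 0 (a i)) => h.
    by rewrite ger0_norm// max_l ?addr0//; lra.
  by rewrite ltr0_norm// max_r ?add0r//; lra.
set M := _ / 2.
have [pM qM] : \sum_i p i = M /\ \sum_i q i = M.
  have h1 : \sum_i p i - \sum_i q i = 0.
    by rewrite -sumrB -[RHS]a0; apply: eq_bigr => i _; rewrite pq.
  have h2 : \sum_i p i + \sum_i q i = \sum_i `|a i|.
    by rewrite -big_split; apply: eq_bigr => i _; rewrite npq.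
  by rewrite /M -h2; split; lra.
have M0 : 0 <= M by rewrite -pM sumr_ge0.
have key : M * \sum_i a i * c i = \sum_i \sum_j p i * q j * (c i - c j).
  transitivity (\sum_i (M * (p i * c i) - p i * \sum_j q j * c j)).
    rewrite sumrB -mulr_sumr -mulr_suml pM -mulrBr -sumrB; congr (_ * _).
    by apply: eq_bigr => i _; rewrite pq mulrBl.
  apply: eq_bigr => i _; rewrite -qM mulr_suml mulr_sumr -sumrB.
  by apply: eq_bigr => j _; ring.
have [M1|M1] := eqVneq M 0.
  rewrite M1 mul0r big1 ?normr0// => i _.
  have : `|a i| <= 0.
    have <- : \sum_i `|a i| = 0 by move: M1; rewrite /M; lra.
    by rewrite (bigD1 i)//= lerDl sumr_ge0.
  by rewrite normr_le0 => /eqP ->; rewrite mul0r.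
have {}M0 : 0 < M by rewrite lt_neqAle eq_sym M1.
rewrite -(ler_pM2l M0) -{1}(gtr0_norm M0) -normrM key.
have -> : M * (M * D) = \sum_i \sum_j p i * q j * D.
  rewrite mulrA -{1}pM -qM !mulr_suml; apply: eq_bigr => i _.
  by rewrite mulr_sumr mulr_suml.
apply: (le_trans (ler_norm_sum _ _ _)); apply: ler_sum => i _.
apply: (le_trans (ler_norm_sum _ _ _)); apply: ler_sum => j _.
rewrite normrM (ger0_norm (mulr_ge0 (p0 i) (q0 j))).
have [ai|ai] := ltP 0 (a i); last by rewrite /p max_l// !mul0r.
have [aj|aj] := ltP (a j) 0; last by rewrite /q max_l ?oppr_le0// mulr0 !mul0r.
by rewrite ler_wpM2l ?mulr_ge0// cD.
Qed.

Section product_means.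
Context d (T : measurableType d) {R : realType}.
Variable mu : {finite_measure set T -> \bar R}.
Local Notation mu2 := (mu \x mu)%E.
Variables (I : finType) (Q : I -> set T).
Hypothesis mQ : forall i, measurable (Q i).

Definition product_cell (ij : I * I) : set (T * T) := Q ij.1 `*` Q ij.2.

Arguments product_cell : simpl never.

Lemma measurable_product_cell ij : measurable (product_cell ij).
Proof. exact: measurableX. Qed.

Lemma indic_product_cell ij z :
  \1_(product_cell ij) z = \1_(Q ij.1) z.1 * \1_(Q ij.2) z.2 :> R.
Proof. by rewrite !indicE -natrM mulnb in_setX. Qed.

Lemma measure_product_cell ij : fine (mu2 (product_cell ij)) =
  fine (mu (Q ij.1)) * fine (mu (Q ij.2)).
Proof. by rewrite product_measure1E// fineM ?fin_num_measure. Qed.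

Lemma product_cell_pos i j : 0 < fine (mu (Q i)) -> 0 < fine (mu (Q j)) ->
  0 < fine (mu2 (product_cell (i, j))).
Proof. by move=> i0 j0; rewrite measure_product_cell mulr_gt0. Qed.

Lemma product_overlap (c : R) : (forall x, \sum_i \1_(Q i) x <= c) ->
  forall z, \sum_ij \1_(product_cell ij) z <= c * c.
Proof.
move=> Qc z; under eq_bigr do rewrite indic_product_cell.
rewrite -(pair_bigA _ (fun i j => \1_(Q i) z.1 * \1_(Q j) z.2)) /=.
under eq_bigr do rewrite -mulr_sumr.
rewrite -mulr_suml ler_pM//; by apply: sumr_ge0 => i _; rewrite indicE.
Qed.

Lemma integrable_coords (u : T -> R) : sq_integrable mu u ->
  mu2.-integrable setT (EFin \o (fun z => u z.1)) /\
  mu2.-integrable setT (EFin \o (fun z => u z.2)).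
Proof.
move=> L2u.
have B1 (z : T * T) : `|(fun=> 1 : R) z| <= 1 by rewrite /= normr1.
have m1 : measurable_fun [set: T * T] (fun=> 1 : R) by exact: measurable_cst.
have [h1 h2] := integrable_bounded_mul L2u m1 B1.
by split; [apply: eq_integrable h1|apply: eq_integrable h2] => // z _ /=; rewrite mul1r.
Qed.

Let ind1 (i : I) (x : T) : `|\1_(Q i) x : R| <= 1.
Proof. by rewrite indicE; case: (_ \in _); rewrite ?normr1 ?normr0. Qed.

Let mind i : measurable_fun setT (\1_(Q i) : T -> R).
Proof. exact: measurable_indic. Qed.

Lemma product_mean_fst (u : T -> R) ij : sq_integrable mu u ->
  0 < fine (mu (Q ij.2)) ->
  cell_mean mu2 product_cell ij (fun z => u z.1) = cell_mean mu Q ij.1 u.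
Proof.
case: ij => i j L2u /= Qj; rewrite /cell_mean measure_product_cell /=.
have mD : measurable_fun setT (fun z : T * T => \1_(Q i) z.1 * \1_(Q j) z.2 : R).
  by apply: measurable_funM; apply: (measurableT_comp (mind _)).
have DB (z : T * T) : `|\1_(Q i) z.1 * \1_(Q j) z.2 : R| <= 1.
  by rewrite normrM mulr_ile1.
have [iz _] := integrable_bounded_mul L2u mD DB.
have L2i : mu.-integrable setT (EFin \o (fun x => \1_(Q i) x * u x)).
  apply: sq_integrable_mul L2u; apply: (@sq_integrable_bounded _ _ _ _ _ 1) => //.
rewrite (_ : Rintegral _ _ _ = (\int[mu]_x (\1_(Q i) x * u x)) * fine (mu (Q j))).
  by rewrite -mulf_div divff ?mulr1// lt0r_neq0.
transitivity (\int[mu2]_z (\1_(Q i) z.1 * \1_(Q j) z.2 * u z.1)).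
  by apply: eq_Rintegral => z _; congr (_ * _); exact: (indic_product_cell (i, j) z).
rewrite -RintegralZr// {1}/Rintegral -(integral12_prod_meas1 iz).
congr fine; apply: eq_integral => x _; rewrite /fubini_F /=.
transitivity (\int[mu]_y ((\1_(Q i) x * u x)%:E * (\1_(Q j) y)%:E))%E.
  by apply: eq_integral => y _; rewrite -EFinM; congr EFin; ring.
rewrite integralZl//; last by apply: integrable_indic.
by rewrite integral_indic// setIT [RHS]EFinM fineK// fin_num_measure.
Qed.

Lemma product_mean_snd (u : T -> R) ij : sq_integrable mu u ->
  0 < fine (mu (Q ij.1)) ->
  cell_mean mu2 product_cell ij (fun z => u z.2) = cell_mean mu Q ij.2 u.
Proof.
case: ij => i j L2u /= Qi; rewrite /cell_mean measure_product_cell /=.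
have mD : measurable_fun setT (fun z : T * T => \1_(Q i) z.1 * \1_(Q j) z.2 : R).
  by apply: measurable_funM; apply: (measurableT_comp (mind _)).
have DB (z : T * T) : `|\1_(Q i) z.1 * \1_(Q j) z.2 : R| <= 1.
  by rewrite normrM mulr_ile1.
have [_ iz] := integrable_bounded_mul L2u mD DB.
have L2j : mu.-integrable setT (EFin \o (fun x => \1_(Q j) x * u x)).
  apply: sq_integrable_mul L2u; apply: (@sq_integrable_bounded _ _ _ _ _ 1) => //.
rewrite (_ : Rintegral _ _ _ = fine (mu (Q i)) * (\int[mu]_x (\1_(Q j) x * u x))).
  by rewrite -mulf_div divff ?mul1r// lt0r_neq0.
transitivity (\int[mu2]_z (\1_(Q i) z.1 * \1_(Q j) z.2 * u z.2)).
  by apply: eq_Rintegral => z _; congr (_ * _); exact: (indic_product_cell (i, j) z).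
rewrite -RintegralZl// {1}/Rintegral -(integral21_prod_meas1 iz).
congr fine; apply: eq_integral => y _; rewrite /fubini_G /=.
transitivity (\int[mu]_x ((\1_(Q j) y * u y)%:E * (\1_(Q i) x)%:E))%E.
  by apply: eq_integral => x _; rewrite -EFinM; congr EFin; ring.
rewrite integralZl//; last by apply: integrable_indic.
by rewrite integral_indic// setIT [RHS]EFinM [RHS]muleC fineK// fin_num_measure.
Qed.

End product_means.

Section ae_product.
Context d (T : measurableType d) {R : realType}.
Variable mu : {finite_measure set T -> \bar R}.

Lemma ae_product_fst (P : T -> Prop) : {ae mu, forall x, P x} ->
  {ae (mu \x mu)%E, forall z, P z.1}.
Proof.
move=> [A [mA A0 PA]]; exists (A `*` setT); split.
- exact: measurableX.
- apply: (etrans (product_measure1E mu mu mA measurableT)).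
  by apply: (etrans (congr1 (fun t => (t * mu setT)%E) A0)); rewrite mul0e.
- by move=> z /= zP; split => //; exact: PA.
Qed.

Lemma ae_product_snd (P : T -> Prop) : {ae mu, forall x, P x} ->
  {ae (mu \x mu)%E, forall z, P z.2}.
Proof.
move=> [A [mA A0 PA]]; exists (setT `*` A); split.
- exact: measurableX.
- apply: (etrans (product_measure1E mu mu measurableT mA)).
  by apply: (etrans (congr1 (fun t => (mu setT * t)%E) A0)); rewrite mule0.
- by move=> z /= zP; split => //; exact: PA.
Qed.

End ae_product.

Lemma powRD_le (R : realType) (a c p : R) : 0 <= a -> 0 <= c -> 0 <= p ->
  (a + c) `^ p <= 2 `^ p * (a `^ p + c `^ p).
Proof.
move=> a0 c0 p0; apply: (@le_trans _ _ ((2 * Num.max a c) `^ p)).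
  apply: ge0_ler_powR; rewrite ?nnegrE ?addr_ge0 ?mulr_ge0 ?le_max ?a0//.
  by case: (leP a c); lra.
rewrite powRM ?le_max ?a0// ler_wpM2l ?powR_ge0//.
by case: (leP a c) => _; rewrite ?lerDl ?lerDr powR_ge0.
Qed.

(** The upper growth bound of the integrand, without its constant. *)
Definition growth_density (R : realType) (n : nat) (beta : R)
    (z : 'rV[R]_n * 'rV[R]_n) (xi zeta : R) : R :=
  `|xi - zeta| / enorm (z.1 - z.2) `^ beta + `|xi| + `|zeta| + 1.

Lemma growth_density_ge1 (R : realType) (n : nat) (beta : R) (z : 'rV[R]_n * 'rV[R]_n)
  (xi zeta : R) : 1 <= growth_density beta z xi zeta.
Proof. by rewrite lerDr !addr_ge0// divr_ge0// powR_ge0. Qed.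

Lemma le_growth_density (R : realType) (n : nat) (beta : R) (z : 'rV[R]_n * 'rV[R]_n)
  (xi zeta : R) (D := growth_density beta z xi zeta) :
  [/\ `|xi| <= D, `|zeta| <= D & `|xi - zeta| / enorm (z.1 - z.2) `^ beta <= D].
Proof.
rewrite /D /growth_density.
set q := _ / _; have q0 : 0 <= q by rewrite divr_ge0// powR_ge0.
by have := normr_ge0 xi; have := normr_ge0 zeta; split; lra.
Qed.

Lemma measurable_growth_density (R : realType) (n : nat) (beta : R)
    (a : 'rV[R]_n * 'rV[R]_n -> R) (c : 'rV[R]_n * 'rV[R]_n -> R) :
  measurable_fun setT a -> measurable_fun setT c ->
  measurable_fun setT (fun z => growth_density beta z (a z) (c z)).
Proof.
move=> ma mc; apply: measurable_funD => //; apply: measurable_funD; last exact: measurableT_comp.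
apply: measurable_funD; last exact: measurableT_comp.
apply: measurable_funM; first by apply: measurableT_comp => //; exact: measurable_funB.
under eq_fun do rewrite -powRN.
exact: (measurableT_comp (measurable_powR _) (@measurable_enorm_sub R n)).
Qed.

Section smoothing.
Context {R : realType} (n : nat).
Variable mu : {finite_measure set 'rV[R]_n -> \bar R}.
Local Notation mu2 := (mu \x mu)%E.
Variable b : R.
Variable eps : R.
Hypothesis eps0 : 0 < eps.

(* enough lattice points for the cells to cover the cube [-b, b]^n *)
Let N : nat := (Num.trunc (2 * b / eps)).+1.
Local Notation I := {ffun 'I_n -> 'I_N.+1}.
Local Notation Q := (fun i : I => lattice_cell eps b i).
Local Notation bump := (fun i : I => lattice_bump eps b i).

Let mQ (i : I) : measurable (Q i) := measurable_lattice_cell eps b i.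

Definition smoothing (u : 'rV[R]_n -> R) (x : 'rV[R]_n) : R :=
  \sum_(i : I) bump i x * cell_mean mu Q i u.

Let sum_bump x : `|x| <= b -> \sum_(i : I) bump i x = 1.
Proof.
move=> xb; apply: sum_lattice_bump => l.
have := le_trans (coord_le_norm x l) xb; rewrite ler_norml => /andP[x1 x2].
rewrite divr_ge0 ?(ltW eps0)//=; last by lra.
apply: (@le_trans _ _ (2 * b / eps)); last by apply/ltW; exact: truncnS_gt.
by rewrite ler_pM2r ?invr_gt0//; lra.
Qed.

Let bump_le1 (i : I) x : bump i x <= 1.
Proof. by apply: prodr_ile1 => l _; rewrite tent_ge0 tent_le1. Qed.

Let cell_of x : `|x| <= b -> exists i : I, Q i x.
Proof.
move=> xb; have : \sum_(i : I) bump i x != 0 by rewrite sum_bump// oner_eq0.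
apply: contra_neqP => /forallNP xQ; apply: big1 => i _; apply/eqP/negPn/negP => /lattice_bump_support.
exact: xQ.
Qed.

Lemma measurable_smoothing u : measurable_fun setT (smoothing u).
Proof.
by apply: measurable_sum => i; apply: measurable_funM => //; exact: measurable_lattice_bump.
Qed.

Lemma smoothing_bounded u : exists B, forall x, `|smoothing u x| <= B.
Proof.
exists (\sum_(i : I) `|cell_mean mu Q i u|) => x.
apply: (le_trans (ler_norm_sum _ _ _)); apply: ler_sum => i _.
rewrite normrM (ger0_norm (lattice_bump_ge0 _ _ _ _)) ler_piMl//.
Qed.

Lemma smoothing_lipschitz u : lipschitz_fun (smoothing u).
Proof.
exists ((\sum_(i : I) `|cell_mean mu Q i u|) * (2 * 2 ^+ n * n%:R / eps)) => x y.
rewrite /smoothing -sumrB; under eq_bigr do rewrite -mulrBl.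
apply: (le_trans (ler_norm_sum _ _ _)).
rewrite mulr_suml mulr_suml; apply: ler_sum => i _.
rewrite normrM -[leRHS]mulrA [leLHS]mulrC ler_wpM2l//.
have := sum_lattice_bump_lipschitz N b eps0 x y.
rewrite (bigD1 i)//= => H.
apply: (@le_trans _ _ (2 * 2 ^+ n * n%:R * (`|x - y| / eps))).
  apply: le_trans H; rewrite lerDl; exact: sumr_ge0.
by rewrite le_eqVlt; apply/orP; left; apply/eqP; ring.
Qed.

Let overlap x : \sum_(i : I) \1_(Q i) x <= 2 ^+ n :> R.
Proof. exact: lattice_overlap. Qed.

Variable u : 'rV[R]_n -> R.
Hypothesis L2u : sq_integrable mu u.

Lemma smoothing_sq_integrable : sq_integrable mu (smoothing u).
Proof.
have [B HB] := smoothing_bounded u.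
by apply: (@sq_integrable_bounded _ _ _ _ _ B) => //; exact: measurable_smoothing.
Qed.

Section comparison_with_lipschitz.
Hypothesis mub : {ae mu, forall x, `|x| <= b}.
Variables (w : 'rV[R]_n -> R) (L : R).
Hypothesis L2w : sq_integrable mu w.
Hypothesis Lw : forall x y, `|w x - w y| <= L * `|x - y|.

Let r x := u x - w x.
Let L2r : sq_integrable mu r.
Proof. exact: sq_integrableB. Qed.

Let osc : R := `|L| * (2 * eps).

Lemma smoothing_close_pointwise x : `|x| <= b ->
  (forall i : I, Q i x -> 0 < fine (mu (Q i))) ->
  (smoothing u x - u x) ^+ 2 <=
   \sum_(i : I) \1_(Q i) x * (3 * (osc ^+ 2 + r x ^+ 2)
      + 3 * cell_mean mu Q i (fun y => r y ^+ 2)).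
Proof.
move=> xb xQ.
have muoo := finite_measure_lty mu.
have -> : smoothing u x - u x = \sum_(i : I) bump i x * (cell_mean mu Q i u - u x).
  under [RHS]eq_bigr do rewrite mulrBr.
  by rewrite sumrB -mulr_suml sum_bump// mul1r.
(* Jensen for the square, with weights [bump i x] *)
have jensen (t : I -> R) : (\sum_(i : I) bump i x * t i) ^+ 2 <= \sum_(i : I) bump i x * t i ^+ 2.
  set m := \sum_(i : I) bump i x * t i.
  have : 0 <= \sum_(i : I) bump i x * (t i - m) ^+ 2.
    by apply: sumr_ge0 => i _; rewrite mulr_ge0 ?sqr_ge0// lattice_bump_ge0.
  have -> : \sum_(i : I) bump i x * (t i - m) ^+ 2 =
      \sum_(i : I) bump i x * t i ^+ 2 - m ^+ 2.
    transitivity (\sum_(i : I) (bump i x * t i ^+ 2 - (2 * m * (bump i x * t i) - m ^+ 2 * bump i x))).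
      by apply: eq_bigr => i _; ring.
    by rewrite sumrB sumrB -!mulr_sumr -/m sum_bump//; ring.
  by rewrite subr_ge0.
apply: (le_trans (jensen _)); apply: ler_sum => i _.
have [b0|/lattice_bump_support Qx] := eqVneq (bump i x) 0.
  rewrite b0 mul0r; apply: mulr_ge0 => //; apply: addr_ge0; apply: mulr_ge0 => //.
    by rewrite addr_ge0 ?sqr_ge0.
  by apply: cell_mean_ge0 => y; exact: sqr_ge0.
rewrite indicE mem_set//= mul1r.
have Qpos := xQ _ Qx.
apply: (@le_trans _ _ ((cell_mean mu Q i u - u x) ^+ 2)).
  by rewrite ler_piMl ?sqr_ge0//; exact: bump_le1.
have iw := sq_integrable_integrable L2w.
have ir := sq_integrable_integrable L2r.
have icst (c : R) : mu.-integrable setT (EFin \o (fun=> c)).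
  exact: sq_integrable_integrable (sq_integrable_cst mu c).
have E : cell_mean mu Q i u = cell_mean mu Q i w + cell_mean mu Q i r.
  rewrite -cell_meanD//; congr cell_mean; apply/funext => y; rewrite /r; ring.
have c1 : `|cell_mean mu Q i w - w x| <= osc.
  have osc_w y : Q i y -> `|w y - w x| <= osc.
    move=> Qy; apply: (le_trans (Lw _ _)).
    apply: (@le_trans _ _ (`|L| * `|y - x|)); first by rewrite ler_wpM2r// ler_norm.
    by rewrite ler_wpM2l//; exact: (@lattice_cell_diam _ _ N eps b eps0 i).
  have h1 : w x - osc <= cell_mean mu Q i w.
    rewrite -[leLHS](cell_mean_cst muoo mQ _ Qpos); apply: le_cell_mean => // y.
    by move=> /osc_w; rewrite ler_norml => /andP[? ?]; lra.
  have h2 : cell_mean mu Q i w <= w x + osc.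
    rewrite -[leRHS](cell_mean_cst muoo mQ _ Qpos); apply: le_cell_mean => // y.
    by move=> /osc_w; rewrite ler_norml => /andP[? ?]; lra.
  by rewrite ler_norml; apply/andP; split; lra.
have c2 : cell_mean mu Q i r ^+ 2 <= cell_mean mu Q i (fun y => r y ^+ 2).
  set B := cell_mean mu Q i r.
  have [mr ir2] := L2r.
  have iBr : mu.-integrable setT (EFin \o (fun y => - (2 * B) * r y)).
    exact: sq_integrable_integrable (sq_integrableZ _ L2r).
  have V0 : 0 <= cell_mean mu Q i (fun y => (r y - B) ^+ 2).
    by apply: cell_mean_ge0 => y; exact: sqr_ge0.
  have VE : cell_mean mu Q i (fun y => (r y - B) ^+ 2) =
      cell_mean mu Q i (fun y => r y ^+ 2) - B ^+ 2.
    rewrite (_ : (fun y => _) = (fun y => r y ^+ 2 + (- (2 * B) * r y + B ^+ 2))); last first.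
      by apply/funext => y; ring.
    have iBB := integrableD measurableT iBr (icst (B ^+ 2)).
    rewrite cell_meanD// cell_meanD// cell_meanZ// cell_mean_cst// -/B; ring.
  by rewrite -subr_ge0 -VE.
rewrite E; set A := cell_mean mu Q i w in c1 *; set B := cell_mean mu Q i r in c2 *.
have -> : A + B - u x = (A - w x) + B - r x by rewrite /r; ring.
have o2 : (A - w x) ^+ 2 <= osc ^+ 2.
  by rewrite -(real_normK (num_real (A - w x))) lerXn2r ?nnegrE ?mulr_ge0 ?(ltW eps0).
have := sqr_ge0 (A - w x - B); have := sqr_ge0 (A - w x + r x); have := sqr_ge0 (B + r x).
nra.
Qed.

Lemma smoothing_close :
  norm2 mu (fun x => smoothing u x - u x) ^+ 2 <=
    3 * 2 ^+ n * (osc ^+ 2 * fine (mu setT) + 2 * norm2 mu r ^+ 2).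
Proof.
have muoo := finite_measure_lty mu.
have [mu_ _] := L2u; have [mr ir2] := L2r.
have L2v : sq_integrable mu (fun x => smoothing u x - u x).
  by apply: sq_integrableB => //; exact: smoothing_sq_integrable.
have mr2 : measurable_fun setT (fun x => r x ^+ 2) by exact: measurable_funX.
have m1 : measurable_fun setT (fun x => osc ^+ 2 + r x ^+ 2) by exact: measurable_funD.
have p1 x : 0 <= osc ^+ 2 + r x ^+ 2 by rewrite addr_ge0 ?sqr_ge0.
have r20 x : 0 <= r x ^+ 2 by exact: sqr_ge0.
have mM : measurable_fun setT (fun x => \sum_(i : I) \1_(Q i) x * cell_mean mu Q i (fun y => r y ^+ 2) : R).
  by apply: measurable_sum => i; apply: measurable_funM => //; exact: measurable_indic.
have M0 x : 0 <= \sum_(i : I) \1_(Q i) x * cell_mean mu Q i (fun y => r y ^+ 2).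
  by apply: sumr_ge0 => i _; rewrite mulr_ge0// cell_mean_ge0.
have K0 : 0 <= 3 * 2 ^+ n :> R by rewrite mulr_ge0 ?exprn_ge0.
rewrite -lee_fin -itg_sqr//.
apply: (@le_trans _ _ (itg mu (fun x => 3 * 2 ^+ n * (osc ^+ 2 + r x ^+ 2) +
   3 * \sum_(i : I) \1_(Q i) x * cell_mean mu Q i (fun y => r y ^+ 2))%R)).
  apply: ae_le_itg.
  - by apply: measurable_funX; apply: measurable_funB => //; exact: measurable_smoothing.
  - by apply: measurable_funD; exact: measurable_funM.
  - by move=> x; exact: sqr_ge0.
  - by move=> x; apply: addr_ge0; exact: mulr_ge0.
  - apply: filterS2 mub (ae_cell_pos muoo mQ) => x xb xQ.
    apply: (le_trans (smoothing_close_pointwise xb xQ)).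
    under eq_bigr do rewrite mulrDr.
    rewrite big_split /= -mulr_suml; apply: lerD.
      by rewrite mulrCA -[leRHS]mulrA ler_wpM2l// ler_wpM2r// overlap.
    rewrite mulr_sumr; apply: ler_sum => i _.
    by rewrite mulrCA.
rewrite itgD; last 4 first.
- exact: measurable_funM.
- exact: measurable_funM.
- by move=> x; exact: mulr_ge0.
- by move=> x; exact: mulr_ge0.
rewrite !itgZ//.
rewrite itgD//; last by move=> x; exact: sqr_ge0.
have avg := @itg_sum_cell_mean _ _ _ mu muoo _ _ mQ _ overlap (fun x => r x ^+ 2) ir2 r20.
rewrite itg_sqr// in avg.
apply: (@le_trans _ _ ((3 * 2 ^+ n)%:E * ((osc ^+ 2 * fine (mu setT))%:E + (norm2 mu r ^+ 2)%:E) +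
   3%:E * ((2 ^+ n)%:E * (norm2 mu r ^+ 2)%:E))%E).
  apply: leeD; apply: lee_wpmul2l => //; apply: leeD.
    rewrite EFinM fineK ?fin_num_measure// le_eqVlt; apply/orP; left; apply/eqP.
    exact: itg_cst.
  by rewrite le_eqVlt; apply/orP; left; apply/eqP; exact: itg_sqr.
rewrite -!EFinD lee_fin.
by rewrite le_eqVlt; apply/orP; left; apply/eqP; ring.
Qed.

End comparison_with_lipschitz.

Section growth_of_smoothing.
Variables (beta p : R).
Hypotheses (beta0 : 0 <= beta) (beta1 : beta <= 1) (p1 : 1 <= p).

Let G (z : 'rV[R]_n * 'rV[R]_n) : R := growth_density beta z (u z.1) (u z.2).
Hypothesis iGp : mu2.-integrable setT (EFin \o (fun z => G z `^ p)).

Let mG : measurable_fun setT G.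
Proof.
have [mu_ _] := L2u; apply: measurable_growth_density.
  exact: (measurableT_comp mu_ measurable_fst).
exact: (measurableT_comp mu_ measurable_snd).
Qed.

Let G1 z : 1 <= G z. Proof. exact: growth_density_ge1. Qed.

Let G0 z : 0 <= G z. Proof. exact: le_trans (G1 z). Qed.

Let iG : mu2.-integrable setT (EFin \o G).
Proof.
apply: le_integrable iGp => //; first exact/measurable_EFinP.
move=> z _ /=; rewrite lee_fin !ger0_norm ?powR_ge0//.
by rewrite -[leLHS]powRr1// ler_powR.
Qed.

Local Notation Q2 := (product_cell Q).
Local Notation mean2 := (cell_mean mu2 Q2).

Definition smoothing_growth_const : R := (n%:R * (1 + 4 * 2 ^+ n * n%:R)) `^ beta + 3.

Lemma smoothing_growth_pointwise (x y : 'rV[R]_n) : `|x| <= b -> `|y| <= b ->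
  (forall i : I, Q i x -> 0 < fine (mu (Q i))) ->
  (forall i : I, Q i y -> 0 < fine (mu (Q i))) ->
  growth_density beta (x, y) (smoothing u x) (smoothing u y) `^ p <=
    smoothing_growth_const `^ p *
      \sum_(ij : I * I) \1_(Q2 ij) (x, y) * mean2 ij (fun z => G z `^ p).
Proof.
move=> xb yb xQ yQ.
have mu2oo := finite_product_lty mu mu.
have mQ2 := measurable_product_cell mQ.
have p0 : 0 < p by exact: lt_le_trans p1.
set S := \sum_(ij : I * I) _.
have S0 : 0 <= S.
  by apply: sumr_ge0 => ij _; rewrite mulr_ge0// cell_mean_ge0// => z; exact: powR_ge0.
pose s := S `^ p^-1.
have s0 : 0 <= s by exact: powR_ge0.
have sp : s `^ p = S by rewrite -powRrM mulVf ?powRr1// lt0r_neq0.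
have mean_s (i j : I) : Q i x -> Q j y -> mean2 (i, j) G <= s.
  move=> Qx Qy; apply: (cell_mean_power mu2oo mQ2 iG iGp G0 p1 s0).
    exact: product_cell_pos (xQ _ Qx) (yQ _ Qy).
  rewrite sp /S (bigD1 (i, j))//= indic_product_cell !indicE !mem_set// !mul1r lerDl.
  by apply: sumr_ge0 => ij _; rewrite mulr_ge0// cell_mean_ge0// => z; exact: powR_ge0.
pose c (i : I) := cell_mean mu Q i u.
have L2n := sq_integrable_norm L2u.
have [mu_ iu2] := L2u.
have [iu1 iu2'] := integrable_coords L2u.
have [in1 in2] := integrable_coords L2n.
have c_s (i j : I) : Q i x -> Q j y -> `|c i| <= s /\ `|c j| <= s.
  move=> Qx Qy; have := mean_s _ _ Qx Qy => ms.
  have iu := sq_integrable_integrable L2u.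
  split; apply: (le_trans (le_norm_cell_mean _ _ iu)) => //.
    rewrite -(product_mean_fst mQ (ij := (i, j)) L2n (yQ _ Qy)).
    apply: le_trans ms; apply: le_cell_mean => // z _.
    by have [] := le_growth_density beta z (u z.1) (u z.2).
  rewrite -(product_mean_snd mQ (ij := (i, j)) L2n (xQ _ Qx)).
  apply: le_trans ms; apply: le_cell_mean => // z _.
  by have [] := le_growth_density beta z (u z.1) (u z.2).
have [i0 Qx0] := cell_of xb; have [j0 Qy0] := cell_of yb.
have s1 : 1 <= s.
  apply: le_trans (mean_s _ _ Qx0 Qy0).
  have Qpos : 0 < fine (mu2 (Q2 (i0, j0))).
    exact: product_cell_pos (xQ _ Qx0) (yQ _ Qy0).
  have i1 : mu2.-integrable setT (EFin \o (fun=> 1)).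
    by apply: (bounded_integrable mu2oo (B := 1)) => // z; rewrite normr1.
  by rewrite -(cell_mean_cst mu2oo mQ2 1 Qpos); exact: le_cell_mean.
have v_s z : `|z| <= b -> (forall i : I, Q i z -> `|c i| <= s) -> `|smoothing u z| <= s.
  move=> zb cz; apply: (le_trans (ler_norm_sum _ _ _)).
  rewrite -[leRHS]mul1r -(sum_bump zb) mulr_suml; apply: ler_sum => i _.
  rewrite normrM (ger0_norm (lattice_bump_ge0 _ _ _ _)).
  have [->|/lattice_bump_support Qz] := eqVneq (bump i z) 0; first by rewrite !mul0r.
  by apply: ler_wpM2l; [exact: lattice_bump_ge0|exact: cz].
have vx : `|smoothing u x| <= s by apply: v_s => // i Qx; have [] := c_s _ _ Qx Qy0.
have vy : `|smoothing u y| <= s by apply: v_s => // i Qy; have [] := c_s _ _ Qx0 Qy.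
pose dist := `|x - y|.
pose Dn := n%:R * (dist + 4 * eps).
have dist0 : 0 <= dist by exact: normr_ge0.
have Dn0 : 0 <= Dn by rewrite mulr_ge0// addr_ge0// mulr_ge0// ltW.
have cc (i j : I) : Q i x -> Q j y -> `|c i - c j| <= Dn `^ beta * s.
  move=> Qx Qy.
  have -> : c i - c j = mean2 (i, j) (fun z => u z.1 - u z.2).
    have -> : (fun z => u z.1 - u z.2) = (fun z => u z.1 + -1 * u z.2).
      by apply/funext => z; rewrite mulN1r.
    have iN := integrableZl measurableT (-1) iu2'.
    rewrite (cell_meanD mQ2 _ iu1); last by apply: eq_integrable iN.
    rewrite (cell_meanZ mQ2)//.
    rewrite (product_mean_fst mQ (ij := (i, j)) L2u (yQ _ Qy)).
    rewrite (product_mean_snd mQ (ij := (i, j)) L2u (xQ _ Qx)).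
    by rewrite mulN1r.
  have iB : mu2.-integrable setT (EFin \o (fun z => u z.1 - u z.2)).
    by have := integrableB measurableT iu1 iu2'; apply: eq_integrable.
  apply: (le_trans (le_norm_cell_mean mQ2 _ iB)).
  apply: (@le_trans _ _ (mean2 (i, j) (fun z => Dn `^ beta * G z))); last first.
    by rewrite (cell_meanZ mQ2)// ler_wpM2l ?powR_ge0// mean_s.
  apply: le_cell_mean => //.
  - exact: integrable_norm iB.
  - by have := integrableZl measurableT (Dn `^ beta) iG; apply: eq_integrable.
  move=> [z1 z2] [/= Q1 Q2_].
  have [z12|z12] := eqVneq (enorm (z1 - z2)) 0.
    have -> : z1 = z2.
      apply/eqP; rewrite -subr_eq0 -normr_le0; apply: le_trans (norm_le_enorm _) _.
      by rewrite z12.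
    by rewrite subrr normr0 mulr_ge0 ?powR_ge0.
  have e0 : 0 < enorm (z1 - z2) by rewrite lt_neqAle eq_sym z12 enorm_ge0.
  have pe0 : 0 < enorm (z1 - z2) `^ beta by rewrite powR_gt0.
  have eD : enorm (z1 - z2) <= Dn.
    apply: (le_trans (enorm_le_norm _)); apply: ler_wpM2l => //.
    have -> : z1 - z2 = (z1 - x) + (x - y) + (y - z2) by rewrite subrKA subrKA.
    have d1 := lattice_cell_diam eps0 Q1 Qx.
    have d2 := lattice_cell_diam eps0 Qy Q2_.
    apply: (le_trans (ler_normD _ _)); rewrite /dist.
    have := ler_normD (z1 - x) (x - y); lra.
  have pD : enorm (z1 - z2) `^ beta <= Dn `^ beta.
    by apply: ge0_ler_powR => //; rewrite nnegrE// ltW.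
  have Gge : `|u z1 - u z2| / enorm (z1 - z2) `^ beta <= G (z1, z2).
    by have [] := le_growth_density beta (z1, z2) (u z1) (u z2).
  rewrite ler_pdivrMr// in Gge; apply: (le_trans Gge).
  by rewrite mulrC ler_wpM2r.
pose a (i : I) := bump i x - bump i y.
have a_sum : \sum_i a i = 0 by rewrite sumrB !sum_bump// subrr.
have vE : smoothing u x - smoothing u y = \sum_i a i * c i.
  by rewrite /smoothing -sumrB; apply: eq_bigr => i _; rewrite -mulrBl.
have supp (i : I) z : 0 < bump i z -> Q i z.
  by move=> h; apply: lattice_bump_support; rewrite gt_eqF.
pose A := (\sum_i `|a i|) / 2.
have A0 : 0 <= A by rewrite divr_ge0// sumr_ge0.
have A1 : A <= 1.
  rewrite /A ler_pdivrMr// mul1r.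
  have -> : 2 = \sum_(i : I) (bump i x + bump i y) :> R by rewrite big_split /= !sum_bump.
  apply: ler_sum => i _; apply: (le_trans (ler_normB _ _)).
  by rewrite !ger0_norm ?lattice_bump_ge0.
have A2 : A * eps <= 2 ^+ n * n%:R * dist.
  have := sum_lattice_bump_lipschitz N b eps0 x y; rewrite -/dist => H.
  rewrite /A -ler_pdivlMr//; rewrite ler_pdivrMr//; apply: (le_trans H).
  by rewrite le_eqVlt; apply/orP; left; apply/eqP; ring.
have vxy : `|smoothing u x - smoothing u y| <= A * (Dn `^ beta * s).
  rewrite vE; apply: zero_sum_bound => //; last by rewrite mulr_ge0 ?powR_ge0.
  move=> i j ai aj; apply: cc; apply: supp.
    by move: ai; rewrite subr_gt0 => /(le_lt_trans _); apply; exact: lattice_bump_ge0.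
  by move: aj; rewrite subr_lt0 => /(le_lt_trans _); apply; exact: lattice_bump_ge0.
pose C0 := n%:R * (1 + 4 * 2 ^+ n * n%:R) : R.
have C00 : 0 <= C0 by rewrite mulr_ge0// addr_ge0// !mulr_ge0// exprn_ge0.
have ADn : A * Dn <= C0 * enorm (x - y).
  apply: (@le_trans _ _ (C0 * dist)); last by apply: ler_wpM2l => //; exact: norm_le_enorm.
  have -> : A * Dn = n%:R * (A * dist + 4 * (A * eps)) by rewrite /Dn; ring.
  have -> : C0 * dist = n%:R * (dist + 4 * (2 ^+ n * n%:R * dist)) by rewrite /C0; ring.
  apply: ler_wpM2l => //; apply: lerD; first by rewrite ler_piMl.
  exact: ler_wpM2l.
have quot : `|smoothing u x - smoothing u y| / enorm (x - y) `^ beta <= C0 `^ beta * s.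
  have [->|z] := eqVneq (enorm (x - y) `^ beta) 0.
    by rewrite invr0 mulr0 mulr_ge0 ?powR_ge0.
  have pos : 0 < enorm (x - y) `^ beta by rewrite lt_neqAle eq_sym z powR_ge0.
  rewrite ler_pdivrMr//; apply: (le_trans vxy).
  rewrite [leLHS]mulrA [leRHS]mulrAC; apply: ler_wpM2r => //.
  rewrite -powRM ?enorm_ge0//.
  apply: (@le_trans _ _ ((A * Dn) `^ beta)); last first.
    by apply: ge0_ler_powR => //; rewrite nnegrE mulr_ge0// enorm_ge0.
  rewrite [leRHS]powRM// ler_wpM2r ?powR_ge0//.
  have [->|An0] := eqVneq A 0; first by rewrite powR_ge0.
  rewrite -[leLHS]powRr1//; apply: ger_powR => //.
  by rewrite A1 andbT lt_neqAle eq_sym An0.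
have -> : smoothing_growth_const `^ p * S = (smoothing_growth_const * s) `^ p.
  by rewrite powRM ?sp// addr_ge0// powR_ge0.
apply: ge0_ler_powR; rewrite ?nnegrE; first exact: ltW.
- exact: le_trans (growth_density_ge1 _ _ _ _).
- by rewrite mulr_ge0// addr_ge0// powR_ge0.
rewrite /growth_density /= /smoothing_growth_const -/C0 mulrDl; lra.
Qed.

Lemma smoothing_growth_split (K := smoothing_growth_const `^ p * (2 ^+ n * 2 ^+ n)) (c : R) :
  {ae mu, forall x, `|x| <= b} -> 0 <= c ->
  exists S : 'rV[R]_n * 'rV[R]_n -> R,
    [/\ measurable_fun setT S, (forall z, 0 <= S z),
        (itg mu2 S <= K%:E * itg mu2 (fun z => Num.max 0 (G z `^ p - c))%R)%E &
        {ae mu2, forall z,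
          growth_density beta z (smoothing u z.1) (smoothing u z.2) `^ p <= K * c + S z}].
Proof.
move=> mub c0.
have mu2oo := finite_product_lty mu mu.
have muoo := finite_measure_lty mu.
have mQ2 := measurable_product_cell mQ.
pose H z := Num.max 0 (G z `^ p - c).
have H0 z : 0 <= H z by rewrite le_max lexx.
have mGp : measurable_fun setT (fun z => G z `^ p) by apply/measurable_EFinP; exact: measurable_int iGp.
have mH : measurable_fun setT H by apply: measurable_maxr => //; exact: measurable_funB.
have iH : mu2.-integrable setT (EFin \o H).
  apply: le_integrable iGp => //; first exact/measurable_EFinP.
  move=> z _ /=; rewrite lee_fin !ger0_norm ?powR_ge0//.
  by rewrite ge_max powR_ge0 lerBlDr lerDl.
have ic : mu2.-integrable setT (EFin \o (fun=> c)).
  by apply: (bounded_integrable mu2oo (B := c)) => // z; rewrite ger0_norm.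
have k0 : 0 <= smoothing_growth_const `^ p by exact: powR_ge0.
have mind ij : measurable_fun setT (fun z => \1_(Q2 ij) z * mean2 ij H).
  by apply: measurable_funM => //; exact: measurable_indic.
have mS : measurable_fun setT (fun z => \sum_(ij : I * I) \1_(Q2 ij) z * mean2 ij H).
  exact: measurable_sum.
have S0 z : 0 <= \sum_(ij : I * I) \1_(Q2 ij) z * mean2 ij H.
  by apply: sumr_ge0 => ij _; rewrite mulr_ge0// cell_mean_ge0.
exists (fun z => smoothing_growth_const `^ p * \sum_(ij : I * I) \1_(Q2 ij) z * mean2 ij H).
split.
- exact: measurable_funM.
- by move=> z; rewrite mulr_ge0.
- rewrite itgZ// /K EFinM -muleA; apply: lee_wpmul2l; rewrite ?lee_fin//.
  exact: (itg_sum_cell_mean mu2oo mQ2 (product_overlap overlap) iH H0).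
have pos := ae_cell_pos muoo mQ.
have good : {ae mu, forall x : 'rV[R]_n, `|x| <= b /\
    (forall i : I, Q i x -> 0 < fine (mu (Q i)))}.
  by apply: filterS2 mub pos => x.
have good1 := ae_product_fst good; have good2 := ae_product_snd good.
apply: filterS2 good1 good2 => -[x y] /= [xb xQ] [yb yQ].
apply: (le_trans (smoothing_growth_pointwise xb yb xQ yQ)).
rewrite /K -mulrA -mulrDr; apply: ler_wpM2l => //.
apply: (@le_trans _ _ (\sum_(ij : I * I) (\1_(Q2 ij) (x, y) * c + \1_(Q2 ij) (x, y) * mean2 ij H))).
  apply: ler_sum => -[i j] _.
  have [Qxy|Qxy] := pselect (Q2 (i, j) (x, y)); last first.
    by rewrite indicE memNset// !mul0r addr0.
  have [Qx Qy] := Qxy.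
  rewrite indicE mem_set// !mul1r.
  rewrite -{1}(cell_mean_cst mu2oo mQ2 c (product_cell_pos mQ (xQ _ Qx) (yQ _ Qy))).
  rewrite -(cell_meanD mQ2)//; apply: le_cell_mean => //.
    have iD := integrableD measurableT ic iH.
    by apply: eq_integrable iD.
  by move=> z _; rewrite /H -lerBlDl le_max lexx orbT.
rewrite big_split /= lerD2r -mulr_suml ler_wpM2r//.
exact: (product_overlap overlap).
Qed.

End growth_of_smoothing.
Section local_oscillation.
Variables (p del : R) (F : 'rV[R]_n * 'rV[R]_n -> R).
Hypothesis p0 : 0 <= p.
Hypothesis mub : {ae mu, forall x, `|x| <= b}.
Hypothesis eps_del : n%:R * (2 * eps) < del.
Hypothesis iF : mu2.-integrable setT (EFin \o F).
Hypothesis F_osc : forall z, enorm (z.1 - z.2) < del -> `|u z.1 - u z.2| `^ p <= F z.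

Lemma power_integrable_of_oscillation : mu.-integrable setT (EFin \o (fun x => `|u x| `^ p)).
Proof.
have muoo := finite_measure_lty mu.
have [mu_ _] := L2u.
have pick (i : I) : exists y, 0 < fine (mu (Q i)) ->
    Q i y /\ mu.-integrable setT (EFin \o (fun x => F (x, y))).
  have [Q0|Q0] := pselect (0 < fine (mu (Q i))); last by exists 0.
  have [A [mA A0 AF]] := ae_integrable2 iF.
  apply: contrapT => /forallNP none.
  have QA : Q i `<=` A.
    by move=> y Qy; apply: AF => /= iy; apply: (none y) => _; split.
  have : (mu (Q i) <= mu A)%E by apply: le_measure; rewrite ?inE//; exact: mQ.
  move=> le0; have Qi0 : mu (Q i) = 0%E.
    by apply/eqP; rewrite eq_le measure_ge0 andbT; apply: (le_trans le0); rewrite le_eqVlt; apply/orP; left; apply/eqP; exact: A0.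
  by move: Q0; rewrite Qi0 ltxx.
have {pick}[y Hy] := choice pick.
pose h (i : I) (x : 'rV[R]_n) : R :=
  if 0 < fine (mu (Q i)) then 2 `^ p * (`|F (x, y i)| + `|u (y i)| `^ p) else 0.
have h0 i x : 0 <= h i x.
  by rewrite /h; case: ifP => // _; rewrite mulr_ge0 ?powR_ge0// addr_ge0 ?powR_ge0.
have ih i : mu.-integrable setT (EFin \o h i).
  rewrite /h; case: (0 < fine (mu (Q i))) (Hy i) => [/(_ isT)[_ iy]|_]; last first.
    by apply: (bounded_integrable muoo (B := 0)) => // x; rewrite normr0.
  have i1 : mu.-integrable setT (EFin \o (fun x => `|F (x, y i)|)) by exact: integrable_norm iy.
  have i2 : mu.-integrable setT (EFin \o (fun=> `|u (y i)| `^ p)).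
    by apply: (bounded_integrable muoo (B := `|u (y i)| `^ p)) => // x; rewrite ger0_norm ?powR_ge0.
  by have := integrableZl measurableT (2 `^ p) (integrableD measurableT i1 i2); apply: eq_integrable.
have ihs : mu.-integrable setT (EFin \o (fun x => \sum_(i : I) h i x)).
  have H : mu.-integrable setT (fun x => \sum_(i : I) (h i x)%:E)%E.
    by apply: integrable_sum => // i _; exact: ih.
  by apply: eq_integrable H => // x _ /=; rewrite sumEFin.
have hs0 x : 0 <= \sum_(i : I) h i x by exact: sumr_ge0.
have mup : measurable_fun setT (fun x => `|u x| `^ p).
  by apply: (measurableT_comp (measurable_powR p)); exact: measurableT_comp.
apply: integrable_itg => //.
apply: le_lt_trans (itg_integrable hs0 ihs); apply: ae_le_itg => //.
- by apply/measurable_EFinP; exact: measurable_int ihs.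
apply: filterS2 mub (ae_cell_pos muoo mQ) => x xb xQ.
have [i Qx] := cell_of xb; have Q0 := xQ _ Qx; have [Qy _] := Hy _ Q0.
apply: (@le_trans _ _ (h i x)); last first.
  by rewrite (bigD1 i)//= lerDl; apply: sumr_ge0.
rewrite /h Q0; apply: (@le_trans _ _ ((`|u x - u (y i)| + `|u (y i)|) `^ p)).
  apply: ge0_ler_powR; rewrite ?nnegrE ?addr_ge0//.
  by rewrite -{1}(subrK (u (y i)) (u x)) ler_normD.
apply: (le_trans (powRD_le _ _ _)) => //; rewrite ler_wpM2l ?powR_ge0// lerD2r.
apply: le_trans (ler_norm _); apply: (F_osc (z := (x, y i))) => /=.
apply: le_lt_trans eps_del; apply: (le_trans (enorm_le_norm _)).
by apply: ler_wpM2l => //; exact: lattice_cell_diam Qx Qy.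
Qed.

End local_oscillation.

End smoothing.

Lemma smoothing_dense (R : realType) (n : nat)
  (mu : {finite_measure set 'rV[R]_n -> \bar R}) (b : R) (u : 'rV[R]_n -> R) :
  {ae mu, forall x, `|x| <= b} -> sq_integrable mu u -> forall e : R, 0 < e ->
  exists eps : R, 0 < eps /\ norm2 mu (fun x => smoothing mu b eps u x - u x) <= e.
Proof.
move=> mub L2u e e0.
pose C : R := 3 * 2 ^+ n * (fine (mu setT) + 2).
have m0 : 0 <= fine (mu setT) by exact: fine_ge0.
have C0 : 0 < C by rewrite !mulr_gt0 ?exprn_gt0// ltr_wpDl.
pose t : R := e / (C + 1).
have t0 : 0 < t by rewrite divr_gt0// addr_gt0.
have t2 : C * t ^+ 2 <= e ^+ 2.
  rewrite /t expr_div_n mulrA ler_pdivrMr ?exprn_gt0 ?addr_gt0//.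
  by rewrite mulrC ler_pM2l ?exprn_gt0//; nra.
have [w [[L Lw] L2w uw]] := lipschitz_dense L2u t0.
pose eps : R := t / (2 * `|L| + 1).
have d0 : 0 < 2 * `|L| + 1 by rewrite ltr_wpDl// mulr_ge0.
have eps0 : 0 < eps by rewrite divr_gt0.
exists eps; split => //.
rewrite -ler_sqr ?nnegrE ?norm2_ge0 ?(ltW e0)//.
apply: (le_trans (smoothing_close eps0 L2u mub L2w Lw)).
apply: le_trans t2.
rewrite (_ : C * t ^+ 2 = 3 * 2 ^+ n * ((fine (mu setT) + 2) * t ^+ 2)); last first.
  by rewrite /C; ring.
apply: ler_wpM2l; first by rewrite mulr_ge0 ?exprn_ge0.
rewrite [leRHS]mulrDl; apply: lerD.
  rewrite mulrC; apply: ler_wpM2l => //.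
  have Le : `|L| * (2 * eps) <= t.
    rewrite /eps (_ : _ * _ = 2 * `|L| * t / (2 * `|L| + 1)); last by ring.
    by rewrite ler_pdivrMr// mulrC ler_pM2l// lerDl.
  have L0 : 0 <= `|L| * (2 * eps) by rewrite mulr_ge0// mulr_ge0// ltW.
  by rewrite lerXn2r ?nnegrE// ltW.
by apply: ler_wpM2l => //; rewrite lerXn2r ?nnegrE ?norm2_ge0 ?(ltW t0).
Qed.

(** * Convergence of energies along a smoothing *)

Section equi_integrability.
Context d (T : measurableType d) {R : realType}.
Variable mu : {measure set T -> \bar R}.
Hypothesis muoo : (mu setT < +oo)%E.

Lemma itg_tail_small (H : T -> R) (e : R) : (forall x, 0 <= H x) ->
  mu.-integrable setT (EFin \o H) -> 0 < e ->
  exists N : nat, (itg mu (fun x => Num.max 0 (H x - N%:R))%R <= e%:E)%E.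
Proof.
move=> H0 iH e0.
have mH : measurable_fun setT H by apply/measurable_EFinP; exact: measurable_int iH.
have Hoo := itg_integrable H0 iH.
have Hfin : itg mu H \is a fin_num by rewrite ge0_fin_numE ?itg_ge0.
have mm (N : nat) : measurable_fun setT (fun x => Num.min (H x) N%:R).
  exact: measurable_minr.
have mt (N : nat) : measurable_fun setT (fun x => Num.max 0 (H x - N%:R))%R.
  by apply: measurable_maxr => //; exact: measurable_funB.
have m0 (N : nat) x : 0 <= Num.min (H x) N%:R by rewrite le_min H0 ler0n.
have t0 (N : nat) x : 0 <= Num.max 0 (H x - N%:R) by rewrite le_max lexx.
apply: contrapT => /forallNP big.
have small (N : nat) : (itg mu (fun x => Num.min (H x) N%:R)%R <= (fine (itg mu H) - e)%:E)%E.
  have := big N => /negP; rewrite -ltNge => eN.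
  have HE : itg mu H = (itg mu (fun x => Num.min (H x) N%:R)%R +
      itg mu (fun x => Num.max 0 (H x - N%:R))%R)%E.
    rewrite -itgD//; congr itg; apply/funext => x.
    by case: (leP (H x) N%:R) => h; [rewrite max_l|rewrite max_r]; lra.
  have f1 : itg mu (fun x => Num.min (H x) N%:R)%R \is a fin_num.
    rewrite ge0_fin_numE ?itg_ge0//; apply: le_lt_trans Hoo.
    by apply: le_itg => // x; rewrite ge_min lexx.
  have f2 : itg mu (fun x => Num.max 0 (H x - N%:R))%R \is a fin_num.
    rewrite ge0_fin_numE ?itg_ge0//; apply: le_lt_trans Hoo.
    by apply: le_itg => // x; rewrite ge_max H0 lerBlDr lerDl ler0n.
  rewrite HE fineD// -(fineK f1) lee_fin /=.
  by rewrite -(fineK f2) lte_fin in eN; lra.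
have : (itg mu H <= (fine (itg mu H) - e)%:E)%E.
  apply: (fatou_bound mm mH m0 H0) => [|K]; last by exists K.
  apply: aeW => x.
  apply: cvg_near_cst; exists (Num.trunc (H x)).+1 => // N /= KN.
  apply/min_idPl; apply: (le_trans (ltW (truncnS_gt (H x)))).
  by rewrite ler_nat.
by rewrite -{1}(fineK Hfin) lee_fin; lra.
Qed.

(** Up to a remainder of small integral the functions are uniformly bounded;
    truncating at that bound leaves a sequence to which bounded convergence
    applies. *)
Lemma vitali_limsup (F_ : nat -> T -> R) (F : T -> R) :
  (forall m, measurable_fun setT (F_ m)) -> measurable_fun setT F ->
  (forall m x, 0 <= F_ m x) -> (forall x, 0 <= F x) ->
  {ae mu, forall x, F_ m x @[m --> \oo] --> F x} ->
  (forall e, 0 < e -> exists2 B, 0 <= B & forall m, exists S : T -> R,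
    [/\ measurable_fun setT S, (forall x, 0 <= S x), (itg mu S <= e%:E)%E &
        {ae mu, forall x, F_ m x <= B + S x}]) ->
  forall e, 0 < e -> \forall m \near \oo, (itg mu (F_ m) <= itg mu F + e%:E)%E.
Proof.
move=> mF_ mF F_0 F0 F_F tight e e0.
have e20 : 0 < e / 2 by rewrite divr_gt0.
have [B B0 HB] := tight _ e20.
have mm m : measurable_fun setT (fun x => Num.min (F_ m x) B) by exact: measurable_minr.
have mmF : measurable_fun setT (fun x => Num.min (F x) B) by exact: measurable_minr.
have m0 m x : 0 <= Num.min (F_ m x) B by rewrite le_min F_0.
have mF0 x : 0 <= Num.min (F x) B by rewrite le_min F0.
have cvgB : itg mu (fun x => Num.min (F_ m x) B)%R @[m --> \oo] --> itg mu (fun x => Num.min (F x) B)%R.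
  apply: (bounded_cvg_itg muoo mm mmF (B := B)) => [m x|].
    by rewrite ger0_norm// ge_min lexx orbT.
  apply: filterS F_F => x Fx.
  have cm : {for F x, continuous (fun y : R => Num.min y B)}.
    by apply: (@continuous_min _ R^o id (cst B)) => //; exact: cvg_cst.
  exact: (cvg_comp _ _ Fx cm).
have Bfin : itg mu (fun x => Num.min (F x) B)%R \is a fin_num.
  rewrite ge0_fin_numE ?itg_ge0//.
  apply: (@le_lt_trans _ _ (itg mu (fun=> B))).
    by apply: le_itg => // x; rewrite ge_min lexx orbT.
  by rewrite itg_cst lte_mul_pinfty.
have lt1 : (itg mu (fun x => Num.min (F x) B)%R < itg mu (fun x => Num.min (F x) B)%R + (e / 2)%:E)%E.
  by rewrite -(fineK Bfin) -EFinD lte_fin ltrDl.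
have ev : \forall m \near \oo, (itg mu (fun x => Num.min (F_ m x) B)%R <
    itg mu (fun x => Num.min (F x) B)%R + (e / 2)%:E)%E.
  exact: cvgB _ (open_ereal_lt' lt1).
apply: filterS ev => m /ltW Hm.
have [S [mS S0 iS FS]] := HB m.
apply: (@le_trans _ _ (itg mu (fun x => Num.min (F_ m x) B + S x)%R)).
  apply: ae_le_itg => //.
  - exact: measurable_funD.
  - by move=> x; rewrite addr_ge0.
  - apply: filterS FS => x; case: (leP (F_ m x) B) => // _ _; rewrite lerDl; exact: S0.
rewrite itgD//; apply: (le_trans (leeD Hm iS)).
rewrite -addeA -EFinD -splitr leeD2r//.
by apply: le_itg => // x; rewrite ge_min lexx.
Qed.

End equi_integrability.

Lemma continuous_powR_norm (R : realType) (p : R) : 1 <= p ->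
  continuous (fun x : R => `|x| `^ p).
Proof.
move=> p1 x; have p0 : 0 < p by exact: lt_le_trans p1.
have [->|x0] := eqVneq x 0; last first.
  have nx : 0 < `|x| by rewrite normr_gt0.
  have c : (fun y : R => expR (p * ln `|y|)) y @[y --> x] --> expR (p * ln `|x|).
    apply: (cvg_comp _ expR); last exact: continuous_expR.
    apply: cvgMr; apply: (cvg_comp _ (@ln R)); last exact: continuous_ln.
    by apply: cvg_norm; exact: cvg_id.
  have E : `|x| `^ p = expR (p * ln `|x|) by rewrite /powR gt_eqF.
  rewrite /continuous_at E; apply: cvg_trans c; apply: near_eq_cvg.
  have : \forall y \near x, 0 < `|y|.
    exact: (cvgr_norm_gt x (@cvg_id _ (nbhs x))) nx.
  by apply: filterS => y y0; rewrite /powR gt_eqF.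
rewrite /continuous_at normr0 powR0 ?gt_eqF//.
have h : \forall y \near (0 : R), `|y| `^ p <= `|y|.
  exists 1 => //= y; rewrite /ball_ /= sub0r normrN => y1.
  have [->|y0] := eqVneq y 0; first by rewrite normr0 powR0 ?gt_eqF.
  rewrite -[leRHS]powRr1//; apply: ger_powR => //.
  by rewrite normr_gt0 y0 ltW.
apply: (@squeeze_cvgr _ _ _ _ (fun=> 0) (fun y : R => `|y|)).
- by apply: filterS h => y ->; rewrite powR_ge0.
- exact: cvg_cst.
- rewrite -[X in _ --> X](normr0 R); exact: norm_continuous.
Qed.

Lemma cvg_powR (R : realType) (T : Type) (F : set_system T) {FF : Filter F}
  (f : T -> R) (l p : R) : 1 <= p -> (forall x, 0 <= f x) -> 0 <= l ->
  f x @[x --> F] --> l -> f x `^ p @[x --> F] --> l `^ p.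
Proof.
move=> p1 f0 l0 fl.
have := cvg_comp _ _ fl (@continuous_powR_norm _ _ p1 l).
rewrite ger0_norm//; apply: cvg_trans; apply: near_eq_cvg; near=> x.
by rewrite /= ger0_norm.
Unshelve. all: by end_near.
Qed.

Lemma cvg_powR_exponent (R : realType) (a p : R) (r : nat -> R) : 0 <= a -> 1 <= p ->
  (forall k, 1 <= r k) -> r k @[k --> \oo] --> p -> a `^ r k @[k --> \oo] --> a `^ p.
Proof.
move=> a0 p1 r1 rp.
have pos (t : R) : 1 <= t -> t != 0 by move=> t1; rewrite gt_eqF// (lt_le_trans _ t1).
have [->|an0] := eqVneq a 0.
  by rewrite powR0 ?pos//; under eq_fun do rewrite powR0 ?pos//; exact: cvg_cst.
rewrite /powR (negPf an0).
apply: (cvg_comp _ expR); last exact: continuous_expR.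
by apply: cvgMl.
Qed.

Section power_integrable.
Context d (T : measurableType d) {R : realType}.
Variable mu : {measure set T -> \bar R}.
Variable p : R.
Hypothesis p0 : 0 <= p.

Definition power_integrable (f : T -> R) :=
  measurable_fun setT f /\ mu.-integrable setT (EFin \o (fun x => f x `^ p)).

Lemma power_integrableS (f g : T -> R) : measurable_fun setT f -> (forall x, 0 <= f x) ->
  (forall x, f x <= g x) -> power_integrable g -> power_integrable f.
Proof.
move=> mf f0 fg [mg ig]; split => //; apply: le_integrable ig => //.
  by apply/measurable_EFinP; exact: (measurableT_comp (measurable_powR p)).
move=> x _ /=; rewrite lee_fin !ger0_norm ?powR_ge0//.
by apply: ge0_ler_powR => //; rewrite nnegrE// (le_trans _ (fg x)).
Qed.

Lemma power_integrableD (f g : T -> R) : (forall x, 0 <= f x) -> (forall x, 0 <= g x) ->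
  power_integrable f -> power_integrable g -> power_integrable (fun x => f x + g x).
Proof.
move=> f0 g0 [mf If] [mg Ig].
have mfg : measurable_fun setT (fun x => f x + g x) by exact: measurable_funD.
split => //; apply: le_integrable (integrableZl measurableT (2 `^ p) (integrableD measurableT If Ig)) => //.
  by apply/measurable_EFinP; exact: (measurableT_comp (measurable_powR p)).
move=> x _ /=; rewrite lee_fin !ger0_norm ?powR_ge0 ?mulr_ge0 ?addr_ge0 ?powR_ge0//.
exact: powRD_le.
Qed.

Lemma power_integrableZ (f : T -> R) (c : R) : (forall x, 0 <= f x) -> 0 <= c ->
  power_integrable f -> power_integrable (fun x => c * f x).
Proof.
move=> f0 c0 [mf If]; split; first exact: measurable_funM.
apply: eq_integrable (integrableZl measurableT (c `^ p) If) => // x _ /=.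
by rewrite powRM.
Qed.

Lemma power_integrable_cst (c : R) : (mu setT < +oo)%E -> power_integrable (fun=> c).
Proof.
move=> muoo; split => //; apply: (bounded_integrable muoo (B := c `^ p)) => // x.
by rewrite ger0_norm ?powR_ge0.
Qed.

End power_integrable.

Lemma growth_density_lipschitz_bounded (R : realType) (n : nat) (beta : R) (v : 'rV[R]_n -> R) (B : R) :
  0 <= beta -> beta <= 1 -> lipschitz_fun v -> (forall x, `|v x| <= B) ->
  exists C : R, forall z, growth_density beta z (v z.1) (v z.2) <= C.
Proof.
move=> b0 b1 [L vL] vB.
have B0 : 0 <= B := le_trans (normr_ge0 _) (vB 0).
exists (`|L| + 2 * B + B + B + 1) => -[x y]; rewrite /growth_density /=.
have := vB x; have := vB y.
suff : `|v x - v y| / enorm (x - y) `^ beta <= `|L| + 2 * B by lra.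
have L0 := normr_ge0 L.
have dB : `|v x - v y| <= 2 * B.
  by apply: (le_trans (ler_normB _ _)); have := vB x; have := vB y; lra.
have dL : `|v x - v y| <= `|L| * enorm (x - y).
  apply: (le_trans (vL _ _)); apply: (le_trans (ler_wpM2r _ (ler_norm L))) => //.
  by apply: ler_wpM2l => //; exact: norm_le_enorm.
set r := enorm (x - y) in dL *; have r0 : 0 <= r := enorm_ge0 _.
have [/eqP|rb] := eqVneq (r `^ beta) 0; first by move=> /eqP ->; rewrite invr0 mulr0; lra.
have rb0 : 0 < r `^ beta by rewrite lt_neqAle eq_sym rb powR_ge0.
rewrite ler_pdivrMr//.
have [r1|r1] := leP r 1.
  apply: (le_trans dL); apply: (@le_trans _ _ (`|L| * r `^ beta)).
    apply: ler_wpM2l => //; have [->|rn0] := eqVneq r 0; first exact: powR_ge0.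
    by rewrite -[leLHS]powRr1//; apply: ger_powR => //; rewrite r1 andbT lt_neqAle eq_sym rn0.
  by apply: ler_wpM2r; [exact: ltW|lra].
have : 1 <= r `^ beta.
  apply: (@le_trans _ _ (1 `^ beta)); first by rewrite powR1.
  by apply: ge0_ler_powR; rewrite ?nnegrE// ltW.
move=> h; apply: (le_trans dB); nra.
Qed.

Lemma growth_sum_bound (R : realFieldType) (M D E a c : R) :
  0 <= M -> 0 <= D -> 0 <= E -> 0 <= a -> 0 <= c ->
  M * (E + M) + D * (a + c) + a + c + 1 <= (M + M * M + D + 1) * ((E + a) + (c + 1)).
Proof.
move=> M0 D0 E0 a0 c0; rewrite -subr_ge0.
have -> : (M + M * M + D + 1) * ((E + a) + (c + 1)) -
    (M * (E + M) + D * (a + c) + a + c + 1) =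
  (M + M * M) * (a + c) + M * M * E + D * E + M + D + E by ring.
by rewrite !addr_ge0 ?mulr_ge0 ?addr_ge0 ?mulr_ge0.
Qed.

Section recovery.
Context {R : realType} (n : nat).
Variable mu : {finite_measure set 'rV[R]_n -> \bar R}.
Local Notation mu2 := (mu \x mu)%E.
Variable b : R.
Hypothesis mub : {ae mu, forall x, `|x| <= b}.
Variable g : 'rV[R]_n * 'rV[R]_n -> R -> R -> R.
Hypothesis mg : forall xi zeta, measurable_fun setT (fun z => g z xi zeta).
Hypothesis cg : forall z, continuous (fun w : R * R => g z w.1 w.2).
Hypothesis g0 : forall z xi zeta, 0 <= g z xi zeta.
Variables (M del beta p : R).
Hypotheses (M0 : 0 < M) (del0 : 0 < del) (beta0 : 0 <= beta) (beta1 : beta <= 1).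
Hypothesis p1 : 1 <= p.
Hypothesis g_upper : forall z xi zeta, g z xi zeta <= M * growth_density beta z xi zeta.
Hypothesis g_lower : forall (z : 'rV[R]_n * 'rV[R]_n) xi zeta, enorm (z.1 - z.2) < del ->
  M^-1 * (`|xi - zeta| / enorm (z.1 - z.2) `^ beta) - M <= g z xi zeta.

Let p0 : 0 <= p. Proof. exact: le_trans p1. Qed.

Let energy (u : 'rV[R]_n -> R) z := g z (u z.1) (u z.2).

Let measurable_energy u : measurable_fun setT u -> measurable_fun setT (energy u).
Proof.
move=> mu_; apply: measurable_caratheodory => //.
  exact: (measurableT_comp mu_ measurable_fst).
exact: (measurableT_comp mu_ measurable_snd).
Qed.

Let mpow (h : 'rV[R]_n * 'rV[R]_n -> R) : measurable_fun setT h -> measurable_fun setT (fun z => h z `^ p).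
Proof. by move=> mh; exact: (measurableT_comp (measurable_powR p)). Qed.

Variable u : 'rV[R]_n -> R.
Hypothesis L2u : sq_integrable mu u.
Hypothesis energy_fin : (itg mu2 (fun z => energy u z `^ p)%R < +oo)%E.

(** Near the diagonal the lower bound controls the difference quotient, so the
    oscillation of [u] at small scale has finite p-th moment, hence so has [u];
    far from the diagonal the quotient is controlled by [u] itself. *)
Lemma growth_density_power_integrable :
  power_integrable mu2 p (fun z => growth_density beta z (u z.1) (u z.2)).
Proof.
have mu2oo := finite_product_lty mu mu.
have [mu_ _] := L2u.
have mu1 : measurable_fun setT (fun z : 'rV[R]_n * 'rV[R]_n => u z.1).
  exact: (measurableT_comp mu_ measurable_fst).
have mu2_ : measurable_fun setT (fun z : 'rV[R]_n * 'rV[R]_n => u z.2).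
  exact: (measurableT_comp mu_ measurable_snd).
have mE := measurable_energy mu_.
have E0 z : 0 <= energy u z by exact: g0.
have iE : power_integrable mu2 p (energy u).
  split => //; apply: integrable_itg => //; first exact: mpow.
  by move=> z; exact: powR_ge0.
have quot_near (z : 'rV[R]_n * 'rV[R]_n) : enorm (z.1 - z.2) < del ->
    `|u z.1 - u z.2| / enorm (z.1 - z.2) `^ beta <= M * (energy u z + M).
  move=> zd; have := g_lower (u z.1) (u z.2) zd; rewrite -/(energy u z) lerBlDr.
  by rewrite -(ler_pM2l M0) mulrA divff ?mul1r// lt0r_neq0.
have osc (z : 'rV[R]_n * 'rV[R]_n) : enorm (z.1 - z.2) < del -> `|u z.1 - u z.2| <= del `^ beta * (M * (energy u z + M)).
  move=> zd; have EM0 : 0 <= M * (energy u z + M) by rewrite mulr_ge0 ?addr_ge0 ?(ltW M0).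
  have [z12|z12] := eqVneq (enorm (z.1 - z.2)) 0.
    have -> : z.1 = z.2.
      by apply/eqP; rewrite -subr_eq0 -normr_le0 -z12; exact: norm_le_enorm.
    by rewrite subrr normr0 mulr_ge0 ?powR_ge0.
  have e0 : 0 < enorm (z.1 - z.2) by rewrite lt_neqAle eq_sym z12 enorm_ge0.
  have := quot_near _ zd; rewrite ler_pdivrMr ?powR_gt0// => h; apply: (le_trans h).
  rewrite mulrC ler_wpM2r//; apply: ge0_ler_powR => //; rewrite ?nnegrE ?enorm_ge0//; exact: ltW.
have iEM : power_integrable mu2 p (fun z => del `^ beta * (M * (energy u z + M))).
  apply: power_integrableZ; [|exact: powR_ge0|].
    by move=> z; rewrite mulr_ge0 ?addr_ge0 ?(ltW M0).
  apply: power_integrableZ; [|exact: ltW|].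
    by move=> z; rewrite addr_ge0 ?(ltW M0).
  apply: power_integrableD => //; last exact: power_integrable_cst.
  by move=> z; exact: ltW.
pose eps : R := del / (2 * n%:R + 1).
have k0 : 0 < 2 * n%:R + 1 :> R by rewrite ltr_wpDl// mulr_ge0.
have eps0 : 0 < eps by rewrite divr_gt0.
have eps_del : n%:R * (2 * eps) < del.
  have E : n%:R * (2 * eps) + eps = del by rewrite /eps; field; rewrite lt0r_neq0.
  by rewrite -[ltRHS]E ltrDl.
have iu : mu.-integrable setT (EFin \o (fun x => `|u x| `^ p)).
  apply: (power_integrable_of_oscillation eps0 L2u p0 mub eps_del iEM.2) => z zd.
  by apply: ge0_ler_powR => //; rewrite ?nnegrE//; [exact: le_trans (osc _ zd)|exact: osc].
have up0 x : 0 <= `|u x| `^ p by exact: powR_ge0.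
have mup : measurable_fun setT (fun x => `|u x| `^ p).
  by apply/measurable_EFinP; exact: measurable_int iu.
have iu_lt : (itg mu (fun x => `|u x| `^ p)%R < +oo)%E by exact: itg_integrable.
have mu_lt := finite_measure_lty mu.
have i1 : power_integrable mu2 p (fun z => `|u z.1|).
  split; first exact: measurableT_comp.
  apply: integrable_itg => //; first exact: (measurableT_comp mup measurable_fst).
  rewrite [X in (X < _)%E](_ : _ = (itg mu (fun x => `|u x| `^ p)%R * mu setT)%E).
    by rewrite lte_mul_pinfty// ?itg_ge0// ge0_fin_numE ?itg_ge0.
  exact: (itg_fst _ _ mup).
have i2 : power_integrable mu2 p (fun z => `|u z.2|).
  split; first exact: measurableT_comp.
  apply: integrable_itg => //; first exact: (measurableT_comp mup measurable_snd).
  rewrite [X in (X < _)%E](_ : _ = (itg mu (fun x => `|u x| `^ p)%R * mu setT)%E).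
    by rewrite lte_mul_pinfty// ?itg_ge0// ge0_fin_numE ?itg_ge0.
  exact: (itg_snd _ _ mup).
pose D := (del `^ beta)^-1.
have D0 : 0 <= D by rewrite invr_ge0 powR_ge0.
pose C := M + M * M + D + 1.
have C0 : 0 <= C by rewrite !addr_ge0 ?mulr_ge0 ?(ltW M0).
have iC : power_integrable mu2 p (fun z => C * ((energy u z + `|u z.1|) + (`|u z.2| + 1))).
  apply: power_integrableZ => //; first by move=> z; rewrite !addr_ge0.
  apply: (power_integrableD p0).
  - by move=> z; rewrite addr_ge0.
  - by move=> z; rewrite addr_ge0.
  - exact: power_integrableD.
  - by apply: power_integrableD => //; exact: power_integrable_cst.
apply: (power_integrableS p0 _ _ _ iC).
- exact: measurable_growth_density.
- by move=> z; exact: le_trans (growth_density_ge1 _ _ _ _).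
move=> z; rewrite /growth_density.
have q : `|u z.1 - u z.2| / enorm (z.1 - z.2) `^ beta <=
    M * (energy u z + M) + D * (`|u z.1| + `|u z.2|).
  have [zd|zd] := ltP (enorm (z.1 - z.2)) del.
    by apply: (le_trans (quot_near _ zd)); rewrite lerDl mulr_ge0// addr_ge0.
  apply: (@le_trans _ _ (D * (`|u z.1| + `|u z.2|))); last first.
    by rewrite lerDr mulr_ge0 ?addr_ge0 ?(ltW M0).
  rewrite mulrC ler_pM ?invr_ge0 ?powR_ge0//; last exact: ler_normB.
  rewrite lef_pV2 ?posrE ?powR_gt0//; last exact: lt_le_trans zd.
  by apply: ge0_ler_powR => //; rewrite nnegrE ?enorm_ge0// ltW.
have := E0 z; have := normr_ge0 (u z.1); have := normr_ge0 (u z.2).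
move=> c0 a0 E1; apply: (le_trans (lerD (lerD (lerD q (lexx _)) (lexx _)) (lexx _))).
exact: growth_sum_bound (ltW M0) D0 E1 a0 c0.
Qed.

Let K : R := smoothing_growth_const n beta `^ p * (2 ^+ n * 2 ^+ n).

Lemma energy_approximation (e : R) : 0 < e ->
  exists v : 'rV[R]_n -> R, [/\ sq_integrable mu v, norm2 mu (fun x => v x - u x) <= e,
    (exists B, forall z, energy v z <= B) &
    (itg mu2 (fun z => energy v z `^ p)%R <= itg mu2 (fun z => energy u z `^ p)%R + e%:E)%E].
Proof.
move=> e0.
have mu2oo := finite_product_lty mu mu.
have [mu_ _] := L2u.
have K0 : 0 <= K by rewrite mulr_ge0 ?powR_ge0// mulr_ge0// exprn_ge0.
have [mD iD] := growth_density_power_integrable.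
have choose_eps (m : nat) : exists eps : R, 0 < eps /\
    norm2 mu (fun x => smoothing mu b eps u x - u x) <= 2^-1 ^+ m.
  by apply: smoothing_dense => //; rewrite exprn_gt0// invr_gt0.
have [eps Heps] := choice choose_eps.
pose v m := smoothing mu b (eps m) u.
have eps0 m : 0 < eps m by have [] := Heps m.
have v_near m : norm2 mu (fun x => v m x - u x) <= 2^-1 ^+ m by have [] := Heps m.
have L2v m : sq_integrable mu (v m) by exact: smoothing_sq_integrable.
have L2vu m : sq_integrable mu (fun x => v m x - u x) by exact: sq_integrableB.
have v_u : {ae mu, forall x, v m x @[m --> \oo] --> u x}.
  have : {ae mu, forall x, cvgn (series (fun m => `|v m x - u x|))}.
    apply: (@ae_cvgn_series _ _ _ _ _ (2 * norm2 mu (fun=> 1))) => //.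
      by move=> m; apply: measurableT_comp => //; have [] := L2vu m.
    move=> k; apply: (@le_trans _ _ (\sum_(0 <= m < k) (2^-1 ^+ m * norm2 mu (fun=> 1))%:E)%E).
      apply: lee_sum => m _; apply: (le_trans (itg_norm_le (L2vu m))).
      by rewrite lee_fin ler_wpM2r// norm2_ge0.
    rewrite sumEFin lee_fin -mulr_suml ler_wpM2r ?norm2_ge0//.
    have -> : \sum_(0 <= m < k) 2^-1 ^+ m = 2 - 2 * 2^-1 ^+ k :> R.
      elim: k => [|k IH]; first by rewrite big_geq// expr0; lra.
      by rewrite big_nat_recr//= IH exprS; lra.
    by rewrite gerBl mulr_ge0// exprn_ge0// invr_ge0.
  apply: filterS => x /cvg_series_cvg_0 h.
  by apply/subr_cvg0; apply/norm_cvg0P.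
have F0 (w : 'rV[R]_n -> R) z : 0 <= energy w z `^ p by exact: powR_ge0.
have mv m : measurable_fun setT (v m) by have [] := L2v m.
have mF w : measurable_fun setT w -> measurable_fun setT (fun z => energy w z `^ p).
  by move=> mw; apply: mpow; exact: measurable_energy.
have cvgF : {ae mu2, forall z, energy (v m) z `^ p @[m --> \oo] --> energy u z `^ p}.
  apply: filterS2 (ae_product_fst v_u) (ae_product_snd v_u) => z /= v1 v2.
  have c : energy (v m) z @[m --> \oo] --> energy u z.
    exact: (cvg_comp2 v1 v2 (@cg z (u z.1, u z.2))).
  exact: (cvg_powR p1 (fun m => g0 _ _ _) (g0 _ _ _) c).
have tight c : 0 < c -> exists2 B, 0 <= B & forall m, exists S : 'rV[R]_n * 'rV[R]_n -> R,
    [/\ measurable_fun setT S, (forall z, 0 <= S z), (itg mu2 S <= c%:E)%E &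
        {ae mu2, forall z, energy (v m) z `^ p <= B + S z}].
  move=> c0; pose MK := M `^ p * K + 1.
  have MK0 : 0 < MK by rewrite ltr_wpDl// mulr_ge0 ?powR_ge0.
  have cMK : 0 < c / MK by rewrite divr_gt0.
  have [N HN] := itg_tail_small (fun z => powR_ge0 _ _) iD cMK.
  exists (M `^ p * (K * N%:R)); first by rewrite mulr_ge0 ?powR_ge0// mulr_ge0.
  move=> m.
  have [S [mS S0 iS HS]] := smoothing_growth_split (eps0 m) L2u beta0 beta1 p1 iD mub (ler0n _ N).
  exists (fun z => M `^ p * S z); split.
  - exact: measurable_funM.
  - by move=> z; rewrite mulr_ge0 ?powR_ge0.
  - rewrite itgZ ?powR_ge0//.
    apply: (@le_trans _ _ ((M `^ p)%:E * (K%:E * (c / MK)%:E))%E).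
      apply: lee_wpmul2l; rewrite ?lee_fin ?powR_ge0//.
      by apply: (le_trans iS); apply: lee_wpmul2l; rewrite ?lee_fin.
    rewrite -!EFinM lee_fin mulrA mulrA ler_pdivrMr// mulrC ler_pM2l//.
    by rewrite /MK lerDl.
  - apply: filterS HS => z Hz; rewrite -mulrDr.
    apply: (@le_trans _ _ ((M * growth_density beta z (v m z.1) (v m z.2)) `^ p)).
      apply: ge0_ler_powR; rewrite ?nnegrE ?p0 ?g0//; last exact: g_upper.
      exact: le_trans (g0 _ _ _) (g_upper _ _ _).
    rewrite powRM ?(ltW M0)//; last exact: le_trans (growth_density_ge1 _ _ _ _).
    by apply: ler_wpM2l => //; exact: powR_ge0.
have ev := vitali_limsup mu2oo (fun m => mF _ (mv m)) (mF _ mu_) (fun m => F0 (v m)) (F0 u) cvgF tight e0.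
have ev2 : \forall m \near \oo, (2^-1 : R) ^+ m <= e.
  have : (2^-1 : R) ^+ m @[m --> \oo] --> 0.
    by apply: cvg_expr; rewrite ger0_norm ?invr_ge0//; lra.
  move/cvgrPdist_le => /(_ _ e0); apply: filterS => m.
  by rewrite sub0r normrN; apply: le_trans; exact: ler_norm.
have [m [Hm1 Hm2]] := filter_ex (filterI ev ev2).
exists (v m); split => //.
- exact: le_trans (v_near m) Hm2.
- have [B vB] := smoothing_bounded mu b (eps m) u.
  have Lv := smoothing_lipschitz mu b (eps0 m) u.
  have [C HC] := growth_density_lipschitz_bounded beta0 beta1 Lv vB.
  exists (M * C) => z; apply: (le_trans (g_upper _ _ _)).
  by apply: ler_wpM2l; [exact: ltW|exact: HC].
Qed.

End recovery.

(** Simple functions below [F] may be cut off on the null set, where they then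
    lie below [G]: no measurability of [F] and [G] is involved. *)
Lemma le_integral_off_null d (T : measurableType d) (R : realType)
    (mu : {measure set T -> \bar R}) (D N : set T) (F G : T -> \bar R) :
  (forall x, D x -> 0 <= F x)%E -> (forall x, D x -> 0 <= G x)%E ->
  measurable N -> mu N = 0%E -> (forall x, D x -> ~ N x -> F x <= G x)%E ->
  (\int[mu]_(x in D) F x <= \int[mu]_(x in D) G x)%E.
Proof.
move=> F0 G0 mN N0 FG; rewrite !ge0_integralE//.
apply: ge_ereal_sup => _ [h /= hF <-].
pose h' := proj_nnsfun h (measurableC mN).
have h'E x : h' x = h x * \1_(~` N) x by [].
have -> : sintegral mu h = sintegral mu h'.
  rewrite -!integralT_nnsfun; apply: ge0_ae_eq_integral => //.
  - by apply/measurable_EFinP; exact: measurable_funPT.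
  - by apply/measurable_EFinP; exact: measurable_funPT.
  - by move=> x _; rewrite lee_fin fun_ge0.
  - by move=> x _; rewrite lee_fin fun_ge0.
  - exists N; split => // x /= hx; apply: contrapT => Nx; apply: hx => _.
    congr EFin; apply/esym; apply: (etrans (h'E x)).
    by rewrite indicE mem_set// mulr1.
apply: ereal_sup_ubound; exists h' => //= x.
apply: (@le_trans _ _ (h x * \1_(~` N) x)%:E); first by rewrite lee_fin -h'E.
rewrite indicE; have [Nx|Nx] := pselect (N x).
  rewrite memNset; last by move=> /(_ Nx).
  by rewrite mulr0 patchE; case: ifPn => // /set_mem /G0.
rewrite mem_set// mulr1; apply: (le_trans (hF x)).
by rewrite !patchE; case: ifPn => // /set_mem Dx; exact: FG.
Qed.

Lemma eq_integral_off_null d (T : measurableType d) (R : realType)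
    (mu : {measure set T -> \bar R}) (D N : set T) (F G : T -> \bar R) :
  (forall x, D x -> 0 <= F x)%E -> (forall x, D x -> 0 <= G x)%E ->
  measurable N -> mu N = 0%E -> (forall x, D x -> ~ N x -> F x = G x) ->
  (\int[mu]_(x in D) F x = \int[mu]_(x in D) G x)%E.
Proof.
by move=> F0 G0 mN N0 FG; apply/eqP; rewrite eq_le; apply/andP; split;
  apply: (le_integral_off_null _ _ mN N0) => // x Dx Nx; rewrite FG.
Qed.

(** * Lebesgue measure of a bounded domain *)

Lemma lebesgue_measure_rV_ball (R : realType) (n : nat) (x : 'rV[R]_n) (e : R) : 0 < e ->
  (lebesgue_measure_rV R n (ball x e) = ((2 * e) ^+ n)%:E)%E.
Proof.
move=> e0; elim: n x => [|n IH] x.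
  by rewrite expr0 /= diracE mem_set// ball_rVE// => -[].
have E : ball x e = @uncons_rV R n @^-1`
    (ball (x ord0 ord0) e `*` ball (\row_j x ord0 (lift ord0 j)) e).
  apply/seteqP; split=> y; rewrite /preimage /= !ball_rVE//.
    by move=> xy; split => /=; [exact: xy|move=> i _ /=; rewrite !mxE; exact: xy].
  move=> [/= xy0 xy] i _ /=; have [j ->|->] := unliftP ord0 i; last exact: xy0.
  by have := xy j Logic.I; rewrite /= !mxE.
have mB : measurable (ball (\row_j x ord0 (lift ord0 j)) e : set 'rV[R]_n).
  by apply: open_measurable_rV; exact: ball_open.
have mb : measurable (ball (x ord0 ord0) e) by exact: measurable_ball.
rewrite E; transitivity (lebesgue_measure (ball (x ord0 ord0) e) *
    lebesgue_measure_rV R n (ball (\row_j x ord0 (lift ord0 j)) e))%E.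
  exact: (cons_measureX (lebesgue_measure_rV R n) mb mB).
by rewrite IH lebesgue_measure_ball ?ltW// -EFinM exprS mulr_natl.
Qed.

Section domain_measure.
Context {R : realType} {n : nat} (Omega : bounded_lipschitz_domain R n).

Lemma domain_in_ball : exists2 b : R, 0 < b & (Omega : set _) `<=` ball (0 : 'rV[R]_n) b.
Proof.
have [B [_ HB]] := domain_bounded Omega.
exists (`|B| + 2) => [|x Ox]; first by rewrite ltr_wpDl.
rewrite -ball_normE /= sub0r normrN.
have /HB /(_ x Ox) : B < `|B| + 1 by rewrite (le_lt_trans (ler_norm B))// ltrDl.
by move/le_lt_trans; apply; rewrite ltrD2l; lra.
Qed.

Let mO := measurable_domain Omega.

Lemma leb_domain_lty : (leb R n Omega < +oo)%E.
Proof.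
have [b b0 Ob] := domain_in_ball.
apply: (@le_lt_trans _ _ (leb R n (ball (0 : 'rV[R]_n) b))).
  apply: le_measure; rewrite ?inE//.
  by apply: open_measurable_rV; exact: ball_open.
by rewrite /leb lebesgue_measure_rV_ball// ltry.
Qed.

Lemma leb_domain_gt0 : (0 < leb R n Omega)%E.
Proof.
have [x Ox] := domain_nonempty Omega.
have /nbhs_ballP[e /= e0 eO] : nbhs x (Omega : set _).
  by apply: open_nbhs_nbhs; split => //; exact: domain_open.
apply: (@lt_le_trans _ _ (leb R n (ball x e))).
  by rewrite /leb lebesgue_measure_rV_ball// lte_fin exprn_gt0// mulr_gt0.
apply: le_measure; rewrite ?inE//.
by apply: open_measurable_rV; exact: ball_open.
Qed.

Let leb_on_fin : fin_num_fun (leb_on Omega).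
Proof.
move=> A mA; rewrite ge0_fin_numE//; apply: le_lt_trans leb_domain_lty.
by apply: le_measure; rewrite ?inE//; exact: measurableI.
Qed.

Definition domain_measure : {finite_measure set 'rV[R]_n -> \bar R} :=
  HB.pack (leb_on Omega : set 'rV[R]_n -> \bar R) (Measure.class (leb_on Omega))
    (Measure_isFinite.Build _ _ _ (leb_on Omega) leb_on_fin).

Local Notation mu := domain_measure.
Local Notation mu2 := (mu \x mu)%E.
Let D2 : set ('rV[R]_n * 'rV[R]_n) := Omega `*` Omega.

Let mD2 : measurable D2. Proof. exact: measurableX. Qed.

Lemma domain_measure_bounded : exists b : R, {ae mu, forall x, `|x| <= b}.
Proof.
have [b b0 Ob] := domain_in_ball; exists b.
exists (~` (Omega : set _)); split; first exact: measurableC.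
  by rewrite /= /mrestr setICl measure0.
move=> x /= xb Ox; apply: xb.
by have := Ob _ Ox; rewrite -ball_normE /= sub0r normrN => /ltW.
Qed.

Lemma domain_measure2E A : measurable A -> mu2 A = leb2_on Omega A.
Proof.
move=> mA; apply: (product_measure_unique (m' := leb2_on Omega)) => // X Y mX mY.
rewrite /leb2_on /= /mrestr.
rewrite (_ : _ `&` _ = (X `&` Omega) `*` (Y `&` Omega)); last first.
  by apply/seteqP; split=> -[x y] /=; tauto.
by apply: product_measure1E; exact: measurableI.
Qed.

Lemma ae_domain_measure2 (P : 'rV[R]_n * 'rV[R]_n -> Prop) :
  {ae leb2_on Omega, forall z, P z} <-> {ae mu2, forall z, P z}.
Proof.
split=> -[A [mA A0 PA]]; exists A; split => //.
  by apply: etrans A0; exact: domain_measure2E.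
by apply: etrans A0; apply/esym; exact: domain_measure2E.
Qed.

Lemma domain_measure2T : mu2 setT = leb2 R n D2.
Proof.
apply: (etrans (domain_measure2E measurableT)).
by rewrite /leb2_on /= /mrestr setTI.
Qed.

Lemma leb2_domain : exists2 m : R, 0 < m & leb2 R n D2 = m%:E.
Proof.
exists (fine (leb2 R n D2)).
  have E : leb2 R n D2 = (leb R n Omega * leb R n Omega)%E by exact: product_measure1E.
  rewrite E fine_gt0// mule_gt0 ?leb_domain_gt0//= lte_mul_pinfty ?leb_domain_lty//.
  by rewrite ge0_fin_numE ?leb_domain_lty.
rewrite fineK// -domain_measure2T ge0_fin_numE//; exact: finite_product_lty.
Qed.

Lemma integral_domain2 (g : 'rV[R]_n * 'rV[R]_n -> R) :
  measurable_fun setT g -> (forall z, 0 <= g z) ->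
  (\int[leb2 R n]_(z in D2) (g z)%:E = itg mu2 g)%E.
Proof.
move=> mg g0.
rewrite (eq_measure_integral mu2); last first.
  move=> A mA AD; apply/esym; apply: (etrans (domain_measure2E mA)).
  by rewrite /leb2_on /= /mrestr setIidl.
rewrite /itg [RHS](ge0_negligible_integral (N := ~` D2))//.
- by rewrite setTD setCK.
- exact: measurableC.
- exact/measurable_EFinP.
- by move=> z _; rewrite lee_fin.
- apply: (etrans (domain_measure2E (measurableC mD2))).
  by rewrite /leb2_on /= /mrestr setICl measure0.
Qed.

Lemma domain_measureE : (domain_measure : {measure set 'rV[R]_n -> \bar R}) = leb_on Omega.
Proof. by []. Qed.

End domain_measure.

(** * Replacing the integrand by a Borel one *)

Lemma ae_countable d (T : measurableType d) (R : realType) (mu : {measure set T -> \bar R})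
    (I : countType) (P : I -> T -> Prop) :
  (forall i, {ae mu, forall x, P i x}) -> {ae mu, forall x, forall i, P i x}.
Proof.
move=> H; have : {ae mu, forall x, forall k, if unpickle k is Some i then P i x else True}.
  apply: ae_foralln => k; case: (unpickle k) => [i|]; first exact: H.
  by apply: aeW.
by apply: filterS => x Hx i; have := Hx (pickle i); rewrite pickleK.
Qed.

Lemma ratr_floor_mul (R : realType) (k : nat) (t : R) :
  exists q : rat, floor_mul (k.+1%:R^-1) t = ratr q.
Proof.
exists (k.+1%:R^-1 * (Num.floor (t / k.+1%:R^-1))%:~R).
by rewrite /floor_mul rmorphM /= fmorphV rmorph_nat rmorph_int.
Qed.

Lemma le_continuous_rat (R : realType) (F G : R -> R -> R) :
  continuous (fun w : R * R => F w.1 w.2) -> continuous (fun w : R * R => G w.1 w.2) ->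
  (forall a b : rat, F (ratr a) (ratr b) <= G (ratr a) (ratr b)) ->
  forall xi zeta, F xi zeta <= G xi zeta.
Proof.
move=> cF cG FG xi zeta.
have ca := @floor_mul_cvg _ xi; have cb := @floor_mul_cvg _ zeta.
have cvg_floor (H : R -> R -> R) : continuous (fun w : R * R => H w.1 w.2) ->
    H (floor_mul (k.+1%:R^-1) xi) (floor_mul (k.+1%:R^-1) zeta) @[k --> \oo] --> H xi zeta.
  by move=> cH; exact: (cvg_comp2 ca cb (cH (xi, zeta))).
apply: (ler_cvg_to (cvg_floor _ cF) (cvg_floor _ cG)); apply: nearW => k /=.
have [a ->] := ratr_floor_mul k xi; have [b ->] := ratr_floor_mul k zeta.
exact: FG.
Qed.

Lemma convex_function_on_line (R : realType) (phi : R -> R) :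
  @convex_function R R^o setT phi -> convex_on_line phi.
Proof.
move=> cphi t a b t0 t1; have := cphi (Itv01 t0 t1) a b.
by rewrite !inE => /(_ Logic.I Logic.I).
Qed.

Section growth_bounds.
Context {R : realType} {n : nat}.

(** What the proof uses of an integrand; in contrast with the assumptions on the
    given one, everything holds at every point of the product space. *)
Record regular_integrand (g : 'rV[R]_n * 'rV[R]_n -> R -> R -> R) (M del beta : R) : Prop :=
  RegularIntegrand {
    regular_M : 0 < M ;
    regular_del : 0 < del ;
    regular_beta0 : 0 <= beta ;
    regular_beta1 : beta <= 1 ;
    regular_measurable : forall xi zeta, measurable_fun setT (fun z => g z xi zeta) ;
    regular_continuous : forall z, continuous (fun w : R * R => g z w.1 w.2) ;
    regular_ge0 : forall z xi zeta, 0 <= g z xi zeta ;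
    regular_convex_fst : forall z zeta, convex_on_line (fun xi => g z xi zeta) ;
    regular_convex_snd : forall z xi, convex_on_line (g z xi) ;
    regular_upper : forall z xi zeta, g z xi zeta <= M * growth_density beta z xi zeta ;
    regular_lower : forall (z : 'rV[R]_n * 'rV[R]_n) xi zeta, enorm (z.1 - z.2) < del ->
      M^-1 * (`|xi - zeta| / enorm (z.1 - z.2) `^ beta) - M <= g z xi zeta }.

Definition quotient_integrand (M beta : R) (z : 'rV[R]_n * 'rV[R]_n) (xi zeta : R) : R :=
  M^-1 * (`|xi - zeta| / enorm (z.1 - z.2) `^ beta).

Lemma measurable_quotient_integrand M beta xi zeta :
  measurable_fun setT (fun z => quotient_integrand M beta z xi zeta).
Proof.
apply: measurable_funM => //; apply: measurable_funM => //.
under eq_fun do rewrite -powRN.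
exact: (measurableT_comp (measurable_powR _) (@measurable_enorm_sub R n)).
Qed.

Lemma continuous_quotient_integrand M beta z :
  continuous (fun w : R * R => quotient_integrand M beta z w.1 w.2).
Proof.
move=> w; rewrite /quotient_integrand; apply: cvgMr; apply: cvgMl.
by apply: cvg_norm; apply: cvgB; [exact: cvg_fst|exact: cvg_snd].
Qed.

Lemma continuous_growth_density beta (z : 'rV[R]_n * 'rV[R]_n) :
  continuous (fun w : R * R => growth_density beta z w.1 w.2).
Proof.
move=> w; rewrite /growth_density; apply: cvgD; last exact: cvg_cst.
apply: cvgD; last by apply: cvg_norm; exact: cvg_snd.
apply: cvgD; last by apply: cvg_norm; exact: cvg_fst.
apply: cvgMl; by apply: cvg_norm; apply: cvgB; [exact: cvg_fst|exact: cvg_snd].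
Qed.

Let norm_convex (t x y : R) : 0 <= t -> t <= 1 ->
  `|t * x + (1 - t) * y| <= t * `|x| + (1 - t) * `|y|.
Proof.
move=> t0 t1; apply: (le_trans (ler_normD _ _)).
have t1' : 0 <= 1 - t by rewrite subr_ge0.
by rewrite !normrM (ger0_norm t0) (ger0_norm t1').
Qed.

Let quotient_convex M beta (z : 'rV[R]_n * 'rV[R]_n) (phi : R -> R) : 0 < M ->
  (forall t a b, 0 <= t -> t <= 1 -> `|phi (t * a + (1 - t) * b)| <= t * `|phi a| + (1 - t) * `|phi b|) ->
  convex_on_line (fun x => M^-1 * (`|phi x| / enorm (z.1 - z.2) `^ beta)).
Proof.
move=> M0 H t a b t0 t1.
have q0 : 0 <= M^-1 * (enorm (z.1 - z.2) `^ beta)^-1.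
  by rewrite mulr_ge0// invr_ge0 ?powR_ge0// ltW.
have := ler_wpM2r q0 (H t a b t0 t1).
set q := (_ `^ _)^-1; move=> h.
rewrite (_ : M^-1 * _ = `|phi (t * a + (1 - t) * b)| * (M^-1 * q)); last by ring.
apply: (le_trans h); rewrite le_eqVlt; apply/orP; left; apply/eqP; ring.
Qed.

Lemma convex_quotient_integrand M beta z : 0 < M ->
  (forall zeta, convex_on_line (fun xi => quotient_integrand M beta z xi zeta)) /\
  (forall xi, convex_on_line (quotient_integrand M beta z xi)).
Proof.
move=> M0; split=> c.
  apply: (@quotient_convex M beta z (fun x => x - c)) => // t a b t0 t1.
  apply: le_trans (norm_convex _ _ t0 t1).
  by rewrite le_eqVlt; apply/orP; left; apply/eqP; congr `|_|; ring.
apply: (@quotient_convex M beta z (fun x => c - x)) => // t a b t0 t1.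
apply: le_trans (norm_convex _ _ t0 t1).
by rewrite le_eqVlt; apply/orP; left; apply/eqP; congr `|_|; ring.
Qed.

End growth_bounds.

Section regularization.
Context {R : realType} {n : nat} (Omega : bounded_lipschitz_domain R n).
Variable f : 'rV[R]_n -> 'rV[R]_n -> R -> R -> R.
Let D2 : set ('rV[R]_n * 'rV[R]_n) := Omega `*` Omega.
Local Notation leb2 := (leb2 R n).
Hypothesis f_ge0 : forall x y, domain_set Omega x -> domain_set Omega y ->
  forall xi zeta, 0 <= f x y xi zeta.
Hypothesis f_caratheodory : caratheodory Omega f.
Hypothesis f_growth : growth Omega f.
Hypothesis f_convex : separately_convex Omega f.

Let mD2 : measurable D2.
Proof. by apply: measurableX; exact: measurable_domain. Qed.

(* one null set outside of which the level sets of [f] at rational arguments and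
   levels are traces of Borel sets *)
Let borel_levels : exists A : rat * rat * rat -> set ('rV[R]_n * 'rV[R]_n),
  (forall q, measurable (A q)) /\
  {ae leb2, forall z, forall q, D2 z ->
    (A q z <-> ratr q.2 < f z.1 z.2 (ratr q.1.1) (ratr q.1.2))}.
Proof.
have level (q : rat * rat * rat) : exists A, measurable A /\
    {ae leb2, forall z, D2 z -> (A z <-> ratr q.2 < f z.1 z.2 (ratr q.1.1) (ratr q.1.2))}.
  have [A mA [N [B [mB B0 NB]] E]] := f_caratheodory.1 (ratr q.1.1) (ratr q.1.2)
     [set t : R | ratr q.2 < t] (open_measurable (@open_gt R (ratr q.2))).
  exists A; split => //; exists B; split => // z /= /not_implyP[D2z Az].
  apply: NB; apply: contrapT => Nz; apply: Az.
  have Ez : (A `|` N) z <-> (D2 z /\ ratr q.2 < f z.1 z.2 (ratr q.1.1) (ratr q.1.2)).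
    by rewrite E.
  split=> [Az|fz]; first by have [_] := Ez.1 (or_introl Az).
  by have [//|/Nz] := Ez.2 (conj D2z fz).
have [A HA] := choice level.
exists A; split; first by move=> q; have [] := HA q.
by apply: ae_countable => q; have [] := HA q.
Qed.

Lemma regular_integrand_exists : exists g M del beta,
  regular_integrand g M del beta /\
  {ae leb2, forall z, D2 z -> forall xi zeta, g z xi zeta = f z.1 z.2 xi zeta}.
Proof.
have [M0 [del [beta [M00 del0 /andP[beta0 beta1] up low]]]] := f_growth.
pose M := Num.max M0 1.
have M0M : M0 <= M by rewrite le_max lexx.
have M1 : 1 <= M by rewrite le_max lexx orbT.
have Mpos : 0 < M by exact: lt_le_trans M1.
have [_ f_cont] := f_caratheodory.
have [A [mA HA]] := borel_levels.
have up' : {ae leb2, forall z, forall q : rat * rat, D2 z ->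
    f z.1 z.2 (ratr q.1) (ratr q.2) <= M0 * growth_density beta z (ratr q.1) (ratr q.2)}.
  by apply: ae_countable => q; exact: up.
have low' : {ae leb2, forall z, forall q : rat * rat, D2 z -> enorm (z.1 - z.2) < del ->
    quotient_integrand M0 beta z (ratr q.1) (ratr q.2) <= f z.1 z.2 (ratr q.1) (ratr q.2) + M0}.
  apply: ae_countable => q; apply: filterS (low (ratr q.1) (ratr q.2)) => z H D2z zd.
  by rewrite -lerBlDr; exact: H.
pose good z := D2 z ->
  [/\ (forall q, A q z <-> ratr q.2 < f z.1 z.2 (ratr q.1.1) (ratr q.1.2)),
      continuous (fun w : R * R => f z.1 z.2 w.1 w.2),
      (forall zeta, convex_on_line (fun xi => f z.1 z.2 xi zeta)) /\
      (forall xi, convex_on_line (f z.1 z.2 xi)),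
      (forall xi zeta, f z.1 z.2 xi zeta <= M * growth_density beta z xi zeta) &
      (enorm (z.1 - z.2) < del -> forall xi zeta,
         quotient_integrand M beta z xi zeta - M <= f z.1 z.2 xi zeta)].
have ae_good : {ae leb2, forall z, good z}.
  apply: filterS2 (filterI HA f_cont) (filterI f_convex (filterI up' low')).
  move=> z [/= H1 H2] [/= H3 [/= H4 H5]] D2z.
  have cf := H2 D2z; have [c1 c2] := H3 D2z.
  split => //.
  - by move=> q; exact: H1.
  - by split=> c; apply: convex_function_on_line.
  - move=> xi zeta; apply: (@le_trans _ _ (M0 * growth_density beta z xi zeta)); last first.
      by rewrite ler_wpM2r// (le_trans _ (growth_density_ge1 _ _ _ _)).
    apply: (le_continuous_rat (F := f z.1 z.2) (G := fun xi zeta => M0 * growth_density beta z xi zeta) cf).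
      by move=> w; apply: cvgMr; exact: continuous_growth_density.
    by move=> a b; exact: (H4 (a, b)).
  - move=> zd xi zeta; rewrite lerBlDr.
    apply: (@le_trans _ _ (f z.1 z.2 xi zeta + M0)); last by rewrite lerD2l.
    apply: (@le_trans _ _ (quotient_integrand M0 beta z xi zeta)).
      rewrite ler_wpM2r ?divr_ge0 ?powR_ge0// lef_pV2 ?posrE//.
    apply: (le_continuous_rat (F := fun xi zeta => quotient_integrand M0 beta z xi zeta)
      (G := fun xi zeta => f z.1 z.2 xi zeta + M0)).
    + exact: continuous_quotient_integrand.
    + by move=> w; apply: cvgD; [exact: cf|exact: cvg_cst].
    + by move=> a b; exact: (H5 (a, b)).
have [Z [mZ Z0 HZ]] := ae_good.
pose D := D2 `\` Z.
have mD : measurable D by exact: measurableD.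
have goodD z : D z -> D2 z /\ good z.
  by move=> [D2z Zz]; split => //; apply: contrapT => /HZ.
pose g z : R -> R -> R := if z \in D then f z.1 z.2 else quotient_integrand M beta z.
have cg z : continuous (fun w : R * R => g z w.1 w.2).
  rewrite /g; case: ifPn => [/set_mem /goodD[D2z /(_ D2z)[]]//|_].
  exact: continuous_quotient_integrand.
have mg_rat (a b : rat) : measurable_fun setT (fun z => g z (ratr a) (ratr b)).
  apply: (measurability _ (RGenOInfty.measurableE R)) => // _ [_ [r ->] <-]; rewrite setTI.
  rewrite (_ : _ @^-1` _ = (D `&` \bigcup_(c in [set c : rat | r <= ratr c]) A (a, b, c)) `|`
     (~` D `&` (fun z => quotient_integrand M beta z (ratr a) (ratr b)) @^-1` `]r, +oo[)).
    apply: measurableU; apply: measurableI => //.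
    - rewrite bigcup_mkcond; apply: countable_bigcupT_measurable => // c.
      by case: ifP.
    - exact: measurableC.
    - by rewrite -[X in measurable X]setTI; exact: measurable_quotient_integrand.
  apply/seteqP; split=> z; rewrite /preimage /= in_itv/= andbT /g.
    case: ifPn => [/set_mem Dz|/negP Dz] rz; last first.
      by right; split; [move=> Dz'; apply: Dz; exact: mem_set|rewrite in_itv/= andbT].
    left; split => //; have [D2z /(_ D2z)[HAz _ _ _ _]] := goodD _ Dz.
    have [c] := rat_in_itvoo rz; rewrite in_itv/= => /andP[rc cz].
    by exists c; [exact: ltW|apply/(HAz (a, b, c))].
  case=> [[Dz [c /= rc Az]]|[Dz]].
    rewrite mem_set//; have [D2z /(_ D2z)[HAz _ _ _ _]] := goodD _ Dz.
    by rewrite in_itv/= andbT; apply: (le_lt_trans rc); apply/(HAz (a, b, c)).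
  by move=> h; case: ifPn => [/set_mem/Dz|_]; rewrite ?in_itv/= ?andbT.
exists g, M, del, beta; split; last first.
  exists Z; split => // z /= /not_implyP[D2z zg]; apply: contrapT => Zz; apply: zg => xi zeta.
  by rewrite /g mem_set.
have density0 z xi zeta : 0 <= growth_density beta z xi zeta :> R.
  by rewrite (le_trans _ (growth_density_ge1 _ _ _ _)).
have q0 z xi zeta : 0 <= quotient_integrand M beta z xi zeta.
  by rewrite mulr_ge0 ?invr_ge0 ?(ltW Mpos)// divr_ge0 ?powR_ge0.
split => //.
- move=> xi zeta; apply: (measurable_fun_cvg (h := fun k z =>
    g z (floor_mul (k.+1%:R^-1) xi) (floor_mul (k.+1%:R^-1) zeta))).
    move=> k; have [a ->] := ratr_floor_mul k xi; have [b ->] := ratr_floor_mul k zeta.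
    exact: mg_rat.
  move=> z _; have ca := @floor_mul_cvg _ xi; have cb := @floor_mul_cvg _ zeta.
  exact: (cvg_comp2 ca cb (@cg z (xi, zeta))).
- move=> z xi zeta; rewrite /g; case: ifPn => // /set_mem [[D1z D2z] _].
  exact: f_ge0.
- move=> z zeta; rewrite /g; case: ifPn => [/set_mem /goodD[D2z /(_ D2z)[_ _ [+ _]]]|_]; first exact.
  exact: (convex_quotient_integrand beta z Mpos).1.
- move=> z xi; rewrite /g; case: ifPn => [/set_mem /goodD[D2z /(_ D2z)[_ _ [_ +]]]|_]; first exact.
  exact: (convex_quotient_integrand beta z Mpos).2.
- move=> z xi zeta; rewrite /g; case: ifPn => [/set_mem /goodD[D2z /(_ D2z)[_ _ _ +]]|_]; first exact.
  have [_ _ h] := le_growth_density beta z xi zeta.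
  rewrite /quotient_integrand; apply: (@le_trans _ _ (1 * growth_density beta z xi zeta)).
    apply: ler_pM => //; rewrite ?invr_ge0 ?(ltW Mpos) ?divr_ge0 ?powR_ge0//.
    by rewrite invf_le1.
  by rewrite ler_wpM2r.
- move=> z xi zeta zd; rewrite /g.
  case: ifPn => [/set_mem /goodD[D2z /(_ D2z)[_ _ _ _ /(_ zd)]]|_]; first exact.
  by rewrite /quotient_integrand gerBl ltW.
Qed.

End regularization.

(** * Elements of L2 and their representatives *)

Section lspace.
Context d (T : measurableType d) {R : realType}.
Variable mu : {measure set T -> \bar R}.

Lemma Lnorm2E (w : T -> R) : sq_integrable mu w ->
  ('N[mu]_2[EFin \o w] = (norm2 mu w)%:E)%E.
Proof.
move=> L2w; have w2 : (2 : R) != 0 by [].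
have E : ((('N[mu]_2[EFin \o w]) `^ 2) = (norm2 mu w ^+ 2)%:E)%E.
  rewrite (@powR_Lnorm _ _ _ _ _ 2)// -itg_sqr//; apply: eq_integral => x _ /=.
  by rewrite powR_mulrn// real_normK// num_real.
have N0 : (0 <= 'N[mu]_2[EFin \o w])%E by exact: Lnorm_ge0.
move: E N0; case: ('N[mu]_2[EFin \o w])%E => [r| |] //=.
- rewrite lee_fin => E r0; have := EFin_inj E; rewrite powR_mulrn// => {}E.
  by congr EFin; apply/eqP; rewrite -(@eqrXn2 _ 2 _ _ _ r0 (norm2_ge0 _ _))// E.
- by rewrite (negPf w2).
Qed.

Lemma lspace_sq_integrable (u : LspaceType2 mu) : sq_integrable mu u.
Proof.
apply: sq_integrableP; first exact: (@measurable_funPT _ _ _ _ (repr (u : {mfun_ mu, T >-> measurableTypeR R}))).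
have := @Lebesgue_finite _ _ _ mu _ _ u; rewrite /finite_norm => fin.
have -> : itg mu (fun x => u x ^+ 2)%R = ('N[mu]_2[EFin \o u] `^ 2)%E.
  rewrite (@powR_Lnorm _ _ _ _ _ 2)//; apply: eq_integral => x _ /=.
  by rewrite powR_mulrn// real_normK// num_real.
exact: poweR_lty.
Qed.

Lemma lspace_of_sq_integrable (w : T -> R) : sq_integrable mu w ->
  exists u : LspaceType2 mu, {ae mu, forall x, u x = w x}.
Proof.
move=> L2w; have [mw _] := L2w.
have mw' : @measurable_fun _ _ T (measurableTypeR R) setT w by exact: mw.
pose F : {mfun T >-> measurableTypeR R} :=
  HB.pack (w : T -> measurableTypeR R) (isMeasurableFun.Build _ _ _ _ _ mw').
pose u0 : {mfun_ mu, T >-> measurableTypeR R} := \pi%qT F.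
have u0w : {ae mu, forall x, u0 x = w x}.
  have /eqmodP/asboolP E : (repr u0 = F %[mod {mfun_ mu, T >-> measurableTypeR R}])%qT by exact: reprK.
  by apply: filterS E => x; apply.
have fin : finite_norm mu 2 u0.
  have mu0 : measurable_fun setT (u0 : T -> R).
    exact: (@measurable_funPT _ _ _ _ (repr u0)).
  have L2u0 : sq_integrable mu u0.
    apply: sq_integrableP => //.
    apply: (@le_lt_trans _ _ (itg mu (fun x => w x ^+ 2)%R)).
      apply: ae_le_itg => //; try by move=> x; exact: sqr_ge0.
      - exact: measurable_funX.
      - exact: measurable_funX.
      - by apply: filterS u0w => x ->.
    by rewrite itg_sqr// ltry.
  by rewrite /finite_norm Lnorm2E// ltry.
pose U : LspaceType2 mu := HB.pack_for (LspaceType mu (lee1n 2)) u0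
  (isFinLebesgue.Build _ _ _ mu 2%E (lee1n 2) u0 fin).
exists U.
exact: u0w.
Qed.

End lspace.

(** * The two inequalities for a regular integrand *)

Lemma convex_on_line_powR (R : realType) (phi : R -> R) (q : R) : 1 <= q ->
  (forall x, 0 <= phi x) -> convex_on_line phi -> convex_on_line (fun x => phi x `^ q).
Proof.
move=> q1 phi0 cphi t a b t0 t1.
have t1' : 0 <= 1 - t by rewrite subr_ge0.
apply: (@le_trans _ _ ((t * phi a + (1 - t) * phi b) `^ q)).
  apply: ge0_ler_powR; rewrite ?nnegrE ?addr_ge0 ?mulr_ge0//; last exact: cphi.
  exact: le_trans q1.
have := @convex_powR R q q1 (Itv01 t0 t1) (phi a) (phi b).
by apply; rewrite inE /= in_itv/= andbT.
Qed.

(** If each property holds for all large [k], then an index tending slowly enough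
    to infinity satisfies its own property for all large [k]. *)
Lemma diagonal_choice (P : nat -> nat -> Prop) :
  (forall j, \forall k \near \oo, P j k) ->
  exists jj : nat -> nat, (forall N, \forall k \near \oo, (N <= jj k)%N) /\
    \forall k \near \oo, P (jj k) k.
Proof.
move=> H; have start j : exists K, forall k, (K <= k)%N -> P j k.
  by have [K _ HK] := H j; exists K => k Kk; exact: HK.
have [K HK] := choice start.
pose jj k := \max_(j < k.+1 | (K j <= k)%N) j.
exists jj; split.
  move=> N; exists (maxn N (K N)) => // k /=; rewrite geq_max => /andP[Nk KNk].
  exact: (@leq_bigmax_cond _ (fun j : 'I_k.+1 => (K j <= k)%N) (fun j => j : nat) (Ordinal (n := k.+1) (m := N) Nk)).
exists (K 0%N) => // k /= K0k; apply: HK; rewrite /jj.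
have : (0 < #|[pred j : 'I_k.+1 | (K j <= k)%N]|)%N.
  by apply/card_gt0P; exists ord0.
move/(eq_bigmax_cond (fun j : 'I_k.+1 => j : nat)) => [j jk ->].
exact: jk.
Qed.

Section regular_energy.
Context {R : realType} {n : nat}.
Variable mu : {finite_measure set 'rV[R]_n -> \bar R}.
Local Notation mu2 := (mu \x mu)%E.
Variables (g : 'rV[R]_n * 'rV[R]_n -> R -> R -> R) (M del beta : R).
Hypothesis reg : regular_integrand g M del beta.

Let mg := regular_measurable reg.
Let cg := regular_continuous reg.
Let g0 := regular_ge0 reg.

Definition energy_density (u : 'rV[R]_n -> R) z := g z (u z.1) (u z.2).
Local Notation E := energy_density.

Lemma energy_density_ge0 u z : 0 <= E u z.
Proof. exact: g0. Qed.

Lemma measurable_energy_density u : measurable_fun setT u -> measurable_fun setT (E u).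
Proof.
move=> mu_; apply: measurable_caratheodory => //.
  exact: (measurableT_comp mu_ measurable_fst).
exact: (measurableT_comp mu_ measurable_snd).
Qed.

Lemma measurable_power_energy u q : measurable_fun setT u ->
  measurable_fun setT (fun z => E u z `^ q).
Proof.
move=> mu_; apply: (measurableT_comp (measurable_powR q)).
exact: measurable_energy_density.
Qed.

Lemma eq_energy_density u v : {ae mu, forall x, u x = v x} ->
  {ae mu2, forall z, E u z = E v z}.
Proof.
move=> uv; apply: filterS2 (ae_product_fst uv) (ae_product_snd uv) => z /= h1 h2.
by rewrite /energy_density h1 h2.
Qed.

Lemma eq_power_energy u v q : measurable_fun setT u -> measurable_fun setT v ->
  {ae mu, forall x, u x = v x} ->
  itg mu2 (fun z => E u z `^ q) = itg mu2 (fun z => E v z `^ q).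
Proof.
move=> mu_ mv uv; have Euv := eq_energy_density uv.
have m1 := measurable_power_energy q mu_; have m2 := measurable_power_energy q mv.
by apply/eqP; rewrite eq_le; apply/andP; split; apply: ae_le_itg => //;
  try (by move=> z; exact: powR_ge0); apply: filterS Euv => z ->.
Qed.

(** Away from the diagonal the energy density is bounded on bounded sets of
    values, and it stays separately convex after taking powers. *)
Lemma power_energy_weak_lsc (us : nat -> 'rV[R]_n -> R) (u : 'rV[R]_n -> R) (q C : R) :
  1 <= q -> (forall k, sq_integrable mu (us k)) -> sq_integrable mu u ->
  weakly_cvg mu us u ->
  (forall K, exists2 k, (K <= k)%N & (itg mu2 (fun z => E (us k) z `^ q)%R <= C%:E)%E) ->
  (itg mu2 (fun z => E u z `^ q)%R <= C%:E)%E.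
Proof.
move=> q1 L2us L2u us_u HC.
have q0 : 0 <= q by exact: le_trans q1.
pose D (j : nat) : set ('rV[R]_n * 'rV[R]_n) := [set z | (enorm (z.1 - z.2) `^ beta)^-1 <= j%:R].
have mD j : measurable (D j).
  have mf : measurable_fun setT (fun z : 'rV[R]_n * 'rV[R]_n => enorm (z.1 - z.2) `^ (- beta)).
    exact: (measurableT_comp (measurable_powR _) (@measurable_enorm_sub R n)).
  have := measurable_fun_ler mf (measurable_cst (j%:R : R)).
  move=> /(_ measurableT [set true]) H.
  rewrite (_ : D j = setT `&` (fun z : 'rV[R]_n * 'rV[R]_n => enorm (z.1 - z.2) `^ (- beta) <= j%:R) @^-1` [set true]).
    exact: H.
  by rewrite setTI; apply/seteqP; split=> z; rewrite /D /= powRN.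
apply: (@weak_lower_semicontinuity _ _ _ mu us u L2us L2u us_u
  (fun z xi zeta => g z xi zeta `^ q) D _ _ _ _ _ mD _ _ _ C HC).
- by move=> xi zeta; apply: (measurableT_comp (measurable_powR q)); exact: mg.
- by move=> z w; apply: cvg_powR => //; exact: cg.
- by move=> z xi zeta; exact: powR_ge0.
- by move=> z eta; apply: convex_on_line_powR => //; exact: (regular_convex_fst reg).
- by move=> z xi; apply: convex_on_line_powR => //; exact: (regular_convex_snd reg).
- by move=> i j ij z; rewrite /D /= => /le_trans; apply; rewrite ler_nat.
- move=> z; exists (Num.trunc (enorm (z.1 - z.2) `^ beta)^-1).+1.
  by rewrite /D /= ltW// truncnS_gt.
- move=> j N; exists ((M * ((N + N) * j%:R + N + N + 1)) `^ q) => z Dz xi eta xN eN.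
  have := regular_upper reg z xi eta => up.
  have N0 : 0 <= N by exact: le_trans xN.
  apply: ge0_ler_powR; rewrite ?nnegrE//.
    by rewrite mulr_ge0 ?(ltW (regular_M reg))// !addr_ge0// mulr_ge0// addr_ge0.
  apply: (le_trans up); rewrite ler_wpM2l ?(ltW (regular_M reg))// /growth_density.
  have q2 : `|xi - eta| / enorm (z.1 - z.2) `^ beta <= (N + N) * j%:R.
    rewrite ler_pM ?invr_ge0 ?powR_ge0//.
    by apply: (le_trans (ler_normB _ _)); exact: lerD.
  by rewrite lerD2r; apply: lerD => //; exact: lerD.
Qed.

Variable m : R.
Hypothesis mE : mu2 setT = m%:E.

(** Jensen: the averaged power means of a function increase with the exponent. *)
Lemma power_level_mono (F : 'rV[R]_n * 'rV[R]_n -> R) (q r c : R) :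
  measurable_fun setT F -> (forall z, 0 <= F z) -> 1 <= q -> q <= r -> 0 <= c ->
  (itg mu2 (fun z => F z `^ r)%R <= (m * c `^ r)%:E)%E ->
  (itg mu2 (fun z => F z `^ q)%R <= (m * c `^ q)%:E)%E.
Proof.
move=> mF F0 q1 qr c0 H.
have q0 : q != 0 by rewrite gt_eqF// (lt_le_trans _ q1).
have qpos : 0 < q by exact: lt_le_trans q1.
have rq1 : 1 <= r / q by rewrite ler_pdivlMr// mul1r.
have rE x : x `^ r = (x `^ q) `^ (r / q) by rewrite -powRrM mulrC divfK.
have muoo : (mu2 setT < +oo)%E by exact: finite_product_lty.
have mFq : measurable_fun setT (fun z => F z `^ q).
  exact: (measurableT_comp (measurable_powR q)).
have T x : (mu2 setT * x = m%:E * x)%E by exact: (congr1 (fun t => (t * x)%E) mE).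
have H2 := @power_mean _ _ _ mu2 setT (fun z => F z `^ q) (r / q) (c `^ q)
  measurableT muoo mFq (fun z _ => powR_ge0 _ _) rq1 (powR_ge0 _ _).
rewrite EFinM; apply: (@le_trans _ _ (mu2 setT * (c `^ q)%:E)%E); last first.
  by rewrite le_eqVlt; apply/orP; left; apply/eqP; exact: T.
apply: H2; apply: (@le_trans _ _ (m%:E * ((c `^ q) `^ (r / q))%:E)%E); last first.
  by rewrite le_eqVlt; apply/orP; left; apply/eqP; apply/esym; exact: T.
rewrite -rE -EFinM; apply: le_trans H; rewrite le_eqVlt; apply/orP; left; apply/eqP.
by apply: eq_integral => z _; rewrite -rE.
Qed.

Section liminf.
Variables (us : nat -> 'rV[R]_n -> R) (u : 'rV[R]_n -> R).
Hypothesis L2us : forall k, sq_integrable mu (us k).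
Hypothesis L2u : sq_integrable mu u.
Hypothesis us_u : weakly_cvg mu us u.
Variables (p_ : nat -> R) (c : R).
Hypothesis c0 : 0 <= c.
Hypothesis levels : forall K, exists2 k, (K <= k)%N &
  (itg mu2 (fun z => E (us k) z `^ p_ k)%R <= (m * c `^ p_ k)%:E)%E.

Let mEu : measurable_fun setT (E u).
Proof. by apply: measurable_energy_density; have [] := L2u. Qed.

Lemma liminf_below_exponent (q : R) : 1 <= q -> (\forall k \near \oo, q <= p_ k) ->
  (itg mu2 (fun z => E u z `^ q)%R <= (m * c `^ q)%:E)%E.
Proof.
move=> q1 [K0 _ HK0]; apply: (power_energy_weak_lsc q1 L2us L2u us_u) => K.
have [k Kk Hk] := levels (maxn K K0); exists k; first by rewrite (leq_trans _ Kk)// leq_maxl.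
apply: (power_level_mono _ _ q1 _ c0 Hk).
- by apply: measurable_energy_density; have [] := L2us k.
- exact: energy_density_ge0.
- by apply: HK0 => /=; rewrite (leq_trans _ Kk)// leq_maxr.
Qed.

Lemma liminf_finite_exponent (p : R) : 1 <= p -> (forall k, 1 <= p_ k) ->
  p_ k @[k --> \oo] --> p ->
  (itg mu2 (fun z => E u z `^ p)%R <= (m * c `^ p)%:E)%E.
Proof.
move=> p1 p_1 p_p.
pose q j : R := Num.max 1 (p - j.+1%:R^-1).
have q1 j : 1 <= q j by rewrite le_max lexx.
have qp j : \forall k \near \oo, q j <= p_ k.
  have : p - j.+1%:R^-1 < p by rewrite ltrBlDr ltrDl invr_gt0.
  move/(cvgr_gt _ p_p); apply: filterS => k /ltW pk.
  by rewrite ge_max p_1.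
have qcvg : q j @[j --> \oo] --> p.
  apply/cvgrPdist_le => e e0.
  have [N _ HN] := near_infty_natSinv_lt (PosNum e0).
  exists N => // j /= /HN /ltW je; have j0 : 0 < j.+1%:R^-1 :> R by rewrite invr_gt0.
  have pq : q j <= p by rewrite ge_max p1 gerBl ltW.
  rewrite ger0_norm ?subr_ge0// lerBlDr -lerBlDl.
  by rewrite le_max; apply/orP; right; rewrite lerB.
have lim_c : c `^ q j @[j --> \oo] --> c `^ p by exact: cvg_powR_exponent.
apply/lee_addgt0Pr => e e0.
apply: (@fatou_bound _ _ _ _ (fun j z => E u z `^ q j)).
- by move=> j; exact: (measurableT_comp (measurable_powR _)).
- exact: (measurableT_comp (measurable_powR _)).
- by move=> j z; exact: powR_ge0.
- by move=> z; exact: powR_ge0.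
- by apply: aeW => z; apply: cvg_powR_exponent => //; exact: energy_density_ge0.
move=> K; have mc : m * c `^ q j @[j --> \oo] --> m * c `^ p by exact: cvgMr.
have [N _ HN] : \forall j \near \oo, m * c `^ q j < m * c `^ p + e.
  by apply: (cvgr_lt _ mc); rewrite ltrDl.
exists (maxn K N); first exact: leq_maxl.
apply: (le_trans (liminf_below_exponent (q1 _) (qp _))).
by rewrite -EFinD lee_fin ltW//; apply: HN => /=; exact: leq_maxr.
Qed.

(** Markov's inequality at a level [t > c] gives the bound [(c / t) ^ q] for all
    exponents [q], hence a null set. *)
Lemma liminf_infinite_exponent : (forall q : R, \forall k \near \oo, q <= p_ k) ->
  {ae mu2, forall z, E u z <= c}.
Proof.
move=> p_oo.
have level (i : nat) : {ae mu2, forall z, E u z <= c + i.+1%:R^-1}.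
  pose t : R := c + i.+1%:R^-1.
  have ct : c < t by rewrite ltrDl invr_gt0.
  have t0 : 0 < t by exact: le_lt_trans ct.
  pose A : set ('rV[R]_n * 'rV[R]_n) := [set z | t < E u z].
  have mA : measurable A.
    rewrite (_ : A = E u @^-1` `]t, +oo[%classic); last first.
      by apply/seteqP; split=> z; rewrite /A /= in_itv/= andbT.
    by rewrite -[X in measurable X]setTI; exact: mEu.
  exists A; split => //; last by move=> z /= /negP; rewrite -ltNge.
  have Afin : mu2 A \is a fin_num.
    rewrite ge0_fin_numE//; apply: (@le_lt_trans _ _ (mu2 setT)).
      by apply: le_measure; rewrite ?inE.
    exact: finite_product_lty.
  have bound (k : nat) : fine (mu2 A) <= m * (c / t) ^+ k.+1.
    have k1 : 1 <= k.+1%:R :> R by rewrite ler1n.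
    have H := liminf_below_exponent k1 (p_oo _).
    have : ((t ^+ k.+1)%:E * mu2 A <= (m * c ^+ k.+1)%:E)%E.
      rewrite powR_mulrn// in H; apply: le_trans H.
      have tk0 : 0 <= t ^+ k.+1 by rewrite exprn_ge0// ltW.
      rewrite -(itg_indic _ mA) -itgZ//.
      apply: le_itg.
      - by apply: measurable_funM => //; exact: measurable_indic.
      - exact: (measurableT_comp (measurable_powR _)).
      - by move=> z; rewrite mulr_ge0// exprn_ge0// ltW.
      move=> z; rewrite indicE powR_mulrn ?energy_density_ge0//.
      case: (boolP (z \in A)) => [/set_mem zA|_]; last first.
        by rewrite mulr0 exprn_ge0// energy_density_ge0.
      by rewrite mulr1 lerXn2r ?nnegrE ?energy_density_ge0// ltW.
    rewrite -(fineK Afin) -EFinM lee_fin expr_div_n mulrA ler_pdivlMr ?exprn_gt0//.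
    by rewrite mulrC.
  have lim0 : m * (c / t) ^+ k.+1 @[k --> \oo] --> 0.
    rewrite -(mulr0 m) -(mulr0 (c / t)); under eq_fun do rewrite exprS.
    apply: cvgMr; apply: cvgMr; apply: cvg_expr.
    by rewrite ger0_norm ?divr_ge0 ?(ltW t0)// ltr_pdivrMr// mul1r.
  have A0 : fine (mu2 A) <= 0.
    by apply: (ler_cvg_to (cvg_cst _) lim0); apply: nearW.
  by rewrite -(fineK Afin); congr EFin; apply/eqP; rewrite eq_le A0 fine_ge0.
have := ae_foralln level; apply: filterS => z Hz.
apply/ler_addgt0Pr => e e0.
have [N _ HN] := near_infty_natSinv_lt (PosNum e0).
by apply: (le_trans (Hz N)); rewrite lerD2l; exact: ltW (HN N (leqnn N)).
Qed.

End liminf.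

Section limsup.
Variable b : R.
Hypothesis mub : {ae mu, forall x, `|x| <= b}.
Variable u : 'rV[R]_n -> R.
Hypothesis L2u : sq_integrable mu u.
Variables (p : R) (p_ : nat -> R).
Hypotheses (p1 : 1 <= p) (p_1 : forall k, 1 <= p_ k) (p_p : p_ k @[k --> \oo] --> p).
Local Notation I := (itg mu2 (fun z => E u z `^ p)%R).
Hypothesis I_fin : (I < +oo)%E.

Let energy_cvg v B : sq_integrable mu v -> (forall z, E v z <= B) ->
  itg mu2 (fun z => E v z `^ p_ k) @[k --> \oo] --> itg mu2 (fun z => E v z `^ p).
Proof.
move=> L2v vB; have [mv _] := L2v.
have [P HP] : exists P, forall k, p_ k <= P.
  have /cvg_seq_bounded[P0 [_ HP]] : cvgn p_ by apply/cvg_ex; exists p.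
  exists (P0 + 1) => k; apply: (le_trans (ler_norm _)).
  by apply: HP => //; rewrite ltrDl.
apply: (@bounded_cvg_itg _ _ _ _ (finite_product_lty mu mu) _ _ (Num.max 1 B `^ P)).
- by move=> k; exact: measurable_power_energy.
- exact: measurable_power_energy.
- move=> k z; rewrite ger0_norm ?powR_ge0//.
  apply: (@le_trans _ _ (Num.max 1 B `^ p_ k)).
    apply: ge0_ler_powR; rewrite ?nnegrE ?energy_density_ge0//.
    + exact: le_trans (p_1 k).
    + by rewrite le_max ler01.
    + by rewrite le_max vB orbT.
  by apply: ler_powR => //; rewrite le_max lexx.
- by apply: aeW => z; apply: cvg_powR_exponent => //; exact: energy_density_ge0.
Qed.

Lemma limsup_finite_exponent : exists vs : nat -> 'rV[R]_n -> R,
  [/\ forall k, sq_integrable mu (vs k),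
      norm2 mu (fun x => vs k x - u x) @[k --> \oo] --> 0 &
      forall e, 0 < e -> \forall k \near \oo,
        (itg mu2 (fun z => E (vs k) z `^ p_ k)%R <= I + e%:E)%E].
Proof.
have approx (j : nat) : exists v : 'rV[R]_n -> R,
    [/\ sq_integrable mu v, norm2 mu (fun x => v x - u x) <= j.+1%:R^-1,
     (exists B, forall z, E v z <= B) &
     (itg mu2 (fun z => E v z `^ p)%R <= I + (j.+1%:R^-1)%:E)%E].
  apply: (energy_approximation mub mg cg g0 (regular_M reg) (regular_del reg)
    (regular_beta0 reg) (regular_beta1 reg) p1 (regular_upper reg) (regular_lower reg) L2u I_fin).
  by rewrite invr_gt0.
have [v Hv] := choice approx.
have Ifin : I \is a fin_num.
  by rewrite ge0_fin_numE// itg_ge0// => z; exact: powR_ge0.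
have near_j j : \forall k \near \oo,
    (itg mu2 (fun z => E (v j) z `^ p_ k)%R <= I + (2 / j.+1%:R)%:E)%E.
  have [L2v _ [B vB] Hj] := Hv j.
  have lt1 : (itg mu2 (fun z => E (v j) z `^ p)%R < I + (2 / j.+1%:R)%:E)%E.
    apply: (le_lt_trans Hj); rewrite -(fineK Ifin) -!EFinD lte_fin ltrD2l.
    by rewrite -[ltLHS]mul1r ltr_pM2r ?invr_gt0// ltr1n.
  have ev : \forall k \near \oo,
      (itg mu2 (fun z => E (v j) z `^ p_ k)%R < I + (2 / j.+1%:R)%:E)%E.
    exact: (energy_cvg L2v vB) _ (open_ereal_lt' lt1).
  by apply: filterS ev => k /ltW.
have [jj [jj_oo Hjj]] := diagonal_choice near_j.
exists (fun k => v (jj k)); split.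
- by move=> k; have [] := Hv (jj k).
- apply/cvgrPdist_le => e e0.
  have [N _ HN] := near_infty_natSinv_lt (PosNum e0).
  apply: filterS (jj_oo N) => k Nk; rewrite sub0r normrN ger0_norm ?norm2_ge0//.
  have [_ H _ _] := Hv (jj k); apply: (le_trans H); apply: ltW; exact: HN.
- move=> e e0; have e20 : 0 < e / 2 by rewrite divr_gt0.
  have [N _ HN] := near_infty_natSinv_lt (PosNum e20).
  apply: filterS2 (jj_oo N) Hjj => k Nk Hk; apply: (le_trans Hk).
  rewrite leeD2l// lee_fin; have := HN _ Nk => /= /ltW h.
  by rewrite mulrC -ler_pdivlMr.
Qed.

End limsup.

End regular_energy.

Section functionals.
Context {R : realType} {n : nat} (Omega : bounded_lipschitz_domain R n).
Local Notation mu := (domain_measure Omega).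
Local Notation mu2 := (mu \x mu)%E.
Local Notation Omega2 := ((Omega : set 'rV[R]_n) `*` (Omega : set 'rV[R]_n)).
Variable f : 'rV[R]_n -> 'rV[R]_n -> R -> R -> R.
Hypothesis f_ge0 : forall x y, domain_set Omega x -> domain_set Omega y ->
  forall xi zeta, 0 <= f x y xi zeta.
Variables (g : 'rV[R]_n * 'rV[R]_n -> R -> R -> R) (M del beta : R).
Hypothesis reg : regular_integrand g M del beta.
Hypothesis gf : {ae leb2 R n, forall z, Omega2 z ->
  forall xi zeta, g z xi zeta = f z.1 z.2 xi zeta}.
Variable m : R.
Hypotheses (m0 : 0 < m) (mE : leb2 R n Omega2 = m%:E).
Local Notation E := (energy_density g).
Implicit Type u : LspaceType2 (leb_on Omega).

Let mass : mu2 setT = m%:E.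
Proof. by apply: (etrans (domain_measure2T Omega)); exact: mE. Qed.

Let L2 u : sq_integrable mu u.
Proof. exact: lspace_sq_integrable. Qed.

Let mL2 u : measurable_fun setT (u : 'rV[R]_n -> R).
Proof. by have [] := L2 u. Qed.

Lemma double_integralE (r : R) u :
  double_integral f r u =
    (((m^-1)%:E * itg mu2 (fun z => E u z `^ r)%R) `^ r^-1)%E.
Proof.
rewrite /double_integral [X in (X^-1)%E]mE inver gt_eqF//; congr ((_ * _) `^ _)%E.
have [N [mN N0 HN]] := gf.
rewrite -(integral_domain2 Omega); last 2 first.
- exact: (measurable_power_energy reg).
- by move=> z; exact: powR_ge0.
apply: (eq_integral_off_null _ _ mN N0).
- by move=> z _; rewrite lee_fin powR_ge0.
- by move=> z _; rewrite lee_fin powR_ge0.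
- move=> z Oz Nz; rewrite /energy_density; congr ((_ `^ _)%:E).
  by apply/esym; apply: contrapT => H; apply: Nz; apply: HN => /= /(_ Oz).
Qed.

Lemma double_integral_le (r c : R) u : 1 <= r -> 0 <= c ->
  (double_integral f r u <= c%:E)%E <->
  (itg mu2 (fun z => E u z `^ r)%R <= (m * c `^ r)%:E)%E.
Proof.
move=> r1 c0; have r0 : 0 < r by exact: lt_le_trans r1.
rewrite double_integralE.
have := itg_ge0 mu2 (fun z => powR_ge0 (E u z) r).
case: (itg mu2 _) => [J| |]//; last first.
  by move=> _; rewrite mulry gtr0_sg ?invr_gt0// mul1e poweRyr ?invr_eq0 ?gt_eqF// !leye_eq.
rewrite lee_fin => J0; rewrite -EFinM poweR_EFin !lee_fin.
have mJ0 : 0 <= m^-1 * J by rewrite mulr_ge0// invr_ge0 ltW.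
rewrite -ler_pdivrMl//; split=> H.
  rewrite -[leLHS]powRr1// -(mulVf (lt0r_neq0 r0)) powRrM.
  by apply: ge0_ler_powR; rewrite ?nnegrE ?powR_ge0// ltW.
rewrite -[leRHS]powRr1// -(mulfV (lt0r_neq0 r0)) powRrM.
by apply: ge0_ler_powR; rewrite ?nnegrE ?powR_ge0// invr_ge0 ltW.
Qed.

Lemma double_integral_ge0 (r : R) u : (0 <= double_integral f r u)%E.
Proof. exact: poweR_ge0. Qed.

Lemma supremal_le (c : R) u :
  (supremal f u <= c%:E)%E <-> {ae mu2, forall z, E u z <= c}.
Proof.
have gf' : {ae leb2_on Omega, forall z, E u z = f z.1 z.2 (u z.1) (u z.2)}.
  have [N [mN N0 HN]] := gf.
  exists (N `|` ~` Omega2); split.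
  - apply: measurableU => //; apply: measurableC.
    by apply: measurableX; exact: measurable_domain.
  - rewrite /leb2_on /= /mrestr setIUl setICl setU0.
    apply: (subset_measure0 _ mN _ N0).
      by apply: measurableI => //; apply: measurableX; exact: measurable_domain.
    exact: subIsetl.
  - move=> z /= zE; have [Oz|] := pselect (Omega2 z); last by right.
    by left; apply: HN => /= /(_ Oz) H; apply: zE; rewrite /energy_density H.
split.
  move/ess_supP => H; apply/ae_domain_measure2.
  by apply: filterS2 gf' H => z ->; rewrite lee_fin.
move/ae_domain_measure2 => H; apply/ess_supP.
by apply: filterS2 gf' H => z -> h; rewrite lee_fin.
Qed.

Lemma supremal_nonneg_level (c : R) u : (supremal f u <= c%:E)%E -> 0 <= c.
Proof.
move=> /supremal_le[A [mA A0 HA]]; rewrite leNgt; apply/negP => c0.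
have AT : A = setT.
  apply/seteqP; split=> // z _; apply: HA => /= Ec.
  by have := le_lt_trans Ec c0; rewrite ltNge (energy_density_ge0 reg).
have mass0 : m%:E = 0%E.
  by apply: etrans (esym mass) _; apply: etrans A0; congr (mu2 _); exact/esym.
by have := m0; rewrite (EFin_inj mass0) ltxx.
Qed.

Lemma weak_cvg_weakly_cvg us u : weak_cvg us u -> weakly_cvg mu us u.
Proof.
move=> us_u v L2v; have [V Vv] := lspace_of_sq_integrable L2v.
have VE (w : LspaceType2 (leb_on Omega)) :
    \int[mu]_x (w x * V x) = \int[mu]_x (w x * v x).
  rewrite /Rintegral; congr fine; apply: ae_eq_integral => //.
  - by apply/measurable_EFinP; apply: measurable_funM.
  - by apply/measurable_EFinP; apply: measurable_funM => //; have [] := L2v.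
  - by apply: filterS Vv => x -> _.
have := us_u V; rewrite VE.
by under eq_fun do rewrite VE.
Qed.

Lemma liminf_inequality (p : \bar R) (p_ : nat -> R) us u :
  (1 <= p)%E -> (forall k, 1 <= p_ k) -> (p_ k)%:E @[k --> \oo] --> p ->
  weak_cvg us u ->
  (nonlocal_functional f p u <=
    limn_einf (fun k => nonlocal_functional f (p_ k)%:E (us k)))%E.
Proof.
move=> p1 p_1 p_p /weak_cvg_weakly_cvg us_u; apply: le_limn_einf => c levels.
have c0 : 0 <= c.
  have [k _ Hk] := levels 0%N; rewrite -lee_fin; apply: le_trans Hk.
  exact: double_integral_ge0.
have {}levels K : exists2 k, (K <= k)%N &
    (itg mu2 (fun z => E (us k) z `^ p_ k)%R <= (m * c `^ p_ k)%:E)%E.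
  by have [k Kk Hk] := levels K; exists k => //; apply/double_integral_le.
have L2us k : sq_integrable mu (us k) by exact: L2.
case: p p1 p_p => [p| |]// p1 p_p.
  apply/double_integral_le => //.
  apply: (liminf_finite_exponent reg mass L2us (L2 u) us_u c0 levels) => //.
  by move/fine_cvgP : p_p => [].
apply/supremal_le.
apply: (liminf_infinite_exponent reg mass L2us (L2 u) us_u c0 levels) => q.
by move/cvgeryP/cvgryPge : p_p.
Qed.

Lemma strong_cvg_cst u : strong_cvg (fun=> u) u.
Proof.
rewrite /strong_cvg (_ : (fun k => _) = fun=> 0%E); first exact: cvg_cst.
apply/funext => k; rewrite (_ : (u \- u)%R = cst 0); last first.
  by apply/funext => x /=; rewrite subrr.
by rewrite Lnorm0.
Qed.

Lemma limsup_inequality (p : \bar R) (p_ : nat -> R) u :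
  (1 <= p)%E -> (forall k, 1 <= p_ k) -> (p_ k)%:E @[k --> \oo] --> p ->
  exists2 us, strong_cvg us u &
  (limn_esup (fun k => nonlocal_functional f (p_ k)%:E (us k)) <=
    nonlocal_functional f p u)%E.
Proof.
move=> p1 p_1 p_p.
have [Fy|Fy] := eqVneq (nonlocal_functional f p u) +oo%E.
  by exists (fun=> u); [exact: strong_cvg_cst|rewrite Fy leey].
case: p p1 p_p Fy => [p| |]// p1 p_p Fy; last first.
  exists (fun=> u); first exact: strong_cvg_cst.
  apply: limn_esup_le => c Fc; exists 0%N => k _.
  have Fc' : (supremal f u <= c%:E)%E by exact: ltW.
  have c0 := supremal_nonneg_level Fc'.
  apply/double_integral_le => //.
  apply: (@le_trans _ _ (itg mu2 (fun=> c `^ p_ k))).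
    apply: ae_le_itg => //.
    - exact: (measurable_power_energy reg).
    - by move=> z; exact: powR_ge0.
    - by move=> z; exact: powR_ge0.
    - move/supremal_le : Fc'; apply: filterS => z Ez.
      apply: ge0_ler_powR; rewrite ?nnegrE ?(energy_density_ge0 reg)//.
      exact: le_trans (p_1 k).
  rewrite le_eqVlt; apply/orP; left; apply/eqP.
  apply: (etrans (itg_cst mu2 _)); apply: (etrans (congr1 (fun t => (_ * t)%E) mass)).
  by rewrite -EFinM mulrC.
have {}p_p : p_ k @[k --> \oo] --> p by move/fine_cvgP : p_p => [].
have {}p1 : 1 <= p by rewrite -lee_fin.
have p0 : 0 < p by exact: lt_le_trans p1.
pose F := fine (double_integral f p u).
have FE : double_integral f p u = F%:E.
  by rewrite fineK// ge0_fin_numE ?double_integral_ge0// ltey.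
have F0 : 0 <= F by rewrite fine_ge0// double_integral_ge0.
have IF : (itg mu2 (fun z => E u z `^ p)%R <= (m * F `^ p)%:E)%E.
  by apply/double_integral_le => //; rewrite FE.
have [b mub] := domain_measure_bounded Omega.
have [vs [L2vs vs_u Hvs]] := limsup_finite_exponent reg mub (L2 u) p1 p_1 p_p
  (le_lt_trans IF (ltry _)).
have [us Hus] := choice (fun k => lspace_of_sq_integrable (L2vs k)).
have mvs k : measurable_fun setT (vs k) by have [] := L2vs k.
exists us.
  rewrite /strong_cvg.
  have NE k : ('N[leb_on Omega]_2[EFin \o (us k \- u)%R])%E =
      (norm2 mu (fun x => vs k x - u x))%:E.
    rewrite Lnorm2E; last by apply: sq_integrableB; exact: L2.
    congr EFin; rewrite /norm2 /Rintegral; congr (Num.sqrt (fine _)).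
    apply: ae_eq_integral => //.
    - by apply/measurable_EFinP; apply: measurable_funX; apply: measurable_funB.
    - by apply/measurable_EFinP; apply: measurable_funX; apply: measurable_funB.
    - by apply: filterS (Hus k) => x /= -> _.
  under eq_fun do rewrite NE.
  by apply/fine_cvgP; split => //; apply: nearW.
apply: limn_esup_le => c; rewrite /= FE lte_fin => Fc.
have c0 : 0 <= c by exact: le_trans (ltW Fc).
(* the gap between the levels [F] and [c], measured on the integrals *)
pose e := m * (c `^ p - F `^ p) / 2.
have e0 : 0 < e.
  rewrite divr_gt0// mulr_gt0// subr_gt0.
  by apply: gt0_ltr_powR => //; rewrite nnegrE.
have cp : m * c `^ p_ k @[k --> \oo] --> m * c `^ p.
  by apply: cvgMr; exact: cvg_powR_exponent.
have ev : \forall k \near \oo, m * F `^ p + e < m * c `^ p_ k.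
  apply: (cvgr_gt _ cp); rewrite /e mulrBr; move: e0; rewrite /e mulrBr => h; lra.
have [K _ HK] := filterI ev (Hvs _ e0).
exists K => k /HK[/= h1 h2]; apply/double_integral_le => //.
rewrite (eq_power_energy reg _ _ (mvs k) (Hus k))//.
apply: (le_trans h2); apply: (le_trans (leeD2r _ IF)).
by rewrite -EFinD lee_fin ltW.
Qed.

End functionals.

Unset Implicit Arguments.

Theorem proposition4p2 (R : realType) (n : nat) (n_gt0 : (0 < n)%N)
    (Omega : bounded_lipschitz_domain R n)
    (f : 'rV[R]_n -> 'rV[R]_n -> R -> R -> R)
    (f_ge0 : forall x y, domain_set Omega x -> domain_set Omega y ->
       forall xi zeta, 0 <= f x y xi zeta)
    (f_caratheodory : caratheodory Omega f)
    (f_growth : growth Omega f)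
    (f_separately_convex : separately_convex Omega f)
    (f_level_convex : level_convex Omega f) :
  forall p : \bar R, (1 <= p)%E ->
  forall p_ : nat -> R, (forall k, 1 <= p_ k) ->
    (fun k => (p_ k)%:E) @ \oo --> p ->
  mosco_cvg (fun k => nonlocal_functional f (p_ k)%:E)
            (@nonlocal_functional R n Omega f p).
Proof.
move=> p p1 p_ p_1 p_p.
have [g [M [del [beta [reg gf]]]]] :=
  regular_integrand_exists f_ge0 f_caratheodory f_growth f_separately_convex.
have [m m0 mE] := leb2_domain Omega.
split=> [us u us_u|u].
  exact: (liminf_inequality reg gf m0 mE p1 p_1 p_p us_u).
exact: (limsup_inequality reg gf m0 mE u p1 p_1 p_p).
Qed.
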